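(* Let $\mu$ be a probability measure on the unit circle $\partial\mathbb{D}$ with infinite support, with Verblunsky coefficients $\alpha=\{\alpha_n\}_{n=0}^\infty\in\mathbb{D}^\infty$, and let $w$ be the density of its absolutely continuous part, i.e. $d\mu = w(\theta)\frac{d\theta}{2\pi}+d\mu_{\mathrm{s}}$ with $\mu_{\mathrm{s}}$ singular with respect to Lebesgue measure. Let $S$ be the shift operator on sequences. Assume that $(S-1)(S+1)\alpha\in\ell^2$ and $\alpha\in\ell^6$. Then $$\int_0^{2\pi} (1-\cos\theta)^2(1+\cos\theta)\log w(\theta)\,\frac{d\theta}{2\pi}>-\infty$$ if and only if $(S-1)^2\alpha\in\ell^4$.
   Context: Here $\mathbb{D}=\{z\in\mathbb{C}: |z|<1\}$ and $\partial\mathbb{D}=\{e^{i\theta}:\theta\in[0,2\pi)\}$. For a probability measure $\mu$ on $\partial\mathbb{D}$ with infinite support, the Gram–Schmidt process applied to $1,z,z^2,\dots$ in $L^2(\partial\mathbb{D},d\mu)$ yields orthonormal polynomials $\varphi_n(z)$ (degree $n$, positive leading coefficient). They obey the recursion $z\varphi_n(z)=\sqrt{1-|\alpha_n|^2}\,\varphi_{n+1}(z)+\bar\alpha_n\varphi_n^*(z)$, where $\varphi_n^*(z)=z^n\overline{\varphi_n(1/\bar z)}$; the numbers $\alpha_n\in\mathbb{D}$, $n\ge 0$, are called the Verblunsky coefficients of $\mu$. (By Verblunsky's theorem, $\mu\mapsto\{\alpha_n\}_{n=0}^\infty$ is a bijection from such measures onto $\mathbb{D}^\infty$.) The shift operator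 $S$ acts on complex sequences by $(Sx)_n=x_{n+1}$, $n\ge0$; polynomials in $S$ are understood accordingly, with $1$ the identity. $\ell^p$ denotes the space of $p$-summable complex sequences indexed by $n\ge 0$. Since $\log w\le w-1$ with $w\in L^1$, the integral is well defined as an element of $[-\infty,\infty)$ (with $\log 0=-\infty$). *)

(* Defs.v *)
From HB Require Import structures.
From mathcomp Require Import all_boot all_order all_algebra.
From mathcomp Require Export complex.
From mathcomp Require Import all_classical all_reals all_analysis.

Set Implicit Arguments.
Unset Strict Implicit.
Unset Printing Implicit Defensive.

Import Order.TTheory GRing.Theory Num.Theory.
Import numFieldNormedType.Exports.

Local Open Scope classical_set_scope.
Local Open Scope ring_scope.
Local Open Scope complex_scope.

(* [R[i]] with the topology of its norm; balls have radii [e : R[i]] with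
   [0 < e], which forces [e] to be a positive real. *)
HB.instance Definition _ (R : rcfType) :=
  NormedModule.copy R[i] (R[i] : numFieldType)^o.

Notation borelC R := (g_sigma_algebraType (@open (complex R))).

Section Circle.
Variable R : realType.
Implicit Types (theta : R) (w : R -> R).

Definition unit_circle : set R[i] := [set z | `|z| = 1].

Definition expi theta : R[i] := cos theta +i* sin theta.

(* Measures on the circle are Borel measures on the plane which do not charge
   the complement of the circle. *)
Definition on_unit_circle (mu : probability (borelC R) R) : Prop :=
  mu (unit_circle : set (borelC R)) = 1%E.

Definition measure_support (mu : {measure set (borelC R) -> \bar R}) :
    set R[i] :=
  [set z | forall U : set R[i], open U -> U z ->
           (0 < mu (U : set (borelC R)))%E].

Definition angles (A : set (borelC R)) : set R :=
  `[0, 2 * pi[ `&` expi @^-1` A.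

Definition singular_circle (nu : {measure set (borelC R) -> \bar R}) : Prop :=
  exists N : set (borelC R), [/\ measurable N,
    (lebesgue_measure (angles N) = 0)%E & nu (~` N) = 0%E].

(* d mu = w(theta) d theta / (2 pi) + d mu_s with mu_s singular; only the values
   of [w] on [0, 2 pi[ matter. *)
Definition ac_density (mu : probability (borelC R) R) w : Prop :=
  [/\ measurable_fun (`[0, 2 * pi[ : set R) w,
      forall theta, theta \in `[0, 2 * pi[ -> 0 <= w theta
    & exists mu_s : {measure set (borelC R) -> \bar R},
        singular_circle mu_s /\
        forall A : set (borelC R), measurable A ->
          mu A = (\int[lebesgue_measure]_(theta in angles A)
                    (w theta / (2 * pi))%:E + mu_s A)%E].

End Circle.

Section OrthogonalPolynomials.
Variables (R : realType) (mu : probability (borelC R) R).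

Definition integralC (f : borelC R -> R[i]) : R[i] :=
  (\int[mu]_z complex.Re (f z)) +i* (\int[mu]_z complex.Im (f z)).

Definition dotp (p q : {poly R[i]}) : R[i] :=
  integralC (fun z => (p.[z])^* * q.[z]).

(* The Gram-Schmidt process applied to 1, z, ..., z^(n - 1). *)
Fixpoint gram_schmidt (n : nat) : seq {poly R[i]} :=
  if n is m.+1 then
    let s := gram_schmidt m in
    let p := 'X^m - \sum_(q <- s) dotp q 'X^m *: q in
    rcons s ((sqrtC (dotp p p))^-1 *: p)
  else [::].

Definition orthopoly (n : nat) : {poly R[i]} := last 0 (gram_schmidt n.+1).

Definition reversed_poly (n : nat) (p : {poly R[i]}) (z : R[i]) : R[i] :=
  z ^+ n * (p.[(z^*)^-1])^*.

(* The recursion is an identity between polynomials in z; as [reversed_poly] is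
   written with 1 / z^*, it is stated for nonzero z. *)
Definition verblunsky (alpha : nat -> R[i]) : Prop :=
  forall n, `|alpha n| < 1 /\
    forall z : R[i], z != 0 ->
      z * (orthopoly n).[z] =
        sqrtC (1 - `|alpha n| ^+ 2) * (orthopoly n.+1).[z]
        + (alpha n)^* * reversed_poly n (orthopoly n) z.

End OrthogonalPolynomials.

Section Sequences.
Variable R : realType.

Definition shift_seq (x : nat -> R[i]) : nat -> R[i] := fun n => x n.+1.

Definition ell (p : nat) (x : nat -> R[i]) : Prop :=
  (\sum_(0 <= n <oo) (ComplexField.Normc.normc (x n) ^+ p)%:E < +oo)%E.

End Sequences.

(* Main.v *)
Require Import Defs.
From HB Require Import structures.
From mathcomp Require Import all_boot all_order all_algebra.
From mathcomp Require Import all_classical all_reals all_analysis.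
From mathcomp Require Import measurable_realfun ring lra.

(* For mu_N = D_N |Phi_N^*|^-2 dtheta/2pi (the Bernstein-Szego approximant of mu),
   the entropy F_N = int q log(D_N |Phi_N^*|^-2) dtheta/2pi with weight
   q = (1 - cos)^2 (1 + cos) depends only on D_N and on the first three Taylor
   coefficients of log Phi_N^*, because Phi_N^* has no zeros in the closed disk.
   The Szego recursion then gives F_(N+1) - F_N in terms of
   alpha_N, ..., alpha_(N-3); under the two summability hypotheses it equals
   - |alpha_N - alpha_(N-1)|^4 / 8 up to telescoping and summable terms, so that
   F_N is bounded below iff (S - 1) alpha, equivalently (S - 1)^2 alpha, is in l^4.
   If the log integral of w is finite then F_N is bounded below, because
   int |Phi_N|^2 / D_N dmu = 1 and log x <= x.  Conversely, mu_N has the same moments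
   as mu up to order N, and log x <= x yields
   int q log f dtheta/2pi <= sup_N (- F_N) + int q f dmu for every bounded f >= 1,
   first for uniform limits of trigonometric polynomials and then by density; taking
   for f truncations of 1/w off a null set carrying mu_s gives the finiteness. *)

Set Implicit Arguments.
Unset Strict Implicit.
Unset Printing Implicit Defensive.

Import Order.TTheory GRing.Theory Num.Theory.
Import numFieldNormedType.Exports.

Local Open Scope classical_set_scope.
Local Open Scope ring_scope.

(** * Complex numbers and Borel measurability *)

(** The increment of F_N contains quadratic terms in alpha, which membership in l^6 alone cannot
    sum; what saves the argument is that alpha is nearly 2-periodic. With x, y, u, v standing for
    alpha_N, ..., alpha_(N-3), putting u = x and v = y in the increment leaves, modulo telescoping,
    only - |x - y|^4 / 8 and terms of degree at least six. The error of this substitution consists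
    of quadratic terms with two factors among x - u and y - v, and of quartic terms with one such
    factor; 2 t^3 e <= e^2 + t^6 splits the latter between the l^2 and the l^6 hypothesis. The
    passage from mu_N to mu is arranged as a duality: log x <= x plays the part of the upper
    semicontinuity of the entropy, and mu_N enters through its moments, so that no limit of the
    densities of mu_N is ever taken. *)

Section Complex.
Variable R : realType.
Implicit Types z w : R[i].
Local Notation Re := (@complex.Re R).
Local Notation Im := (@complex.Im R).
Local Notation conj := (@conjc R).

(** Moduli of [R[i]] are themselves elements of [R[i]]; this real-valued square keeps estimates in
    [R] and is polynomial in the coordinates, within reach of [ring] and [field]. *)
Definition normsq z : R := Re z ^+ 2 + Im z ^+ 2.

Lemma ReD z w : Re (z + w) = Re z + Re w. Proof. by case: z w => [a b] [c d]. Qed.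
Lemma ImD z w : Im (z + w) = Im z + Im w. Proof. by case: z w => [a b] [c d]. Qed.
Lemma ReN z : Re (- z) = - Re z. Proof. by case: z. Qed.
Lemma ImN z : Im (- z) = - Im z. Proof. by case: z. Qed.
Lemma ReM z w : Re (z * w) = Re z * Re w - Im z * Im w.
Proof. by case: z w => [a b] [c d]. Qed.
Lemma ImM z w : Im (z * w) = Re z * Im w + Im z * Re w.
Proof. by case: z w => [a b] [c d]. Qed.
Lemma Re_conj z : Re (conj z) = Re z. Proof. by case: z. Qed.
Lemma Im_conj z : Im (conj z) = - Im z. Proof. by case: z. Qed.
Lemma Re_inv z : Re z^-1 = Re z / normsq z. Proof. by case: z. Qed.
Lemma Im_inv z : Im z^-1 = - Im z / normsq z.
Proof. by case: z => a b; rewrite mulNr. Qed.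
Lemma Re_sum (I : Type) (s : seq I) (P : pred I) (F : I -> R[i]) :
  Re (\sum_(i <- s | P i) F i) = \sum_(i <- s | P i) Re (F i).
Proof. by elim/big_rec2: _ => // i x y _ <-; rewrite ReD. Qed.
Lemma Im_sum (I : Type) (s : seq I) (P : pred I) (F : I -> R[i]) :
  Im (\sum_(i <- s | P i) F i) = \sum_(i <- s | P i) Im (F i).
Proof. by elim/big_rec2: _ => // i x y _ <-; rewrite ImD. Qed.

Lemma complex_eq z w : Re z = Re w -> Im z = Im w -> z = w.
Proof. by case: z w => [a b] [c d] /= -> ->. Qed.

Lemma normsq_ge0 z : 0 <= normsq z.
Proof. by rewrite addr_ge0 ?sqr_ge0. Qed.
Lemma normsqE z : (normsq z)%:C%C = z * conj z.
Proof. by case: z => a b; apply: complex_eq; rewrite /normsq /=; ring. Qed.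
Lemma normsqM z w : normsq (z * w) = normsq z * normsq w.
Proof. by rewrite /normsq ReM ImM; ring. Qed.
Lemma normsq1 : normsq 1 = 1. Proof. by rewrite /normsq /= expr1n expr0n addr0. Qed.
Lemma normsqX z n : normsq (z ^+ n) = normsq z ^+ n.
Proof. by elim: n => [|n IH]; rewrite ?normsq1// !exprS normsqM IH. Qed.
Lemma normsq_conj z : normsq (conj z) = normsq z.
Proof. by rewrite /normsq Re_conj Im_conj sqrrN. Qed.
Lemma normsq_eq0 z : (normsq z == 0) = (z == 0).
Proof.
by rewrite paddr_eq0 ?sqr_ge0// !sqrf_eq0; case: z => a b; rewrite eq_complex.
Qed.
Lemma normsq_gt0 z : (0 < normsq z) = (z != 0).
Proof. by rewrite lt_def normsq_eq0 normsq_ge0 andbT. Qed.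
Lemma normsqV z : normsq z^-1 = (normsq z)^-1.
Proof.
have [->|z0] := eqVneq z 0; first by rewrite invr0 /normsq /= expr0n addr0 invr0.
apply: (mulfI (x := normsq z)); first by rewrite normsq_eq0.
by rewrite -normsqM !divff ?normsq_eq0 ?normsq1.
Qed.
Lemma normsq_norm z : (normsq z)%:C%C = `|z| ^+ 2.
Proof. by rewrite -add_Re2_Im2. Qed.
Lemma normsq_normc z : normsq z = ComplexField.Normc.normc z ^+ 2.
Proof. by case: z => a b; rewrite /= sqr_sqrtr// addr_ge0 ?sqr_ge0. Qed.
Lemma normcE z : (ComplexField.Normc.normc z)%:C%C = `|z|.
Proof. by rewrite normc_def; case: z. Qed.

Lemma normc_ge0 z : 0 <= ComplexField.Normc.normc z.
Proof. by case: z => a b; rewrite /= sqrtr_ge0. Qed.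
Lemma Re_le_normc z : `|Re z| <= ComplexField.Normc.normc z.
Proof. by rewrite -lecR normcE normc_ge_Re. Qed.
Lemma Im_le_normc z : `|Im z| <= ComplexField.Normc.normc z.
Proof.
have := Re_le_normc (z * 'i%C).
rewrite ReM /= mulr0 mulr1 sub0r normrN => /le_trans -> //.
by rewrite -lecR normcE normrM -normcE -[`|'i%C|]normcE /= expr0n expr1n add0r
  sqrtr1 mulr1.
Qed.
Lemma le_normc_ReIm z : ComplexField.Normc.normc z <= `|Re z| + `|Im z|.
Proof.
rewrite -lecR normcE.
have -> : z = (Re z)%:C%C + (Im z)%:C%C * 'i%C.
  by apply: complex_eq; rewrite ?ReD ?ImD ?ReM ?ImM /=; ring.
apply: le_trans (ler_normD _ _) _.
rewrite normrM -!normcE /= !expr0n expr1n add0r !addr0 !sqrtr_sqr sqrtr1.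
by rewrite mulr1 -[_%:C%C + _]rmorphD lecR !mulr0 mul0r subr0 !addr0 mulr1 add0r.
Qed.

Lemma circleE z : @unit_circle R z <-> normsq z = 1.
Proof.
rewrite /unit_circle /=; split => [h|h].
  by apply: complexI; rewrite normsq_norm h expr1n.
by apply/eqP; rewrite -(@eqrXn2 _ 2)// expr1n -normsq_norm h.
Qed.
Lemma circle_conj z : @unit_circle R z -> conj z = z^-1.
Proof.
move/circleE => h; have z0 : z != 0 by rewrite -normsq_gt0 h ltr01.
by apply: (mulfI z0); rewrite divff// -normsqE h.
Qed.
Lemma circle_neq0 z : @unit_circle R z -> z != 0.
Proof. by move/circleE => h; rewrite -normsq_gt0 h ltr01. Qed.
Lemma normsq_expi t : normsq (expi t) = 1.
Proof. by rewrite /normsq /expi /= cos2Dsin2. Qed.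
Lemma circle_expi t : @unit_circle R (expi t). Proof. exact/circleE/normsq_expi. Qed.

Lemma normsq_expand u : normsq (1 - u) = 1 - 2 * Re u + normsq u.
Proof. by rewrite /normsq ReD ImD ReN ImN /=; ring. Qed.
End Complex.

Section Measurability.
Variable R : realType.
Local Notation Re := (@complex.Re R).
Local Notation Im := (@complex.Im R).

Lemma open_measurableC (U : set R[i]) : open U -> measurable (U : set (borelC R)).
Proof. by move=> oU; apply: sub_gen_smallest. Qed.

Lemma continuousC_lip (f : R[i] -> R) :
  (forall z w, `|f z - f w| <= ComplexField.Normc.normc (z - w)) -> continuous f.
Proof.
move=> lf z; apply: (proj2 (@cvgrPdist_lt _ _ _ _ (nbhs_filter z) _ _)) => e e0.
near=> w.
apply: le_lt_trans (lf _ _) _; rewrite -ltcR normcE.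
near: w; exists e%:C%C => //=; by rewrite ltcR.
Unshelve. all: by end_near. Qed.

Lemma measurable_continuousC (f : R[i] -> R) :
  continuous f -> measurable_fun setT (f : borelC R -> R).
Proof.
move=> cf; apply: (measurability _ (RGenOInfty.measurableE R)) => //.
move=> _ [_ [x ->] <-]; rewrite setTI; apply: open_measurableC.
by apply: open_comp => [? _|]; [exact: cf|exact: interval_open].
Qed.

Lemma measurable_Re : measurable_fun setT (Re : borelC R -> R).
Proof.
apply: measurable_continuousC; apply: continuousC_lip => z w.
by rewrite -ReN -ReD Re_le_normc.
Qed.
Lemma measurable_Im : measurable_fun setT (Im : borelC R -> R).
Proof.
apply: measurable_continuousC; apply: continuousC_lip => z w.
by rewrite -ImN -ImD Im_le_normc.
Qed.

Lemma expi_continuous : continuous (@expi R : R -> R[i]).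
Proof.
move=> t; apply/cvgrPdist_lt => -[e e'].
rewrite ltcE /= => /andP[/eqP -> e0]; near=> s.
rewrite -normcE ltcR; apply: le_lt_trans (le_normc_ReIm _) _ => /=.
rewrite [ltRHS]splitr ltrD//; near: s.
  by have /cvgrPdist_lt := @continuous_cos R t; apply; rewrite divr_gt0.
by have /cvgrPdist_lt := @continuous_sin R t; apply; rewrite divr_gt0.
Unshelve. all: by end_near. Qed.

Lemma measurable_expi : measurable_fun setT (@expi R : R -> borelC R).
Proof.
apply: (@measurability _ _ R (borelC R) setT (@expi R) (@open R[i])) => //.
move=> _ [U oU <-]; rewrite setTI; apply: open_measurable.
by apply: open_comp => // ? _; exact: expi_continuous.
Qed.

Definition cmeasurable (f : borelC R -> R[i]) :=
  measurable_fun setT (Re \o f) /\ measurable_fun setT (Im \o f).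

Lemma cmeasurable_id : cmeasurable id.
Proof. by split; [exact: measurable_Re|exact: measurable_Im]. Qed.
Lemma cmeasurable_cst c : cmeasurable (cst c).
Proof. by split; exact: measurable_cst. Qed.
Lemma cmeasurableD f g : cmeasurable f -> cmeasurable g -> cmeasurable (f \+ g).
Proof.
move=> [f1 f2] [g1 g2]; split.
- by rewrite (_ : _ \o _ = (Re \o f) \+ (Re \o g));
    [exact: measurable_funD|apply/funext => z; rewrite /= ReD].
- by rewrite (_ : _ \o _ = (Im \o f) \+ (Im \o g));
    [exact: measurable_funD|apply/funext => z; rewrite /= ImD].
Qed.
Lemma cmeasurableM f g : cmeasurable f -> cmeasurable g -> cmeasurable (f \* g).
Proof.
move=> [f1 f2] [g1 g2]; split.
- rewrite (_ : _ \o _ = (Re \o f) \* (Re \o g) \- (Im \o f) \* (Im \o g)).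
    by apply: measurable_funB; exact: measurable_funM.
  by apply/funext => z; rewrite /= ReM.
- rewrite (_ : _ \o _ = (Re \o f) \* (Im \o g) \+ (Im \o f) \* (Re \o g)).
    by apply: measurable_funD; exact: measurable_funM.
  by apply/funext => z; rewrite /= ImM.
Qed.
Lemma cmeasurable_horner (p : {poly R[i]}) : cmeasurable (fun z => p.[z]).
Proof.
elim/poly_ind: p => [|p c IH].
  rewrite (_ : (fun _ => _) = cst 0); first exact: cmeasurable_cst.
  by apply/funext => z; rewrite horner0.
rewrite (_ : (fun _ => _) = (fun z => p.[z]) \* id \+ cst c).
  apply: cmeasurableD; last exact: cmeasurable_cst.
  by apply: cmeasurableM => //; exact: cmeasurable_id.
by apply/funext => z; rewrite hornerMXaddC.
Qed.
Lemma measurable_normsq f : cmeasurable f ->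
  measurable_fun setT (fun z => normsq (f z)).
Proof.
by move=> [f1 f2]; apply: measurable_funD; exact: measurable_funX.
Qed.
Lemma measurable_inv (f : borelC R -> R) : measurable_fun setT f ->
  measurable_fun setT (fun z => (f z)^-1).
Proof.
move=> mf; apply: (measurableT_comp _ mf).
rewrite -(setvU [set (0 : R)]); apply/measurable_funU => //.
  exact: measurableC.
split; last exact: measurable_fun_set1.
apply: open_continuous_measurable_fun; first exact: closed_openC.
by move=> x /set_mem /= /eqP x0; exact: inv_continuous.
Qed.
Lemma cmeasurable_inv f : cmeasurable f -> cmeasurable (fun z => (f z)^-1).
Proof.
move=> mf; have [f1 f2] := mf; split.
- rewrite (_ : _ \o _ = (Re \o f) \* (fun z => (normsq (f z))^-1)).
    by apply: measurable_funM => //; apply: measurable_inv; exact: measurable_normsq.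
  by apply/funext => z; rewrite /= Re_inv.
- rewrite (_ : _ \o _ = \- (Im \o f) \* (fun z => (normsq (f z))^-1)).
    apply: measurable_funM; first exact: measurable_funN.
    by apply: measurable_inv; exact: measurable_normsq.
  by apply/funext => z; rewrite /= Im_inv.
Qed.
End Measurability.

(** * Bounded Borel functions on the circle and their means *)

Section Admissible.
Variable R : realType.
Local Notation circle := (@unit_circle R).
Implicit Types f g : borelC R -> R.

Lemma measurable_circle : measurable (circle : set (borelC R)).
Proof.
have -> : circle = setT `&` (@normsq R \o id) @^-1` [set 1].
  by apply/seteqP; split => z /= => [/circleE|[_ /circleE]].
apply: (measurable_normsq (@cmeasurable_id R)) => //.
Qed.

(** Boundedness is asked on the circle only, since polynomials are unbounded on the plane;
    measurability is asked everywhere, so that integrals over the plane and over the circle can be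
    exchanged. *)
Definition admissible f :=
  measurable_fun setT f /\ exists M, forall z, circle z -> `|f z| <= M.

Lemma admissible_cst c : admissible (cst c).
Proof. by split; [exact: measurable_cst|exists `|c|]. Qed.
Lemma admissibleD f g : admissible f -> admissible g ->
  admissible (fun z => f z + g z).
Proof.
move=> [mf [M fM]] [mg [N gN]]; split; first exact: measurable_funD.
by exists (M + N) => z cz; rewrite (le_trans (ler_normD _ _))// lerD ?fM ?gN.
Qed.
Lemma admissibleM f g : admissible f -> admissible g ->
  admissible (fun z => f z * g z).
Proof.
move=> [mf [M fM]] [mg [N gN]]; split; first exact: measurable_funM.
by exists (M * N) => z cz; rewrite normrM ler_pM ?fM ?gN.
Qed.
Lemma admissibleZ c f : admissible f -> admissible (fun z => c * f z).
Proof. by move=> af; apply: admissibleM => //; exact: admissible_cst. Qed.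
Lemma admissibleN f : admissible f -> admissible (fun z => - f z).
Proof.
move=> /(admissibleZ (-1)); congr admissible.
by apply/funext => z; rewrite mulN1r.
Qed.
Lemma admissibleB f g : admissible f -> admissible g ->
  admissible (fun z => f z - g z).
Proof. by move=> af ag; apply: admissibleD => //; exact: admissibleN. Qed.
Lemma admissible_norm f : admissible f -> admissible (fun z => `|f z|).
Proof.
move=> [mf [M fM]]; split; first exact: measurableT_comp.
by exists M => z /fM; rewrite normr_id.
Qed.
Lemma admissible_sum (I : Type) (s : seq I) (F : I -> borelC R -> R) :
  (forall i, admissible (F i)) -> admissible (fun z => \sum_(i <- s) F i z).
Proof.
move=> aF; elim: s => [|i s IH].
  by under eq_fun do rewrite big_nil; exact: admissible_cst.
by under eq_fun do rewrite big_cons; exact: admissibleD.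
Qed.
End Admissible.

Section Expect.
Variables (R : realType) (P : probability (borelC R) R).
Hypothesis P_circle : on_unit_circle P.
Local Notation circle := (@unit_circle R).
Implicit Types f g : borelC R -> R.

Definition expect f : R := \int[P]_(z in circle) f z.

Lemma integrable_admissible f : admissible f ->
  P.-integrable circle (EFin \o f).
Proof.
move=> [mf [M fM]]; apply: measurable_bounded_integrable.
- exact: measurable_circle.
- exact: (eq_ind_r (fun x => (x < +oo)%E) (ltry 1) P_circle).
- exact: measurable_funTS.
- exists M; split; rewrite ?num_real// => x Mx z /fM /le_trans; apply; exact: ltW.
Qed.

Lemma expect_eq f g : (forall z, circle z -> f z = g z) -> expect f = expect g.
Proof. by move=> fg; apply: eq_Rintegral => z /set_mem /fg. Qed.
Lemma expectD f g : admissible f -> admissible g ->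
  expect (fun z => f z + g z) = expect f + expect g.
Proof.
by move=> af ag; apply: RintegralD; first exact: measurable_circle;
  exact: integrable_admissible.
Qed.
Lemma expectB f g : admissible f -> admissible g ->
  expect (fun z => f z - g z) = expect f - expect g.
Proof.
by move=> af ag; apply: RintegralB; first exact: measurable_circle;
  exact: integrable_admissible.
Qed.
Lemma expectZ c f : admissible f -> expect (fun z => c * f z) = c * expect f.
Proof.
by move=> af; apply: RintegralZl; first exact: measurable_circle;
  exact: integrable_admissible.
Qed.
Lemma expectN f : admissible f -> expect (fun z => - f z) = - expect f.
Proof.
by move=> af; rewrite -mulN1r -expectZ//; apply: expect_eq => z _; rewrite mulN1r.
Qed.
Lemma expect_cst c : expect (fun=> c) = c.
Proof.
rewrite /expect Rintegral_cst; last exact: measurable_circle.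
exact: etrans (congr1 (fun x => c * fine x) P_circle) (mulr1 c).
Qed.
Lemma expect_le f g : admissible f -> admissible g ->
  (forall z, circle z -> f z <= g z) -> expect f <= expect g.
Proof.
move=> af ag fg; exact: (@le_Rintegral _ (borelC R) R P circle f g
  (@measurable_circle R) (integrable_admissible af) (integrable_admissible ag) fg).
Qed.
Lemma expect_ge0 f : (forall z, circle z -> 0 <= f z) -> 0 <= expect f.
Proof. by move=> f0; apply: Rintegral_ge0. Qed.
Lemma expect_norm_le f M : admissible f ->
  (forall z, circle z -> `|f z| <= M) -> `|expect f| <= M.
Proof.
move=> af fM; rewrite ler_norml -{1}(expect_cst (- M)) -{2}(expect_cst M).
by rewrite !expect_le//; try exact: admissible_cst;
  move=> z /fM; rewrite ler_norml => /andP[].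
Qed.
Lemma expect_dist_le f g e : admissible f -> admissible g ->
  (forall z, circle z -> `|f z - g z| <= e) -> `|expect f - expect g| <= e.
Proof.
by move=> af ag fg; rewrite -expectB//; apply: expect_norm_le => //; exact: admissibleB.
Qed.
Lemma expect_sum (I : Type) (s : seq I) (F : I -> borelC R -> R) :
  (forall i, admissible (F i)) ->
  expect (fun z => \sum_(i <- s) F i z) = \sum_(i <- s) expect (F i).
Proof.
move=> aF; elim: s => [|i s IH].
  rewrite big_nil -[RHS](expect_cst 0).
  by apply: expect_eq => z _; rewrite big_nil.
rewrite big_cons -IH -expectD//; last exact: admissible_sum.
by apply: expect_eq => z _; rewrite big_cons.
Qed.

Lemma off_circle_null : P (~` circle) = 0%E.
Proof.
rewrite probability_setC; last exact: measurable_circle.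
by apply: etrans (congr1 (fun x => 1 - x)%E P_circle) _; rewrite subee.
Qed.

Lemma ge0_integral_circle (f : borelC R -> \bar R) :
  measurable_fun setT f -> (forall z, 0 <= f z)%E ->
  (\int[P]_z f z = \int[P]_(z in circle) f z)%E.
Proof.
move=> mf f0; rewrite (@ge0_negligible_integral _ (borelC R) R P setT (~` circle) f)//.
- by rewrite setTD setCK.
- by apply: measurableC; exact: measurable_circle.
- exact: off_circle_null.
Qed.

Lemma integrable_circle (f : borelC R -> \bar R) : measurable_fun setT f ->
  P.-integrable circle f -> P.-integrable setT f.
Proof.
move=> mf /integrableP[_ fi]; apply/integrableP; split => //.
rewrite ge0_integral_circle//; exact: measurableT_comp.
Qed.

Lemma EFin_expect f : admissible f ->
  (expect f)%:E = (\int[P]_(z in circle) (f z)%:E)%E.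
Proof.
move=> af; rewrite /expect /Rintegral fineK//.
apply: integrable_fin_num; [exact: measurable_circle|exact: integrable_admissible].
Qed.

Lemma Rintegral_expect f : admissible f -> \int[P]_z f z = expect f.
Proof.
move=> af; rewrite /expect /Rintegral; congr fine.
rewrite (@negligible_integral _ _ _ P setT (~` circle))//.
- by rewrite setTD setCK.
- by apply: measurableC; exact: measurable_circle.
- apply: integrable_circle; last exact: integrable_admissible.
  by case: af => mf _; exact/measurable_EFinP.
- exact: off_circle_null.
Qed.
End Expect.

Section ComplexExpect.
Variable R : realType.
Local Notation circle := (@unit_circle R).
Local Notation Re := (@complex.Re R).
Local Notation Im := (@complex.Im R).
Implicit Types f g : borelC R -> R[i].

Definition cadmissible f :=
  admissible (fun z => Re (f z)) /\ admissible (fun z => Im (f z)).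

Lemma cadmissible_cst c : cadmissible (fun=> c).
Proof. by split; exact: admissible_cst. Qed.
Lemma cadmissibleD f g : cadmissible f -> cadmissible g ->
  cadmissible (fun z => f z + g z).
Proof.
move=> [f1 f2] [g1 g2]; split.
- by under eq_fun do rewrite /= ReD; exact: admissibleD.
- by under eq_fun do rewrite /= ImD; exact: admissibleD.
Qed.
Lemma cadmissibleM f g : cadmissible f -> cadmissible g ->
  cadmissible (fun z => f z * g z).
Proof.
move=> [f1 f2] [g1 g2]; split.
- under eq_fun do rewrite /= ReM.
  by apply: admissibleB; exact: admissibleM.
- under eq_fun do rewrite /= ImM.
  by apply: admissibleD; exact: admissibleM.
Qed.
Lemma cadmissible_conj f : cadmissible f -> cadmissible (fun z => conjc (f z)).
Proof.
move=> [f1 f2]; split.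
- by under eq_fun do rewrite /= Re_conj.
- by under eq_fun do rewrite /= Im_conj; exact: admissibleN.
Qed.
Lemma admissible_normsq f : cadmissible f -> admissible (fun z => normsq (f z)).
Proof.
by move=> [f1 f2]; apply: admissibleD; under eq_fun do rewrite expr2;
  exact: admissibleM.
Qed.
Lemma cadmissible_id : cadmissible id.
Proof.
by split; split; [exact: measurable_Re| |exact: measurable_Im|];
  exists 1 => z /circleE /=; rewrite /normsq => h;
  rewrite -(@expr_le1 _ 2)// real_normK ?num_real// -h ?lerDl ?lerDr sqr_ge0.
Qed.
Lemma cadmissible_horner (p : {poly R[i]}) : cadmissible (fun z => p.[z]).
Proof.
elim/poly_ind: p => [|p c IH].
  by under eq_fun do rewrite horner0; exact: cadmissible_cst.
under eq_fun do rewrite hornerMXaddC.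
apply: cadmissibleD; last exact: cadmissible_cst.
by apply: cadmissibleM => //; exact: cadmissible_id.
Qed.
Lemma cadmissible_exp n : cadmissible (fun z => z ^+ n).
Proof. by have := cadmissible_horner 'X^n; under eq_fun do rewrite hornerXn. Qed.

Variables (P : probability (borelC R) R).
Hypothesis P_circle : on_unit_circle P.

Definition cexpect f : R[i] :=
  (expect P (fun z => Re (f z)) +i* expect P (fun z => Im (f z)))%C.

Lemma integralC_cexpect f : cadmissible f -> integralC P f = cexpect f.
Proof.
by move=> [f1 f2]; rewrite /integralC /cexpect -!(Rintegral_expect P_circle).
Qed.
Lemma cexpect_eq f g : (forall z, circle z -> f z = g z) -> cexpect f = cexpect g.
Proof.
by move=> fg; congr (_ +i* _)%C; apply: expect_eq => z /fg /= ->.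
Qed.
Lemma cexpectD f g : cadmissible f -> cadmissible g ->
  cexpect (fun z => f z + g z) = cexpect f + cexpect g.
Proof.
move=> [f1 f2] [g1 g2]; apply: complex_eq; rewrite ?ReD ?ImD /= -expectD//;
  by apply: expect_eq => z _ /=; rewrite ?ReD ?ImD.
Qed.
Lemma cexpectZ c f : cadmissible f -> cexpect (fun z => c * f z) = c * cexpect f.
Proof.
move=> [f1 f2]; apply: complex_eq; rewrite ?ReM ?ImM /= -!expectZ// -?expectD -?expectB//;
  try exact: admissibleZ; by apply: expect_eq => z _ /=; rewrite ?ReM ?ImM.
Qed.
Lemma cexpect_cst c : cexpect (fun=> c) = c.
Proof. by apply: complex_eq => /=; rewrite expect_cst. Qed.
Lemma cexpect_conj f : cadmissible f ->
  cexpect (fun z => conjc (f z)) = conjc (cexpect f).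
Proof.
move=> [f1 f2]; apply: complex_eq; rewrite /= ?Re_conj ?Im_conj /= -?expectN//;
  by apply: expect_eq => z _ /=; rewrite ?Re_conj ?Im_conj.
Qed.
Lemma cexpect_sum (I : Type) (s : seq I) (F : I -> borelC R -> R[i]) :
  (forall i, cadmissible (F i)) ->
  cexpect (fun z => \sum_(i <- s) F i z) = \sum_(i <- s) cexpect (F i).
Proof.
move=> aF; apply: complex_eq; rewrite ?Re_sum ?Im_sum -expect_sum//;
  try by [move=> i; case: (aF i)]; by apply: expect_eq => z _ /=; rewrite ?Re_sum ?Im_sum.
Qed.
End ComplexExpect.

(** * Normalized arc length *)

Section CircleMeasure.
Variable R : realType.
Local Notation circle := (@unit_circle R).

Lemma pi2_gt0 : 0 < 2 * pi :> R.
Proof. by rewrite mulr_gt0// pi_gt0. Qed.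

Let measurable_expiR :
  measurable_fun setT (@expi R : measurableTypeR R -> borelC R).
Proof. exact: measurable_expi. Qed.

Definition expi_mfun : {mfun measurableTypeR R >-> borelC R} :=
  mfun_Sub (mem_set measurable_expiR).

(** Arc length divided by [2 pi], as the law of [expi] under the uniform distribution on
    [[0, 2 pi]]; it thus lives on the same Borel plane as [mu]. *)
Definition circle_measure : probability (borelC R) R :=
  distribution (uniform_prob pi2_gt0) expi_mfun.

Lemma circle_measureE A : circle_measure A = uniform_prob pi2_gt0 (@expi R @^-1` A).
Proof. by []. Qed.

Lemma circle_measure_circle : on_unit_circle circle_measure.
Proof.
rewrite /on_unit_circle circle_measureE.
rewrite (_ : _ @^-1` _ = setT) ?probability_setT//.
by apply/seteqP; split => // t _; exact: circle_expi.
Qed.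

Lemma ge0_integral_circle_measure (f : borelC R -> \bar R) :
  measurable_fun setT f -> (forall z, 0 <= f z)%E ->
  (\int[circle_measure]_z f z =
   (2 * pi)^-1%:E * \int[lebesgue_measure]_(t in `[0%R, (2 * pi)%R[) f (expi t))%E.
Proof.
move=> mf f0; rewrite ge0_integral_distribution// integral_uniform.
- rewrite subr0 integral_itv_bndo_bndc//.
  by apply: measurable_funTS; apply: measurableT_comp mf _; exact: measurable_expi.
- by apply: measurableT_comp mf _; exact: measurable_expi.
- by move=> t; exact: f0.
Qed.
End CircleMeasure.

(** * Fourier moments of the normalized Lebesgue measure *)

Lemma is_derive1_comp (R : realType) (f g : R -> R) (x df dg : R) :
  is_derive x (1 : R) f df -> is_derive (f x) (1 : R) g dg ->
  is_derive x (1 : R) (g \o f) (dg * df).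
Proof.
move=> [d1 e1] [d2 e2]; apply: DeriveDef.
  by apply/derivable1_diffP/differentiable_comp; exact/derivable1_diffP.
by rewrite -derive1E derive1_comp// !derive1E e1 e2.
Qed.

Section Fourier.
Variable R : realType.
Local Notation circle := (@unit_circle R).
Local Notation m := (@circle_measure R).
Local Notation Re := (@complex.Re R).
Local Notation Im := (@complex.Im R).

Lemma expi_exp (t : R) n : expi t ^+ n = expi (n%:R * t).
Proof.
elim: n => [|n IH]; first by rewrite expr0 mul0r /expi cos0 sin0.
rewrite exprS IH -natr1 mulrDl mul1r /expi cosD sinD.
by apply: complex_eq; rewrite ?ReM ?ImM /=; ring.
Qed.

Lemma expi2pi : @expi R (2 * pi) = 1.
Proof.
by rewrite mulr_natl /expi cos2pi sin2pi.
Qed.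

(** The change of variables [ge0_integral_circle_measure] asks for a nonnegative integrand, so [f]
    is shifted by its bound [c]; [F] is an antiderivative of the shifted function, and the shift is
    subtracted at the end. *)
Lemma expect_circle_measure_FTC (f : borelC R -> R) (F : R -> R) c :
  admissible f -> (forall z, circle z -> `|f z| <= c) ->
  (forall t : R, derivable F t 1 /\ 'D_1 F t = f (expi t) + c) -> continuous (f \o @expi R) ->
  expect m f = (2 * pi)^-1 * (F (2 * pi) - F 0) - c.
Proof.
move=> af fc dF cf; have pi2 := pi2_gt0 R.
have ac : admissible (fun z => f z + c).
  by apply: admissibleD => //; exact: admissible_cst.
rewrite -[LHS](addrK c); congr (_ - _).
rewrite -[X in _ + X](expect_cst (@circle_measure_circle R)).
rewrite -expectD//; [|exact: circle_measure_circle|exact: admissible_cst].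
apply: EFin_inj; rewrite (EFin_expect (@circle_measure_circle R))//.
pose g z := (`|f z + c|)%:E.
transitivity (\int[m]_(z in circle) g z)%E.
  apply: eq_integral => z /set_mem cz; congr EFin; rewrite ger0_norm//.
  by have := fc z cz; rewrite ler_norml => /andP[+ _]; lra.
have mg : measurable_fun setT g.
  by apply/measurable_EFinP; case: (admissible_norm ac).
have g0 z : (0 <= g z)%E by rewrite lee_fin.
rewrite -(ge0_integral_circle (@circle_measure_circle R))//.
rewrite ge0_integral_circle_measure// EFinM; congr (_ * _)%E.
transitivity (\int[lebesgue_measure]_(t in `[0%R, (2 * pi)%R[) (f (expi t) + c)%:E)%E.
  apply: eq_integral => t _; congr EFin; rewrite ger0_norm//.
  by have := fc _ (circle_expi t); rewrite ler_norml => /andP[+ _]; lra.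
have cfc : continuous (fun t => f (expi t) + c).
  by move=> t; apply: continuousD; [exact: cf|exact: cst_continuous].
rewrite integral_itv_bndo_bndc; last first.
  apply/measurable_EFinP; apply: measurable_funTS; exact: continuous_measurable_fun.
rewrite (@continuous_FTC2 _ _ F) ?EFinB//.
- exact: continuous_subspaceT.
- split.
  + by move=> t _; case: (dF t).
  + apply: cvg_at_right_filter; apply: differentiable_continuous.
    by apply/derivable1_diffP; case: (dF 0).
  + apply: cvg_at_left_filter; apply: differentiable_continuous.
    by apply/derivable1_diffP; case: (dF (2 * pi)).
- by move=> t _; rewrite derive1E; case: (dF t).
Qed.

Lemma cexpect_exp n : cexpect m (fun z => z ^+ n.+1) = 0.
Proof.
have [a1 a2] := @cadmissible_exp R n.+1.
have n0 : n.+1%:R != 0 :> R by rewrite pnatr_eq0.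
have pi0 : 2 * pi != 0 :> R by rewrite gt_eqF ?pi2_gt0.
have bnd z : circle z -> `|Re (z ^+ n.+1)| <= 1 /\ `|Im (z ^+ n.+1)| <= 1.
  move=> /circleE z1; have := normsqX z n.+1; rewrite z1 expr1n /normsq => h.
  by split; rewrite -(@expr_le1 _ 2)// real_normK ?num_real// -h ?lerDl ?lerDr sqr_ge0.
have dc (t : R) : is_derive t (1 : R) (fun s => n.+1%:R * s) n.+1%:R.
  have -> : (fun s => n.+1%:R * s) = n.+1%:R \*: (id : R -> R) by [].
  by apply: is_derive_eq; exact: mulr1.
have cc : continuous (fun t : R => n.+1%:R * t).
  by move=> t; apply: differentiable_continuous; apply/derivable1_diffP; case: (dc t).
have dsin t : is_derive t (1 : R) (@sin R \o (fun s => n.+1%:R * s))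
    (cos (n.+1%:R * t) * n.+1%:R).
  exact: is_derive1_comp (dc t) (is_derive_sin _).
have dcos t : is_derive t (1 : R) (@cos R \o (fun s => n.+1%:R * s))
    (- sin (n.+1%:R * t) * n.+1%:R).
  exact: is_derive1_comp (dc t) (is_derive_cos _).
have := expi_exp (2 * pi) n.+1; rewrite expi2pi expr1n => -[ecos esin].
apply: complex_eq => /=.
(* An antiderivative of [cos ((n + 1) t) + 1]; the summand [id] accounts for the shift by 1. *)
- rewrite (@expect_circle_measure_FTC _
    ((n.+1%:R)^-1 \*: (@sin R \o (fun s => n.+1%:R * s)) + id) 1) //.
  + rewrite !fctE /= -esin.
    rewrite mulr0 sin0 !scaler0 add0r !addr0 subr0 mulVf ?subrr//.
  + by move=> z /bnd[].
  + move=> t; rewrite expi_exp /=; split; first exact: ex_derive.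
    apply: derive_val; apply: is_derive_eq.
    by rewrite -[_ *: _]/(_ * _) mulrCA mulVf// mulr1.
  + rewrite (_ : _ \o _ = @cos R \o (fun s => n.+1%:R * s)).
      by move=> t; apply: continuous_comp; [exact: cc|exact: continuous_cos].
    by apply/funext => t /=; rewrite expi_exp.
- rewrite (@expect_circle_measure_FTC _
    (- (n.+1%:R)^-1 \*: (@cos R \o (fun s => n.+1%:R * s)) + id) 1) //.
  + rewrite !fctE /= -ecos.
    by rewrite mulr0 cos0 addr0 addrAC subrr add0r mulVf ?subrr.
  + by move=> z /bnd[].
  + move=> t; rewrite expi_exp /=; split; first exact: ex_derive.
    apply: derive_val; apply: is_derive_eq.
    by rewrite mulNr scalerN scaleNr opprK -[_ *: _]/(_ * _) mulrCA mulVf// mulr1.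
  + rewrite (_ : _ \o _ = @sin R \o (fun s => n.+1%:R * s)).
      by move=> t; apply: continuous_comp; [exact: cc|exact: continuous_sin].
    by apply/funext => t /=; rewrite expi_exp.
Qed.
End Fourier.

(** * Uniform limits of polynomials on the circle *)

Section ModulusLemmas.
Variable R : realType.
Implicit Types z w : R[i].
Local Notation nc := (@ComplexField.Normc.normc R).

Lemma ncM z w : nc (z * w) = nc z * nc w.
Proof. exact: ComplexField.Normc.normcM. Qed.
Lemma ncD z w : nc (z + w) <= nc z + nc w.
Proof. exact: le_normcD. Qed.
Lemma ncN z : nc (- z) = nc z.
Proof. exact: normcN. Qed.
Lemma ncB z w : nc (z - w) <= nc z + nc w.
Proof. by rewrite -(ncN w) ncD. Qed.
Lemma nc1 : nc 1 = 1. Proof. exact: ComplexField.Normc.normc1. Qed.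
Lemma nc0 : nc 0 = 0. Proof. exact: ComplexField.Normc.normc0. Qed.
Lemma ncX z n : nc (z ^+ n) = nc z ^+ n.
Proof. by elim: n => [|n IH]; rewrite ?nc1// !exprS ncM IH. Qed.
Lemma ncV z : nc z^-1 = (nc z)^-1.
Proof. exact: ComplexField.Normc.normcV. Qed.
Lemma nc_eq0 z : (nc z == 0) = (z == 0).
Proof.
by apply/eqP/eqP => [/ComplexField.Normc.eq0_normc//|->]; exact: nc0.
Qed.
Lemma nc_gt0 z : (0 < nc z) = (z != 0).
Proof. by rewrite lt_def nc_eq0 normc_ge0 andbT. Qed.
Lemma nc_conj z : nc (conjc z) = nc z.
Proof. by case: z => a b /=; rewrite sqrrN. Qed.
Lemma nc_circle z : @unit_circle R z <-> nc z = 1.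
Proof.
rewrite circleE normsq_normc; split => [h|->]; last by rewrite expr1n.
by apply/eqP; rewrite -(@eqrXn2 _ 2) ?normc_ge0// h expr1n.
Qed.
Lemma nc_real (x : R) : nc (x%:C%C) = `|x|.
Proof. by rewrite /= expr0n addr0 sqrtr_sqr. Qed.
End ModulusLemmas.

Section DiskFunctions.
Variable R : realType.
Local Notation circle := (@unit_circle R).
Local Notation m := (@circle_measure R).
Local Notation nc := (@ComplexField.Normc.normc R).
Implicit Types f g : borelC R -> R[i].

Lemma cexpect_le P f M : on_unit_circle P -> cadmissible f ->
  (forall z, circle z -> nc (f z) <= M) -> nc (cexpect P f) <= 2 * M.
Proof.
move=> hP [f1 f2] fM; apply: le_trans (le_normc_ReIm _) _.
rewrite mulr_natl mulr2n lerD//=; apply: expect_norm_le => // z /fM;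
  apply: le_trans; [exact: Re_le_normc|exact: Im_le_normc].
Qed.

Lemma cadmissible_bounded f : cadmissible f ->
  exists2 M, 0 < M & forall z, circle z -> nc (f z) <= M.
Proof.
move=> [[_ [M fM]] [_ [N fN]]]; exists (`|M| + `|N| + 1).
  by rewrite ltr_wpDl// addr_ge0.
move=> z cz; apply: le_trans (le_normc_ReIm _) _.
rewrite -[leLHS]addr0 lerD// lerD//.
  by rewrite (le_trans (fM _ cz))// ler_norm.
by rewrite (le_trans (fN _ cz))// ler_norm.
Qed.

Lemma cadmissibleB f g : cadmissible f -> cadmissible g ->
  cadmissible (fun z => f z - g z).
Proof.
move=> af ag; apply: cadmissibleD => //.
have := cadmissibleM (cadmissible_cst (-1)) ag; congr cadmissible.
by apply/funext => z; rewrite mulN1r.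
Qed.

Lemma cadmissible_inv f c : cmeasurable f -> 0 < c ->
  (forall z, circle z -> c <= nc (f z)) -> cadmissible (fun z => (f z)^-1).
Proof.
move=> /cmeasurable_inv[m1 m2] c0 fc; split; split => //; exists c^-1 => z cz;
  [apply: le_trans (Re_le_normc _) _|apply: le_trans (Im_le_normc _) _];
  by rewrite ncV lef_pV2 ?fc// posrE ?(lt_le_trans c0)// fc.
Qed.

Lemma cexpect_horner (p : {poly R[i]}) : cexpect m (fun z => p.[z]) = p`_0.
Proof.
transitivity (cexpect m (fun z => \sum_(i < size p) p`_i * z ^+ i)).
  by apply: cexpect_eq => z _; rewrite horner_coef.
rewrite cexpect_sum; last 2 first.
- exact: circle_measure_circle.
- by move=> i; apply: cadmissibleM; [exact: cadmissible_cst|exact: cadmissible_exp].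
rewrite (eq_bigr (fun i : 'I__ => p`_i * cexpect m (fun z => z ^+ i))); last first.
  by move=> i _; rewrite cexpectZ//; [exact: circle_measure_circle|exact: cadmissible_exp].
case: (size p) (size_poly_leq0 p) => [|n].
  by rewrite leqnn big_ord0 => /esym/eqP ->; rewrite coef0.
move=> _; rewrite big_ord_recl /= big1; last first.
  by move=> i _; rewrite [X in _ * X](cexpect_exp R i) mulr0.
rewrite addr0 -[RHS]mulr1; congr (_ * _).
by rewrite -[RHS](cexpect_cst (@circle_measure_circle R)).
Qed.

(** Boundary values of the disk algebra. Analyticity is used only through stability under products,
    the inverses of zero-free polynomials, and the mean value property [cexpect_disk_function]. *)
Definition disk_function f := cadmissible f /\
  forall e, 0 < e -> exists p : {poly R[i]},
    forall z, circle z -> nc (f z - p.[z]) <= e.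

Lemma disk_function_horner (p : {poly R[i]}) : disk_function (fun z => p.[z]).
Proof.
split; first exact: cadmissible_horner.
by move=> e e0; exists p => z _; rewrite subrr nc0 ltW.
Qed.

Lemma disk_functionM f g : disk_function f -> disk_function g ->
  disk_function (fun z => f z * g z).
Proof.
move=> [af hf] [ag hg]; split; first exact: cadmissibleM.
move=> e e0; have [M M0 fM] := cadmissible_bounded af.
have e2 : 0 < e / 2 by rewrite divr_gt0.
have [q hq] := hg _ (divr_gt0 e2 M0).
have [N N0 qN] := cadmissible_bounded (cadmissible_horner q).
have [p hp] := hf _ (divr_gt0 e2 N0).
exists (p * q) => z cz; rewrite hornerM.
have -> : f z * g z - p.[z] * q.[z] =
    f z * (g z - q.[z]) + (f z - p.[z]) * q.[z] by ring.
apply: le_trans (ncD _ _) _; rewrite !ncM [leRHS](splitr e).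
have Mn : M != 0 by rewrite gt_eqF. have Nn : N != 0 by rewrite gt_eqF.
rewrite lerD//.
  by rewrite -[leRHS](divfK Mn) mulrC ler_pM ?normc_ge0 ?hq ?fM.
by rewrite -[leRHS](divfK Nn) ler_pM ?normc_ge0 ?hp ?qN.
Qed.

Lemma normc_1BM_ge u z : nc u < 1 -> circle z -> 1 - nc u <= nc (1 - u * z).
Proof.
move=> u1 /nc_circle z1; rewrite lerBlDr -[leLHS](nc1 R).
rewrite -[X in nc X <= _](subrK (u * z)) (le_trans (ncD _ _))//.
by rewrite ncM z1 mulr1.
Qed.

(** Partial sums of the geometric series: the remainder [(u z)^N / (1 - u z)] is uniformly small
    because [|1 - u z| >= 1 - |u|] on the circle. *)
Lemma disk_function_geometric u : nc u < 1 ->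
  disk_function (fun z => (1 - u * z)^-1).
Proof.
move=> u1; have r0 := normc_ge0 u; have d0 : 0 < 1 - nc u by rewrite subr_gt0.
have low z := @normc_1BM_ge u z u1.
split.
  apply: (cadmissible_inv _ d0) => //.
  have := cmeasurable_horner (1 - u *: 'X : {poly R[i]}); congr cmeasurable.
  by apply/funext => z; rewrite !hornerE.
move=> e e0.
have u1' : `|nc u| < 1 by rewrite ger0_norm.
have [N _ /(_ N (leqnn N)) /=] :=
  (proj1 (@cvgrPdist_lt _ _ _ _ _ _ _) (cvg_expr u1')) _ (mulr_gt0 e0 d0).
rewrite sub0r normrN ger0_norm ?exprn_ge0// => hN.
exists (\sum_(j < N) u ^+ j *: 'X^j) => z cz.
have n0 : 1 - u * z != 0 by rewrite -nc_gt0 (lt_le_trans d0)// low.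
have -> : (1 - u * z)^-1 - (\sum_(j < N) u ^+ j *: 'X^j).[z] =
    (u * z) ^+ N * (1 - u * z)^-1.
  rewrite horner_sum; under eq_bigr do rewrite hornerZ hornerXn -exprMn.
  apply: (mulIf n0); rewrite mulrBl mulfVK// mulVf//.
  by rewrite -[(u * z) ^+ N](subrK 1) subrX1; ring.
rewrite ncM ncX ncM (nc_circle z).1// mulr1 ncV.
rewrite ler_pdivrMr ?(lt_le_trans d0) ?low//.
by rewrite (le_trans (ltW hN))// ler_pM2l// low.
Qed.

(** For a polynomial [p], [z p(z)] has no constant term, hence mean 0. Uniform approximation
    transfers this; the error [e / 2] makes up for the factor 2 of [cexpect_le]. *)
Lemma cexpect_disk_function f : disk_function f ->
  cexpect m (fun z => z * f z) = 0.
Proof.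
move=> [af hf]; apply/eqP; rewrite -nc_eq0; apply/eqP/le_anti.
rewrite normc_ge0 andbT; apply/ler_addgt0Pl => e e0; rewrite addr0.
have [p hp] := hf (e / 2) (divr_gt0 e0 (ltr0n _ 2)).
have ap := cadmissible_horner p; have ai := @cadmissible_id R.
have -> : cexpect m (fun z => z * f z) = cexpect m (fun z => z * (f z - p.[z])).
  transitivity (cexpect m (fun z => z * (f z - p.[z]) + ('X * p).[z])).
    by apply: cexpect_eq => z _; rewrite hornerM hornerX; ring.
  rewrite cexpectD; [|exact: circle_measure_circle| |exact: cadmissible_horner].
    by rewrite cexpect_horner coefXM addr0.
  by apply: cadmissibleM => //; exact: cadmissibleB.
rewrite -[leRHS](divfK (_ : 2 != 0 :> R)) ?pnatr_eq0// mulrC.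
apply: cexpect_le; [exact: circle_measure_circle| |].
  by apply: cadmissibleM => //; exact: cadmissibleB.
by move=> z cz; rewrite ncM (nc_circle z).1// mul1r hp.
Qed.

(** The [u] are the inverses of the roots, which lie outside the closed disk; the constant term 1
    normalizes the scalar in front. Inverses and logarithms thereby reduce to a single factor
    [1 - u z]. *)
Lemma disk_zero_free_factor (p : {poly R[i]}) : p`_0 = 1 ->
  (forall z, nc z <= 1 -> p.[z] != 0) ->
  exists2 us : seq R[i], p = \prod_(u <- us) (1 - u *: 'X) &
    forall u, u \in us -> nc u < 1.
Proof.
move=> p0 pz; have [rs] := closed_field_poly_normal p => pE.
have lc0 : lead_coef p != 0.
  by apply/eqP => l0; have /eqP := p0; rewrite pE l0 scale0r coef0 eq_sym oner_eq0.
have rs1 r : r \in rs -> 1 < nc r.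
  move=> rrs; rewrite ltNge; apply/negP => /pz; rewrite -[_ != 0]/(~~ root p r).
  by rewrite pE rootZ// root_prod_XsubC rrs.
exists [seq r^-1 | r <- rs]; last first.
  move=> _ /mapP[r /rs1 r1 ->]; rewrite ncV invf_lt1//.
  exact: lt_trans r1.
rewrite big_map.
have fE : \prod_(r <- rs) ('X - r%:P) =
    (\prod_(r <- rs) - r) *: \prod_(r <- rs) (1 - r^-1 *: 'X).
  elim: rs rs1 {pE} => [|r rs IH] rs1; first by rewrite !big_nil scale1r.
  rewrite !big_cons IH; last by move=> s sr; rewrite rs1// inE sr orbT.
  have r0 : r != 0 by rewrite -nc_gt0 (lt_trans ltr01)// rs1// mem_head.
  have -> : 'X - r%:P = (- r) *: (1 - r^-1 *: 'X).
    rewrite scalerBr scalerA mulNr divff// scaleN1r opprK scaleNr addrC.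
    by rewrite -mul_polyC mulr1.
  by rewrite -scalerAl -scalerAr scalerA.
rewrite pE fE scalerA.
have c1 : (\prod_(r <- rs) (1 - r^-1 *: 'X) : {poly R[i]})`_0 = 1.
  rewrite -horner_coef0 horner_prod big1// => r _.
  by rewrite hornerD hornerN hornerZ hornerX mulr0 subr0 hornerC.
move/eqP: p0; rewrite {1}pE fE scalerA coefZ c1 mulr1 => /eqP ->.
by rewrite scale1r.
Qed.

Lemma disk_function_inv_prod (us : seq R[i]) : (forall u, u \in us -> nc u < 1) ->
  disk_function (fun z => (\prod_(u <- us) (1 - u *: 'X)).[z]^-1).
Proof.
elim: us => [|u us IH] h.
  have := disk_function_horner 1; congr disk_function.
  by apply/funext => z; rewrite big_nil hornerE invr1.
have := disk_functionM (disk_function_geometric (h u (mem_head _ _)))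
  (IH (fun v vs => h v (mem_behead (s := u :: us) vs))).
congr disk_function; apply/funext => z.
by rewrite big_cons hornerM invfM; congr (_^-1 * _); rewrite !hornerE.
Qed.

Lemma disk_function_inv (p : {poly R[i]}) : p`_0 = 1 ->
  (forall z, nc z <= 1 -> p.[z] != 0) -> disk_function (fun z => p.[z]^-1).
Proof.
by move=> p0 /(disk_zero_free_factor p0)[us -> /disk_function_inv_prod].
Qed.
End DiskFunctions.

(** * Logarithmic integrals of zero-free polynomials *)

Section LogApprox.
Variable R : realType.
Local Notation Re := (@complex.Re R).
Local Notation Im := (@complex.Im R).
Local Notation nc := (@ComplexField.Normc.normc R).
Implicit Types v : R[i].

Lemma Re_realM (x : R) v : Re (x%:C%C * v) = x * Re v.
Proof. by rewrite ReM /= mul0r subr0. Qed.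
Lemma Im_realM (x : R) v : Im (x%:C%C * v) = x * Im v.
Proof. by rewrite ImM /= mul0r addr0. Qed.

(* The mean value theorem along [t |-> ln |1 - t v|^2], whose derivative is
   minus twice the real part of a geometric series. *)
Lemma ln_normsq_taylor v n : nc v < 1 ->
  `|ln (normsq (1 - v)) + 2 * Re (\sum_(j < n) v ^+ j.+1 / j.+1%:R)|
    <= 2 * nc v ^+ n.+1 / (1 - nc v).
Proof.
move=> v1; have r0 := normc_ge0 v; have d0 : 0 < 1 - nc v by rewrite subr_gt0.
have low (t : R) : 0 <= t <= 1 -> 1 - nc v <= nc (1 - t%:C%C * v).
  move=> /andP[t0 t1]; rewrite lerBlDr -[leLHS](nc1 R).
  rewrite -[X in nc X <= _](subrK (t%:C%C * v)) (le_trans (ncD _ _))//.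
  by rewrite lerD2l// ncM nc_real ger0_norm// ler_piMl.
(* [N] is [|1 - t v|^2] and [q] is twice the real part of the partial sum at [t v], both as real
   polynomials in [t], so that they can be differentiated formally. *)
pose N : {poly R} := 1 - (2 * Re v) *: 'X + normsq v *: 'X^2.
pose q : {poly R} := \sum_(j < n) (2 * Re (v ^+ j.+1) / j.+1%:R) *: 'X^(j.+1).
have NE t : N.[t] = normsq (1 - t%:C%C * v).
  rewrite normsq_expand Re_realM normsqM /N !hornerE.
  by rewrite [normsq t%:C%C]/normsq /= expr0n addr0; ring.
have N0 (t : R) : 0 <= t <= 1 -> 0 < N.[t].
  move=> /low h; rewrite NE normsq_gt0 -nc_gt0; exact: lt_le_trans h.
pose g (t : R) : R := ln N.[t] + q.[t].
pose dg (t : R) : R := - 2 * Re (v * (t%:C%C * v) ^+ n / (1 - t%:C%C * v)).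
(* [q'] cancels the first [n] terms of the geometric series; [dg] is the tail that remains. *)
have dgE (t : R) : 0 <= t <= 1 -> (N.[t])^-1 * (N^`()%R).[t] + (q^`()%R).[t] = dg t.
  move=> t01; have nz : 1 - t%:C%C * v != 0.
    by rewrite -normsq_gt0 -NE N0.
  have e1 : (N.[t])^-1 * (N^`()%R).[t] = - 2 * Re (v / (1 - t%:C%C * v)).
    have -> : (N^`()%R).[t] = - (2 * Re v) + 2 * normsq v * t.
      rewrite /N derivD derivB derivZ derivZ derivX derivXn derivC.
      by rewrite !hornerE /=; ring.
    rewrite ReM Re_inv Im_inv -NE /N !hornerE ReD ImD ReN ImN Re_realM Im_realM.
    rewrite /normsq /=; field.
    by have := N0 t t01; rewrite /N !hornerE => /gt_eqF; rewrite /normsq => ->.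
  have e2 : (q^`()%R).[t] = 2 * Re (v * \sum_(j < n) (t%:C%C * v) ^+ j).
    rewrite /q [in LHS]linear_sum horner_sum mulr_sumr Re_sum mulr_sumr.
    apply: eq_bigr => j _ /=; rewrite derivZ derivXn hornerZ hornerMn hornerXn /=.
    rewrite exprMn mulrCA -rmorphXn Re_realM -exprS -[t ^+ j *+ _]mulr_natr.
    by field; rewrite nat1r pnatr_eq0.
  have e3 : \sum_(j < n) (t%:C%C * v) ^+ j =
      (1 - (t%:C%C * v) ^+ n) / (1 - t%:C%C * v).
    apply: (canRL (mulfK nz)); rewrite mulrC.
    by rewrite -[RHS]opprB subrX1; ring.
  have e4 : v / (1 - t%:C%C * v) = v * \sum_(j < n) (t%:C%C * v) ^+ j
      + v * (t%:C%C * v) ^+ n / (1 - t%:C%C * v) by rewrite e3; field.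
  by rewrite e1 e2 e4 ReD /dg; ring.
have cg (t : R) : 0 <= t <= 1 -> is_derive t (1 : R) g (dg t).
  move=> t01; rewrite -dgE//.
  rewrite (_ : g = (@ln R \o horner N) + horner q)//.
  apply: is_deriveD; apply: is_derive1_comp; apply: is_derive1_ln; exact: N0.
have [||c c01] := @MVT R g dg 0 1 ltr01.
- by move=> t; rewrite in_itv /= => /andP[t0 t1]; apply: cg; rewrite !ltW.
- apply: derivable_within_continuous => t; rewrite in_itv /= => /cg; case=> //.
rewrite subr0 mulr1; have -> : g 0 = 0.
  rewrite /g NE mul0r subr0 normsq1 ln1 add0r /q horner_sum big1// => j _.
  by rewrite hornerZ hornerXn expr0n mulr0.
have -> : g 1 = ln (normsq (1 - v)) + 2 * Re (\sum_(j < n) v ^+ j.+1 / j.+1%:R).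
  rewrite /g NE mul1r; congr (_ + _); rewrite /q horner_sum Re_sum mulr_sumr.
  apply: eq_bigr => j _; rewrite hornerZ hornerXn expr1n mulr1.
  have -> : (j.+1%:R : R[i])^-1 = (j.+1%:R^-1)%:C%C by rewrite fmorphV rmorph_nat.
  by rewrite [_ * _%:C%C]mulrC Re_realM; ring.
rewrite subr0 => ->; rewrite /dg normrM normrN (ger0_norm (ler0n R 2)) -[leRHS]mulrA ler_pM2l//.
apply: le_trans (Re_le_normc _) _.
have c01' : 0 <= c <= 1 by move: c01; rewrite in_itv /= => /andP[? ?]; rewrite !ltW.
have /andP[c0 c1] := c01'.
rewrite ncM ncV ncM ncX ncM nc_real (ger0_norm c0) ler_pM ?mulr_ge0 ?invr_ge0 ?exprn_ge0 ?mulr_ge0 ?normc_ge0//.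
  by rewrite exprS ler_wpM2l// lerXn2r ?nnegrE ?mulr_ge0// ler_piMl.
by rewrite lef_pV2 ?low// posrE (lt_le_trans d0)// low.
Qed.
End LogApprox.

(** * The weight, its Fourier coefficients and weighted logarithmic means *)

Section Weight.
Variable R : realType.
Local Notation circle := (@unit_circle R).
Local Notation m := (@circle_measure R).
Local Notation mC := (@circle_measure_circle R).
Local Notation Re := (@complex.Re R).
Local Notation nc := (@ComplexField.Normc.normc R).
Implicit Types p q : {poly R[i]}.

Definition weight (z : R[i]) : R := (1 - Re z) ^+ 2 * (1 + Re z).

Lemma circle_Re_le1 z : circle z -> -1 <= Re z <= 1.
Proof.
move=> /nc_circle z1; have := Re_le_normc z; rewrite z1 => h.
by move: h; rewrite ler_norml.
Qed.

Lemma weight_ge0 z : circle z -> 0 <= weight z.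
Proof.
move=> /circle_Re_le1 /andP[h _]; rewrite /weight mulr_ge0 ?sqr_ge0//.
by rewrite addrC -lerBlDr sub0r.
Qed.

Lemma weight_le8 z : circle z -> weight z <= 8.
Proof.
move=> /circle_Re_le1 /andP[h1 h2]; rewrite /weight.
have -> : 8 = 2 ^+ 2 * 2 :> R by ring.
rewrite ler_pM ?sqr_ge0 ?lerXn2r ?nnegrE//; lra.
Qed.

Lemma admissible_weight : admissible weight.
Proof.
have [a _] := @cadmissible_id R.
by apply: admissibleM; [under eq_fun do rewrite expr2; apply: admissibleM;
  apply: admissibleB|apply: admissibleD] => //; exact: admissible_cst.
Qed.

(** Fourier expansion of [1 - c - c^2 + c^3] with [c = (z + conj z) / 2]. Frequencies stop at 3,
    which is why only three Taylor coefficients of the logarithm survive. *)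
Lemma weight_circle z : circle z -> (weight z)%:C%C =
  2^-1 - 8^-1 * (z + conjc z) - 4^-1 * (z ^+ 2 + conjc z ^+ 2)
  + 8^-1 * (z ^+ 3 + conjc z ^+ 3) :> R[i].
Proof.
move=> cz; have z0 := circle_neq0 cz.
have e : (Re z)%:C%C = (z + conjc z) / 2 by rewrite ReJ_add.
have -> : (weight z)%:C%C = (1 - (Re z)%:C%C) ^+ 2 * (1 + (Re z)%:C%C).
  by rewrite /weight rmorphM rmorphXn rmorphB rmorphD rmorph1.
by rewrite e (circle_conj cz); field.
Qed.

Lemma cexpect_conjX_exp j i :
  cexpect m (fun z => conjc z ^+ j * z ^+ i) = (i == j)%:R.
Proof.
have [ji|ij] := leqP j i.
  transitivity (cexpect m (fun z => ('X^(i - j)).[z])).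
    apply: cexpect_eq => z cz; rewrite hornerXn (circle_conj cz) exprVn.
    by rewrite -{1}(subnK ji) exprD mulrC mulfK// expf_neq0// circle_neq0.
  by rewrite cexpect_horner coefXn eq_sym subn_eq0 eqn_leq ji andbT.
transitivity (cexpect m (fun z => conjc (('X^(j - i)).[z]))).
  apply: cexpect_eq => z cz; rewrite hornerXn rmorphXn /= (circle_conj cz) !exprVn.
  rewrite -{1}(subnK (ltnW ij)) exprD invfM mulfVK// expf_neq0//.
  exact: circle_neq0.
rewrite cexpect_conj; [|exact: mC|exact: cadmissible_horner].
rewrite cexpect_horner coefXn eq_sym subn_eq0 leqNgt ij ltn_eqF//=.
by apply: complex_eq; rewrite /= ?oppr0.
Qed.

Lemma cadmissible_conjX j : cadmissible (fun z : borelC R => conjc z ^+ j).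
Proof.
have := cadmissible_conj (@cadmissible_exp R j); congr cadmissible.
by apply/funext => z; rewrite rmorphXn.
Qed.

Lemma cexpect_conjX_horner j p :
  cexpect m (fun z => conjc z ^+ j * p.[z]) = p`_j.
Proof.
pose F (i : nat) z : R[i] := p`_i * (conjc z ^+ j * z ^+ i).
have aji i : @cadmissible R (fun z => conjc z ^+ j * z ^+ i).
  exact: (cadmissibleM (cadmissible_conjX j) (@cadmissible_exp R i)).
have aF (i : 'I_(size p)) : @cadmissible R (F i).
  by apply: cadmissibleM => //; exact: cadmissible_cst.
transitivity (cexpect m (fun z => \sum_(i < size p) F i z)).
  apply: cexpect_eq => z _; rewrite horner_coef mulr_sumr.
  by apply: eq_bigr => i _; rewrite /F mulrCA.
rewrite cexpect_sum//; last exact: mC.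
rewrite (eq_bigr (fun i : 'I_(size p) => p`_i * (i == j :> nat)%:R)); last first.
  move=> i _; rewrite /F cexpectZ//; last exact: mC.
  by congr (_ * _); exact: cexpect_conjX_exp.
have [jp|pj] := ltnP j (size p); last first.
  rewrite nth_default// big1// => i _.
  by rewrite ltn_eqF ?mulr0// (leq_trans (ltn_ord i)).
rewrite (bigD1 (Ordinal jp)) //= eqxx mulr1 big1 ?addr0// => i.
by rewrite -val_eqE /= => /negbTE ->; rewrite mulr0.
Qed.

(** In the Fourier expansion of the weight, [conj z ^ j] extracts the coefficient of order [j],
    while [z ^ j] with [j > 0] has mean 0 against a polynomial. *)
Lemma expect_weight_horner p : expect m (fun z => weight z * Re p.[z]) =
  Re (2^-1 * p`_0 - 8^-1 * p`_1 - 4^-1 * p`_2 + 8^-1 * p`_3).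
Proof.
have ap := cadmissible_horner p.
have H j : cexpect m (fun z => z ^+ j * p.[z]) = ('X^j * p)`_0.
  by rewrite -cexpect_horner; apply: cexpect_eq => z _; rewrite hornerM hornerXn.
have aX j : @cadmissible R (fun z => z ^+ j * p.[z]).
  by apply: cadmissibleM => //; exact: cadmissible_exp.
have aC j : @cadmissible R (fun z => conjc z ^+ j * p.[z]).
  exact: (cadmissibleM (cadmissible_conjX j) ap).
pose f z : R[i] := (2^-1 * p.[z] + - 8^-1 * (z ^+ 1 * p.[z] + conjc z ^+ 1 * p.[z]))
  + (- 4^-1 * (z ^+ 2 * p.[z] + conjc z ^+ 2 * p.[z])
  + 8^-1 * (z ^+ 3 * p.[z] + conjc z ^+ 3 * p.[z])).
have aZ c f' : @cadmissible R f' -> @cadmissible R (fun z => c * f' z).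
  by move=> a; apply: cadmissibleM => //; exact: cadmissible_cst.
transitivity (Re (cexpect m f)).
  apply: expect_eq => z cz; rewrite -Re_realM weight_circle//.
  by rewrite /f; congr Re; rewrite !expr1; ring.
have aS j : @cadmissible R (fun z => z ^+ j * p.[z] + conjc z ^+ j * p.[z]).
  exact: cadmissibleD (aX j) (aC j).
have ES j c : cexpect m (fun z => c * (z ^+ j * p.[z] + conjc z ^+ j * p.[z])) =
    c * (('X^j * p)`_0 + p`_j).
  rewrite (cexpectZ mC c (aS j)) (cexpectD mC (aX j) (aC j)).
  by rewrite H cexpect_conjX_horner.
rewrite /f (cexpectD mC (cadmissibleD (aZ _ _ ap) (aZ _ _ (aS 1)))
  (cadmissibleD (aZ _ _ (aS 2)) (aZ _ _ (aS 3)))).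
rewrite (cexpectD mC (aZ _ _ ap) (aZ _ _ (aS 1))).
rewrite (cexpectD mC (aZ _ _ (aS 2)) (aZ _ _ (aS 3))) !ES (cexpectZ mC _ ap).
by rewrite cexpect_horner !coefXnM /=; congr Re; ring.
Qed.

Lemma admissible_ln (f : borelC R -> R) c : admissible f -> 0 < c ->
  (forall z, circle z -> c <= f z) -> admissible (fun z => ln (f z)).
Proof.
move=> [mf [M fM]] c0 cf; split.
  exact: measurableT_comp (@measurable_ln R) mf.
exists (`|ln c| + `|ln M|) => z cz; have fz := cf z cz.
have f0 := lt_le_trans c0 fz; have M1 := fM z cz; rewrite gtr0_norm// in M1.
have M0 := lt_le_trans f0 M1.
rewrite ler_norml; apply/andP; split.
  have h : ln c <= ln (f z) by rewrite ler_ln.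
  have := ler_norm (- ln c); have := normr_ge0 (ln M); rewrite normrN; lra.
have h : ln (f z) <= ln M by rewrite ler_ln.
have := ler_norm (ln M); have := normr_ge0 (ln c); lra.
Qed.

(** With [c_k] the Taylor coefficients of [log p] for [p_0 = 1], this is
    [- c_1 / 4 - c_2 / 2 + c_3 / 4]: the Fourier coefficients -1/8, -1/4, 1/8 of the weight, doubled
    because [log |p|^2 = 2 Re log p]. Written out in this way, it avoids defining a complex
    logarithm. *)
Definition log_coef p : R[i] :=
  - 4^-1 * p`_1 - 2^-1 * (p`_2 - 2^-1 * p`_1 ^+ 2)
  + 4^-1 * (p`_3 - p`_1 * p`_2 + 3^-1 * p`_1 ^+ 3).

Lemma log_coefM p q : p`_0 = 1 -> q`_0 = 1 ->
  log_coef (p * q) = log_coef p + log_coef q.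
Proof.
move=> p0 q0; rewrite /log_coef !coefM !big_ord_recl !big_ord0 /= /bump /=.
rewrite !add1n !addr0 ?subn0 ?p0 ?q0.
by field.
Qed.

Lemma admissible_ln_geometric u : nc u < 1 ->
  admissible (fun z => ln (normsq (1 - u * z))).
Proof.
move=> u1; have d0 : 0 < 1 - nc u by rewrite subr_gt0.
apply: (admissible_ln (c := (1 - nc u) ^+ 2)); last 2 first.
- by rewrite exprn_gt0.
- by move=> z cz; rewrite normsq_normc lerXn2r ?nnegrE ?normc_ge0 ?normc_1BM_ge// ltW.
apply: admissible_normsq; apply: cadmissibleB; first exact: cadmissible_cst.
by apply: cadmissibleM; [exact: cadmissible_cst|exact: cadmissible_id].
Qed.

(** The weight sees only frequencies up to 3, so a Taylor polynomial of degree at least 3 already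
    has the exact weighted mean; only the uniform error of the truncation has to tend to 0. *)
Lemma expect_weight_ln_geometric u : nc u < 1 ->
  expect m (fun z => weight z * ln (normsq (1 - u * z))) =
  Re (log_coef (1 - u *: 'X)).
Proof.
move=> u1; have d0 : 0 < 1 - nc u by rewrite subr_gt0.
have r0 := normc_ge0 u; set L := Re _.
apply/eqP; rewrite -subr_eq0 -normr_eq0; apply/eqP/le_anti.
rewrite normr_ge0 andbT; apply/ler_addgt0Pl => e e0; rewrite addr0.
have u1' : `|nc u| < 1 by rewrite ger0_norm.
(* The error is at most [8 * 2 * |u|^(N + 4) / (1 - |u|)], 8 being the bound of the weight and 2 the
   constant of [ln_normsq_taylor]; hence 16. The shift by 3 keeps the coefficients 1 to 3. *)
have [N _ /(_ (N + 3)%N (leq_addr _ _)) /=] :=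
  (proj1 (@cvgrPdist_lt _ _ _ _ _ _ _) (cvg_expr u1')) _
    (mulr_gt0 e0 (divr_gt0 d0 (ltr0n R 16))).
rewrite sub0r normrN ger0_norm ?exprn_ge0// => hN.
pose s : {poly R[i]} := \sum_(j < (N + 3)%N) (- 2 * (u ^+ j.+1 / j.+1%:R)) *: 'X^(j.+1).
have sc k : s`_k.+1 = if (k < N + 3)%N then - 2 * (u ^+ k.+1 / k.+1%:R) else 0.
  rewrite /s coef_sum; case: ifPn => kN.
    rewrite (bigD1 (Ordinal kN))//= coefZ coefXn eqxx mulr1 big1 ?addr0// => i.
    by rewrite -val_eqE /= coefZ coefXn eqSS eq_sym => /negbTE ->; rewrite mulr0.
  rewrite big1// => i _; rewrite coefZ coefXn eqSS gtn_eqF ?mulr0//.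
  by rewrite (leq_trans (ltn_ord i))// leqNgt.
have s0 : s`_0 = 0 by rewrite /s coef_sum big1// => i _; rewrite coefZ coefXn mulr0.
have -> : L = expect m (fun z => weight z * Re s.[z]).
  rewrite expect_weight_horner s0 !sc !addnS /= /L /log_coef; congr Re.
  rewrite !coefB !coefZ !coefX !coef1 /=.
  by field.
have as_ : admissible (fun z => Re s.[z]) by case: (cadmissible_horner s).
have al := admissible_ln_geometric u1.
apply: expect_dist_le => //; [exact: mC|apply: admissibleM => //; exact: admissible_weight..|].
move=> z cz; rewrite -mulrBr normrM ger0_norm ?weight_ge0//.
have zu : nc (u * z) = nc u by rewrite ncM (nc_circle z).1// mulr1.
have := @ln_normsq_taylor R (u * z) (N + 3) (_ : _ < 1); rewrite zu => /(_ u1).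
have -> : 2 * Re (\sum_(j < (N + 3)%N) (u * z) ^+ j.+1 / j.+1%:R) = - Re s.[z].
  rewrite /s horner_sum !Re_sum mulr_sumr -sumrN; apply: eq_bigr => j _.
  rewrite hornerZ hornerXn -ReN exprMn.
  have -> : 2 * Re (u ^+ j.+1 * z ^+ j.+1 / j.+1%:R) =
      Re ((2 : R)%:C%C * (u ^+ j.+1 * z ^+ j.+1 / j.+1%:R)) by rewrite Re_realM.
  by congr Re; rewrite rmorph_nat; ring.
move=> h; have [w0 w8] := (weight_ge0 cz, weight_le8 cz).
apply: le_trans (_ : 8 * (2 * nc u ^+ (N + 3).+1 / (1 - nc u)) <= e).
  by rewrite ler_pM.
rewrite mulrA ler_pdivrMr// exprS.
have h2 : nc u * nc u ^+ (N + 3) <= nc u ^+ (N + 3).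
  by rewrite ler_piMl ?exprn_ge0// ltW.
lra.
Qed.

(** Both the weighted mean of the logarithm and [log_coef] are additive over the linear factors;
    admissibility is carried along because additivity of the mean requires it. *)
Lemma expect_weight_ln p : p`_0 = 1 -> (forall z, nc z <= 1 -> p.[z] != 0) ->
  admissible (fun z => ln (normsq p.[z])) /\
  expect m (fun z => weight z * ln (normsq p.[z])) = Re (log_coef p).
Proof.
move=> p0 /(disk_zero_free_factor p0)[us -> {p p0}].
elim: us => [|u us IH] h.
  split.
    have := @admissible_cst R (0 : R); congr admissible; apply/funext => z.
    by rewrite big_nil hornerE normsq1 ln1.
  rewrite -[LHS](_ : expect m (fun=> 0) = _); last first.
    by apply: expect_eq => z _; rewrite big_nil hornerE normsq1 ln1 mulr0.
  rewrite (expect_cst mC) big_nil; suff -> : log_coef 1 = 0 by [].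
  by rewrite /log_coef !coef1 /=; ring.
have [|al IH'] := IH; first by move=> v vs; rewrite h// inE vs orbT.
have u1 : nc u < 1 by rewrite h// mem_head.
have nz z : circle z -> (1 - u * z != 0) /\ (\prod_(v <- us) (1 - v *: 'X)).[z] != 0.
  have aux v : v \in u :: us -> circle z -> 1 - v * z != 0.
    move=> /h v1 cz; rewrite -nc_gt0 (lt_le_trans _ (normc_1BM_ge v1 cz))//.
    by rewrite subr_gt0.
  move=> cz; split; first by rewrite aux ?mem_head.
  rewrite horner_prod prodf_seq_neq0; apply/allP => v vs /=.
  by rewrite !hornerE aux// inE vs orbT.
have lnM z : circle z -> ln (normsq (\prod_(v <- u :: us) (1 - v *: 'X)).[z]) =
    ln (normsq (1 - u * z)) + ln (normsq (\prod_(v <- us) (1 - v *: 'X)).[z]).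
  move=> /nz[n1 n2]; rewrite big_cons hornerM normsqM lnM ?posrE ?normsq_gt0//.
    by rewrite !hornerE.
  by rewrite !hornerE.
have ag := admissible_ln_geometric u1.
split.
  split; last first.
    have [_ [M hM]] := admissibleD ag al; exists M => z cz; rewrite lnM//; exact: hM.
  apply: measurableT_comp (@measurable_ln R) _.
  apply: measurable_normsq; exact: cmeasurable_horner.
rewrite big_cons log_coefM; last 2 first.
- by rewrite coefB coef1 coefZ coefX mulr0 subr0.
- rewrite -horner_coef0 horner_prod big1// => v _.
  by rewrite hornerD hornerN hornerZ hornerX mulr0 subr0 hornerC.
rewrite ReD -IH' -expect_weight_ln_geometric// -expectD; first last.
- by apply: admissibleM => //; exact: admissible_weight.
- by apply: admissibleM => //; exact: admissible_weight.
- exact: mC.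
by apply: expect_eq => z cz; have := lnM z cz; rewrite big_cons => ->; rewrite mulrDr.
Qed.
End Weight.

(** * Szego recursion and Bernstein-Szego measures *)

Section Szego.
Variables (R : realType) (a : nat -> R[i]).
Local Notation circle := (@unit_circle R).
Local Notation m := (@circle_measure R).
Local Notation mC := (@circle_measure_circle R).
Local Notation Re := (@complex.Re R).
Local Notation nc := (@ComplexField.Normc.normc R).
Local Notation conj := (@conjc R).

(* The pair of the monic orthogonal polynomial [Phi_n] and its reversal [Phi_n^*]. *)
Fixpoint szego n : {poly R[i]} * {poly R[i]} :=
  if n is k.+1 then
    ('X * (szego k).1 - conj (a k) *: (szego k).2,
     (szego k).2 - a k *: ('X * (szego k).1))
  else (1, 1).

Local Notation Phi n := (szego n).1.
Local Notation Phis n := (szego n).2.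

(** The constant [D_n], which [expect_normsq_szego] identifies with the squared norm of [Phi_n] in
    [L^2(mu)]. *)
Definition szego_const n : R := \prod_(k < n) (1 - normsq (a k)).

Lemma horner_szego n z : (Phi n.+1).[z] = z * (Phi n).[z] - conj (a n) * (Phis n).[z].
Proof. by rewrite /= hornerD hornerN hornerZ hornerM hornerX. Qed.

Lemma horner_szego_dual n z :
  (Phis n.+1).[z] = (Phis n).[z] - a n * (z * (Phi n).[z]).
Proof. by rewrite /= hornerD hornerN !hornerZ hornerM hornerX. Qed.

(** The induction step of each identity uses the other, hence the conjunction. *)
Lemma szego_reversed n z : z != 0 ->
  z ^+ n * conj (Phi n).[(conj z)^-1] = (Phis n).[z] /\
  z ^+ n * conj (Phis n).[(conj z)^-1] = (Phi n).[z].
Proof.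
move=> z0; have c1 : conj 1 = 1 by apply: complex_eq; rewrite /= ?oppr0.
elim: n => [|n [IH1 IH2]]; first by rewrite /= !hornerE ?expr0 ?mul1r c1.
rewrite /= !hornerE -IH1 -IH2 !(rmorphB, rmorphM) /= !fmorphV /= !conjcK.
rewrite !exprS; split.
  by field.
by field.
Qed.

Lemma szego_circle n z : circle z -> (Phi n).[z] = z ^+ n * conj (Phis n).[z].
Proof.
move=> cz; have z0 := circle_neq0 cz.
by have [_ <-] := szego_reversed n z0; rewrite (circle_conj cz) invrK.
Qed.

Hypothesis a1 : forall n, nc (a n) < 1.

Lemma szego_const_gt0 n : 0 < szego_const n.
Proof.
apply: prodr_gt0 => k _; rewrite subr_gt0 normsq_normc.
by rewrite expr_lt1 ?normc_ge0.
Qed.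

(** The inequality drives the induction: it gives [|a_n z Phi_n| < |Phi_n^*|], hence no zero at the
    next stage, and it is preserved thanks to [|q - a p|^2 - |p - conj a q|^2 = (1 - |a|^2) (|q|^2 -
    |p|^2)]. *)
Lemma szego_dual_neq0 n z : nc z <= 1 ->
  (Phis n).[z] != 0 /\ nc (Phi n).[z] <= nc (Phis n).[z].
Proof.
move=> z1; elim: n => [|n [IH1 IH2]].
  by rewrite /= !hornerE oner_neq0 lexx.
have h : nc (z * (Phi n).[z]) <= nc (Phis n).[z].
  by rewrite ncM -[leRHS]mul1r ler_pM ?normc_ge0.
have lt1 : 0 < nc (Phis n).[z] by rewrite nc_gt0.
split.
  rewrite horner_szego_dual subr_eq0; apply/eqP => e.
  have : nc (Phis n).[z] < nc (Phis n).[z].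
    rewrite {1}e ncM (le_lt_trans (ler_wpM2l (normc_ge0 _) h))//.
    by rewrite gtr_pMl.
  by rewrite ltxx.
rewrite -(@ler_pXn2r _ 2) ?nnegrE ?normc_ge0// -!normsq_normc -subr_ge0.
rewrite horner_szego horner_szego_dual; set q := (Phis n).[z]; set p := z * _.
have -> : normsq (q - a n * p) - normsq (p - conj (a n) * q) =
    (1 - normsq (a n)) * (normsq q - normsq p).
  move: (a n) q p => [x1 x2] [q1 q2] [p1 p2].
  by rewrite /normsq /=; ring.
rewrite mulr_ge0// subr_ge0 normsq_normc.
  by rewrite expr_le1 ?normc_ge0 ?ltW.
by rewrite normsq_normc lerXn2r ?nnegrE ?normc_ge0.
Qed.

Lemma coef0_szego_dual n : (Phis n)`_0 = 1.
Proof.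
by elim: n => [|n IH]; rewrite /= ?coef1// coefB IH coefZ coefXM mulr0 subr0.
Qed.

Lemma disk_function_szego_inv n : disk_function (fun z => (Phis n).[z]^-1).
Proof.
by apply: disk_function_inv (coef0_szego_dual n) _ => z /(szego_dual_neq0 n)[].
Qed.

(** Density of the Bernstein-Szego measure [mu_n] with respect to [circle_measure]. *)
Definition szego_density n (z : borelC R) : R :=
  szego_const n / normsq (Phis n).[z].

Lemma szego_density_gt0 n z : circle z -> 0 < szego_density n z.
Proof.
move=> /nc_circle z1; rewrite divr_gt0 ?szego_const_gt0// normsq_gt0.
by case: (@szego_dual_neq0 n z); rewrite ?z1.
Qed.

Lemma admissible_szego_density n : admissible (szego_density n).
Proof.
apply: admissibleZ.
have [ai _] := disk_function_szego_inv n.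
have := admissible_normsq ai; congr admissible; apply/funext => z.
by rewrite normsqV.
Qed.

(** The right side is twice the real part of [z^(n + 1)] times a disk function; such a function is
    orthogonal to trigonometric polynomials of degree at most [n], so consecutive densities share
    these moments. *)
Lemma szego_density_step n z : circle z ->
  szego_density n.+1 z - szego_density n z =
  2 * Re (a n * (szego_const n)%:C%C *
    (z ^+ n.+1 * ((Phis n).[z]^-1 * (Phis n.+1).[z]^-1))).
Proof.
move=> cz; have z1 : nc z <= 1 by rewrite (nc_circle z).1.
have [q0 _] := @szego_dual_neq0 n z z1.
have [r0 _] := @szego_dual_neq0 n.+1 z z1.
have pE := szego_circle n cz.
have rE : (Phis n.+1).[z] = (Phis n).[z] - a n * (z ^+ n.+1 * conj (Phis n).[z]).
  by rewrite horner_szego_dual pE exprS -[z * z ^+ n * _]mulrA.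
have zz : normsq (z ^+ n.+1) = 1 by rewrite normsqX (circleE z).1// expr1n.
rewrite /szego_density rE in r0 *; rewrite /szego_const big_ord_recr /=.
rewrite -/(szego_const n).
move: (szego_const n) (a n) (z ^+ n.+1) (Phis n).[z] zz q0 r0 => D x u q zz q0 r0.
set r := q - _ in r0 *.
have -> : x * D%:C%C * (u * (q^-1 * r^-1)) = D%:C%C * (x * u * (q^-1 * r^-1)) by ring.
rewrite Re_realM.
(* Multiplying by conjugates leaves only the real denominators [|q|^2] and [|r|^2], which the
   relation [e] below connects. *)
have -> : q^-1 * r^-1 = ((normsq q)^-1 * (normsq r)^-1)%:C%C * (conj q * conj r).
  rewrite rmorphM !fmorphV /= !normsqE.
  have cr0 : conj r != 0 by rewrite conjc_eq0.
  have cq0 : conj q != 0 by rewrite conjc_eq0.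
  by field; rewrite r0 q0 cr0 cq0.
rewrite [x * u * _]mulrCA Re_realM.
have n1 : normsq q != 0 by rewrite normsq_eq0.
have n2 : normsq r != 0 by rewrite normsq_eq0.
have -> : x * u * (conj q * conj r) =
    x * u * conj q ^+ 2 - (normsq x)%:C%C * (normsq u)%:C%C * (normsq q)%:C%C.
  by rewrite !normsqE /r rmorphB !rmorphM /= conjcK; ring.
rewrite zz mulr1 -rmorphM ReD ReN /=.
have e : normsq r = normsq q * (1 + normsq x) - 2 * Re (x * u * conj q ^+ 2).
  have : normsq r = normsq q + normsq x * normsq u * normsq q
     - 2 * Re (x * u * conj q ^+ 2).
    rewrite /r; move: x u q {zz q0 r0 r n1 n2} => [x1 x2] [u1 u2] [q1 q2].
    by rewrite /normsq expr2 /=; ring.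
  by rewrite zz => ->; ring.
by field: e; rewrite n1 n2.
Qed.
End Szego.

(** * Moments of the Bernstein-Szego measures *)

Section SzegoMoments.
Variables (R : realType) (a : nat -> R[i]).
Hypothesis a1 : forall n, ComplexField.Normc.normc (a n) < 1.
Local Notation circle := (@unit_circle R).
Local Notation m := (@circle_measure R).
Local Notation mC := (@circle_measure_circle R).
Local Notation conj := (@conjc R).
Local Notation Phi n := (szego a n).1.
Local Notation Phis n := (szego a n).2.
Implicit Types p : {poly R[i]}.

Lemma size_szego n : (size (Phi n) <= n.+1)%N /\ (size (Phis n) <= n.+1)%N.
Proof.
elim: n => [|n [IH1 IH2]]; first by rewrite /= size_poly1.
have h : (size ('X * Phi n)%R <= n.+2)%N.
  by rewrite (leq_trans (size_polyMleq _ _))// size_polyX.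
split; rewrite (leq_trans (size_polyD _ _))// geq_max size_polyN.
  by rewrite h (leq_trans (size_scale_leq _ _))// ltnW.
by rewrite (leq_trans IH2)// (leq_trans (size_scale_leq _ _)).
Qed.

Lemma lead_szego n : (Phi n)`_n = 1.
Proof.
elim: n => [|n IH]; first by rewrite /= coef1.
have [_ h] := size_szego n.
by rewrite /= coefB coefXM /= IH coefZ (nth_default _ h) mulr0 subr0.
Qed.

Lemma cadmissible_real (f : borelC R -> R) :
  admissible f -> cadmissible (fun z => (f z)%:C%C).
Proof. by move=> af; split => //; exact: admissible_cst. Qed.

Let density n (z : borelC R) : R[i] := (szego_density a n z)%:C%C.

Let cadmissible_density n p : cadmissible (fun z => density n z * p.[z]).
Proof.
apply: cadmissibleM; last exact: cadmissible_horner.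
exact/cadmissible_real/admissible_szego_density.
Qed.

(** The difference of the densities is [F + conj F] with [F = c z^(n + 1) G]. The mean of [F p]
    vanishes, and so does that of [p conj F], which is the conjugate of [z] times the disk function
    [c r G]; here [r = z^n conj p] on the circle is a polynomial because [p] has degree at most
    [n]. *)
Lemma szego_density_stable n p : (size p <= n.+1)%N ->
  cexpect m (fun z => density n.+1 z * p.[z]) =
  cexpect m (fun z => density n z * p.[z]).
Proof.
move=> sp; pose c := a n * (szego_const a n)%:C%C.
pose G z := (Phis n).[z]^-1 * (Phis n.+1).[z]^-1.
pose r : {poly R[i]} := \sum_(i < n.+1) conj p`_i *: 'X^(n - i).
have dG (q : {poly R[i]}) : @disk_function R (fun z => q.[z] * G z).
  apply: disk_functionM (disk_function_horner q) _.
  by apply: disk_functionM; exact: disk_function_szego_inv.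
have rE z : circle z -> r.[z] = z ^+ n * conj p.[z].
  move=> cz; rewrite (horner_coef_wide _ sp) rmorph_sum mulr_sumr /r horner_sum.
  apply: eq_bigr => i _; rewrite hornerZ hornerXn rmorphM rmorphXn /=.
  rewrite (circle_conj cz) mulrCA -[in z ^+ n](subnK (leq_ord i)).
  by rewrite exprVn exprD mulfK// expf_neq0// circle_neq0.
pose q1 := c *: ('X^n * p); pose q2 := c *: r.
have ai := @cadmissible_id R.
have a1' : @cadmissible R (fun z => z * (q1.[z] * G z)).
  by apply: cadmissibleM => //; have [] := dG q1.
have a2' : @cadmissible R (fun z => z * (q2.[z] * G z)).
  by apply: cadmissibleM => //; have [] := dG q2.
have e : cexpect m (fun z => z * (q1.[z] * G z) + conj (z * (q2.[z] * G z))) = 0.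
  rewrite (cexpectD mC a1' (cadmissible_conj a2')) (cexpect_conj mC a2').
  rewrite !cexpect_disk_function ?add0r//; exact: conjc0.
transitivity (cexpect m (fun z => density n z * p.[z] +
    (z * (q1.[z] * G z) + conj (z * (q2.[z] * G z))))); last first.
  rewrite (cexpectD mC (cadmissible_density n p)); first by rewrite e addr0.
  by apply: cadmissibleD => //; exact: cadmissible_conj.
apply: cexpect_eq => z cz; rewrite /density.
rewrite -[szego_density a n.+1 z](subrK (szego_density a n z)).
rewrite szego_density_step// rmorphD mulrDl addrC; congr (_ + _).
rewrite -/c -/(G z).
have re2 (x : R[i]) : (2 * complex.Re x)%:C%C = x + conj x.
  by case: x => x y; apply: complex_eq => /=; ring.
rewrite [X in X * _](re2 (c * (z ^+ n.+1 * G z))).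
rewrite mulrDl /q1 /q2 !hornerZ hornerM hornerXn rE// exprS; congr (_ + _).
  by ring.
have -> : z * (c * (z ^+ n * conj p.[z]) * G z) =
    c * (z * z ^+ n * G z) * conj p.[z] by ring.
have cM (x y : R[i]) : conj (x * conj y) = conj x * y by rewrite rmorphM /= conjcK.
by rewrite cM -mulrA.
Qed.

(** On the circle [Phi_(n+1)] is [z^(n+1)] times the conjugate of its reversal, which cancels the
    conjugate factor of the denominator and leaves [z] times a disk function. *)
Lemma szego_density_orthogonal n :
  cexpect m (fun z => density n.+1 z * (Phi n.+1).[z]) = 0.
Proof.
pose D := (szego_const a n.+1)%:C%C : R[i].
rewrite -[RHS](cexpect_disk_function (f := fun z =>
  (D *: 'X^n : {poly R[i]}).[z] * (Phis n.+1).[z]^-1)); last first.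
  by apply: disk_functionM; [exact: disk_function_horner|exact: disk_function_szego_inv].
apply: cexpect_eq => z cz; rewrite szego_circle// /density /szego_density.
have z1 : ComplexField.Normc.normc z <= 1 by rewrite (nc_circle z).1.
have [q0 _] := szego_dual_neq0 a1 n.+1 z1.
have cq0 : conj (Phis n.+1).[z] != 0 by rewrite conjc_eq0.
rewrite rmorphM fmorphV /= normsqE hornerZ hornerXn -/D exprS.
by field; rewrite q0 cq0.
Qed.

(** As [Phi_(n+1)] is monic, the vanishing of its mean determines moment [n + 1] from the lower
    ones. Both [mu] and [mu_(n+1)] satisfy it, and passing from [mu_n] to [mu_(n+1)] keeps the lower
    moments. Orthogonality to the constant 1 is thus enough. *)
Lemma szego_moments (mu : probability (borelC R) R) :
  on_unit_circle mu -> (forall n, cexpect mu (fun z => (Phi n.+1).[z]) = 0) ->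
  forall n p, (size p <= n.+1)%N ->
  cexpect mu (fun z => p.[z]) = cexpect m (fun z => density n z * p.[z]).
Proof.
move=> hmu orth; elim=> [|n IH] p sp.
  rewrite (size1_polyC sp) -[LHS](_ : cexpect mu (fun=> p`_0) = _); last first.
    by apply: cexpect_eq => z _; rewrite hornerC.
  rewrite (cexpect_cst hmu) -[LHS](cexpect_cst mC); apply: cexpect_eq => z _.
  rewrite hornerC /density /szego_density /szego_const big_ord0 /=.
  by rewrite -polyC1 hornerC normsq1 divr1 mul1r.
pose c := p`_n.+1; pose r := p - c *: Phi n.+1.
have sr : (size r <= n.+1)%N.
  apply/leq_sizeP => j nj; rewrite coefB coefZ.
  have [->|jn] := eqVneq j n.+1; first by rewrite lead_szego mulr1 subrr.
  have nj' : (n.+1 < j)%N by rewrite ltn_neqAle eq_sym jn.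
  have [h _] := size_szego n.+1.
  by rewrite !nth_default ?mulr0 ?subr0// (leq_trans _ nj').
have pE z : p.[z] = r.[z] + c * (Phi n.+1).[z].
  by rewrite -hornerZ -hornerD subrK.
have ar := cadmissible_horner r; have aP := cadmissible_horner (Phi n.+1).
have acP : @cadmissible R (fun z => c * (Phi n.+1).[z]).
  exact: cadmissibleM (cadmissible_cst c) aP.
transitivity (cexpect mu (fun z => r.[z] + c * (Phi n.+1).[z])).
  by apply: cexpect_eq => z _; rewrite pE.
rewrite (cexpectD hmu ar acP) (cexpectZ hmu c aP) orth mulr0 addr0 IH//.
rewrite -szego_density_stable//.
have adP : @cadmissible R (fun z => c * (density n.+1 z * (Phi n.+1).[z])).
  exact: cadmissibleM (cadmissible_cst c) (cadmissible_density _ _).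
rewrite -[LHS]addr0 -[X in _ + X](mulr0 c) -(szego_density_orthogonal n).
rewrite -(cexpectZ mC c (cadmissible_density _ _)).
rewrite -(cexpectD mC (cadmissible_density _ _) adP).
by apply: cexpect_eq => z _; rewrite pE; ring.
Qed.
End SzegoMoments.

(** * Gram-Schmidt polynomials and the monic Szego recursion *)

Section GramSchmidt.
Variables (R : realType) (mu : probability (borelC R) R) (alpha : nat -> R[i]).
Hypothesis mu_circle : on_unit_circle mu.
Local Notation circle := (@unit_circle R).
Local Notation conj := (@conjc R).
Local Notation nc := (@ComplexField.Normc.normc R).
Local Notation Phi n := (szego alpha n).1.
Local Notation Phis n := (szego alpha n).2.
Implicit Types p q : {poly R[i]}.

(** The Verblunsky recursion is given at nonzero [z] only; the points 1, 2, 3, ... already exceed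
    the possible number of roots of [p - q]. *)
Lemma poly_eq_nonzero p q : (forall z, z != 0 -> p.[z] = q.[z]) -> p = q.
Proof.
move=> pq; apply/eqP; rewrite -subr_eq0; apply/negPn/negP => r0.
have := max_poly_roots r0 (rs := [seq k.+1%:R | k <- iota 0 (size (p - q)%R)]).
rewrite size_map size_iota ltnn => H; suff: false by []; apply: H.
  apply/allP => _ /mapP[k _ ->].
  by rewrite /root hornerD hornerN pq ?subrr// pnatr_eq0.
rewrite map_inj_uniq ?iota_uniq// => i j /eqP.
by rewrite eqr_nat eqSS => /eqP.
Qed.

Lemma cadmissible_dotp p q : @cadmissible R (fun z => conj p.[z] * q.[z]).
Proof.
apply: cadmissibleM; last exact: cadmissible_horner.
by apply: cadmissible_conj; exact: cadmissible_horner.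
Qed.

Lemma dotpE p q : dotp mu p q = cexpect mu (fun z => conj p.[z] * q.[z]).
Proof. by rewrite -(integralC_cexpect mu_circle (cadmissible_dotp p q)). Qed.

Lemma dotp1E q : dotp mu 1 q = cexpect mu (fun z => q.[z]).
Proof.
rewrite dotpE; apply: cexpect_eq => z _.
have -> : conj (1 : {poly R[i]}).[z] = 1.
  by rewrite -polyC1 hornerC; apply: complex_eq; rewrite /= ?oppr0.
by rewrite mul1r.
Qed.

Lemma dotpZ c p : dotp mu (c *: p) (c *: p) = (normsq c)%:C%C * dotp mu p p.
Proof.
rewrite !dotpE -(cexpectZ mu_circle _ (cadmissible_dotp p p)).
apply: cexpect_eq => z _; rewrite hornerZ rmorphM normsqE /=; ring.
Qed.

Lemma dotp_normsq p : dotp mu p p = (expect mu (fun z => normsq p.[z]))%:C%C.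
Proof.
rewrite dotpE; apply: complex_eq => /=.
  by apply: expect_eq => z _; rewrite mulrC -normsqE.
rewrite -[RHS](expect_cst mu_circle 0).
by apply: expect_eq => z _; rewrite mulrC -normsqE.
Qed.

Definition gs_residual n : {poly R[i]} :=
  'X^n - \sum_(q <- gram_schmidt mu n) dotp mu q 'X^n *: q.

Lemma orthopolyE n :
  orthopoly mu n = (sqrtC (dotp mu (gs_residual n) (gs_residual n)))^-1 *: gs_residual n.
Proof. by rewrite /orthopoly /= last_rcons. Qed.

Lemma gram_schmidtE n : gram_schmidt mu n = [seq orthopoly mu k | k <- iota 0 n].
Proof.
elim: n => // n IH; rewrite -addn1 iotaD map_cat -IH addn1 cats1 add0n /=.
by rewrite orthopolyE.
Qed.

Lemma orthopoly0 : orthopoly mu 0 = 1.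
Proof.
rewrite orthopolyE /gs_residual /= big_nil subr0 expr0 dotp1E.
rewrite -[X in sqrtC X](_ : cexpect mu (fun=> 1) = _); last first.
  by apply: cexpect_eq => z _; rewrite -polyC1 hornerC.
by rewrite (cexpect_cst mu_circle) sqrtC1 invr1 scale1r.
Qed.

(** In the projection subtracted from ['X^(n.+1)], the terms of positive index pair to 0 with 1 by
    induction, and the term of index 0 reproduces the mean of ['X^(n.+1)]. Pairings with 1 are all
    that [szego_moments] asks for. *)
Lemma dotp1_orthopoly n : dotp mu 1 (orthopoly mu n) = (n == 0)%:R.
Proof.
have lin c q : dotp mu 1 (c *: q) = c * dotp mu 1 q.
  rewrite !dotp1E -(cexpectZ mu_circle _ (cadmissible_horner q)).
  by apply: cexpect_eq => z _; rewrite hornerZ.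
elim/ltn_ind: n => -[_|n IH].
  rewrite orthopoly0 dotp1E -[LHS](_ : cexpect mu (fun=> 1) = _); last first.
    by apply: cexpect_eq => z _; rewrite -polyC1 hornerC.
  exact: cexpect_cst.
rewrite orthopolyE lin /gs_residual; set S := \sum_(_ <- _) _.
have -> : dotp mu 1 ('X^(n.+1) - S) = dotp mu 1 'X^(n.+1) - dotp mu 1 S.
  have -> : - dotp mu 1 S = dotp mu 1 (- S) by rewrite -[in RHS]scaleN1r lin mulN1r.
  rewrite !dotp1E -(cexpectD mu_circle (cadmissible_horner _) (cadmissible_horner _)).
  by apply: cexpect_eq => z _; rewrite hornerD.
have -> : dotp mu 1 S = dotp mu 1 'X^(n.+1); last by rewrite subrr mulr0.
have cS (s : seq {poly R[i]}) (F : {poly R[i]} -> {poly R[i]}) :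
    dotp mu 1 (\sum_(q <- s) F q) = \sum_(q <- s) dotp mu 1 (F q).
  elim: s => [|q s IHs]; first by rewrite !big_nil -[X in dotp _ _ X](scale0r 0) lin mul0r.
  rewrite !big_cons -IHs !dotp1E.
  rewrite -(cexpectD mu_circle (cadmissible_horner _) (cadmissible_horner _)).
  by apply: cexpect_eq => z _; rewrite hornerD.
rewrite /S cS gram_schmidtE big_map /=.
rewrite big_cons lin IH// mulr1 orthopoly0 big1_seq ?addr0// => k /=.
rewrite mem_iota => /andP[k1 k2]; rewrite lin IH ?gtn_eqF ?mulr0//.
Qed.

Hypothesis mu_alpha : verblunsky mu alpha.

Lemma alpha_lt1 n : nc (alpha n) < 1.
Proof. by have [h _] := mu_alpha n; rewrite -ltcR normcE. Qed.

Lemma sqrtC_real (x : R) : 0 <= x -> sqrtC (x%:C%C) = (Num.sqrt x)%:C%C :> R[i].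
Proof.
move=> x0; rewrite -{1}(sqr_sqrtr x0) rmorphXn /= sqrCK//.
by rewrite ler0c sqrtr_ge0.
Qed.

(** Dividing the Verblunsky recursion by [rho = sqrt (1 - |alpha_n|^2)] gives the monic one:
    reversal commutes with real scalars, and [1 / rho] turns the factor [D_n^(-1/2)] into
    [D_(n+1)^(-1/2)]. *)
Lemma orthopoly_szego n :
  orthopoly mu n = ((Num.sqrt (szego_const alpha n))^-1)%:C%C *: Phi n.
Proof.
have D0 := szego_const_gt0 alpha_lt1.
elim: n => [|n IH].
  by rewrite orthopoly0 /szego_const big_ord0 sqrtr1 invr1 scale1r.
have [_ rec] := mu_alpha n; apply: poly_eq_nonzero => z z0.
have a0 : 0 < 1 - normsq (alpha n).
  by rewrite subr_gt0 normsq_normc expr_lt1 ?normc_ge0 ?alpha_lt1.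
have := rec z z0; rewrite -normsq_norm -(rmorph1 (real_complex R)) -rmorphB.
rewrite sqrtC_real ?ltW//; set rho := Num.sqrt _.
have rho0 : rho%:C%C != 0 :> R[i].
  by rewrite eq_complex /= eqxx andbT gt_eqF// sqrtr_gt0.
rewrite /reversed_poly IH !hornerZ; set k := Num.sqrt (szego_const alpha n).
have ck (x : R) (w : R[i]) : conj (x%:C%C * w) = x%:C%C * conj w.
  by apply: complex_eq; rewrite ?Re_conj ?Im_conj ?Re_realM ?Im_realM
    ?Re_conj ?Im_conj ?mulrN.
have conjE (w : R[i]) : (w^*)%R = conj w by [].
rewrite !conjE ck => e.
apply: (mulfI rho0); rewrite horner_szego.
have [h _] := szego_reversed alpha n z0.
move/eqP: e; rewrite -subr_eq => /eqP <-; rewrite -h.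
have -> : (Num.sqrt (szego_const alpha n.+1))^-1 = rho^-1 * k^-1.
  rewrite /szego_const big_ord_recr /= sqrtrM; last by rewrite ltW// D0.
  by rewrite invfM mulrC.
have k0 : k%:C%C != 0 :> R[i].
  by rewrite eq_complex /= eqxx andbT gt_eqF// sqrtr_gt0.
by rewrite rmorphM !fmorphV /=; field; rewrite rho0 k0.
Qed.

Lemma cexpect_szego n : cexpect mu (fun z => (Phi n.+1).[z]) = 0.
Proof.
have := dotp1_orthopoly n.+1; rewrite orthopoly_szego dotp1E /= => e.
have k0 : ((Num.sqrt (szego_const alpha n.+1))^-1)%:C%C != 0 :> R[i].
  by rewrite eq_complex /= eqxx andbT invr_eq0 gt_eqF// sqrtr_gt0 szego_const_gt0//;
    exact: alpha_lt1.
apply: (mulfI k0); rewrite mulr0 -[RHS]e.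
rewrite -(cexpectZ mu_circle _ (cadmissible_horner _)).
by apply: cexpect_eq => z _; rewrite hornerZ.
Qed.

Lemma expect_normsq_szego n :
  expect mu (fun z => normsq (Phi n).[z]) = szego_const alpha n.
Proof.
have D0 := szego_const_gt0 alpha_lt1 n.
set c := (Num.sqrt (szego_const alpha n))^-1.
have c0 : c != 0 by rewrite invr_eq0 gt_eqF// sqrtr_gt0.
have opE := orthopoly_szego n.
(* A residual of norm 0 would make the normalized polynomial 0, through [0^-1 = 0], against its
   nonzero leading coefficient [c]. *)
have r0 : dotp mu (gs_residual n) (gs_residual n) != 0.
  apply/eqP => d0; move: opE; rewrite orthopolyE d0 sqrtC0 invr0 scale0r.
  move=> /(congr1 (fun p : {poly R[i]} => p`_n)); rewrite coefZ lead_szego mulr1 coef0.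
  by move=> /eqP; rewrite eq_sym eq_complex /= (negbTE c0).
have : dotp mu (orthopoly mu n) (orthopoly mu n) = 1.
  rewrite {1 2}orthopolyE dotpZ; move: r0; rewrite dotp_normsq.
  set d := expect _ _ => d0.
  have d0' : 0 < d.
    rewrite lt_def expect_ge0 ?andbT => [|z _]; last exact: normsq_ge0.
    by apply: contra d0 => /eqP ->.
  rewrite sqrtC_real ?ltW// normsqV /normsq /= expr0n addr0 sqr_sqrtr ?ltW//.
  by rewrite -rmorphM mulVf// gt_eqF.
rewrite opE dotpZ dotp_normsq -rmorphM => /complexI.
rewrite {1}/normsq /= expr0n addr0 /c exprVn sqr_sqrtr ?ltW// => /(canRL (mulKf _)) ->.
  by rewrite invrK mulr1.
by rewrite invr_eq0 gt_eqF.
Qed.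
End GramSchmidt.

(** * Approximation by trigonometric polynomials *)

Section TrigApprox.
Variable R : realType.
Local Notation circle := (@unit_circle R).
Local Notation conj := (@conjc R).
Local Notation Re := (@complex.Re R).
Local Notation nc := (@ComplexField.Normc.normc R).
Implicit Types (f g : borelC R -> R) (p q : {poly R[i]}).

(* On the circle every trigonometric polynomial is the real part of a polynomial. *)
Definition trig_approx f := admissible f /\
  forall e, 0 < e -> exists p : {poly R[i]},
    forall z, circle z -> `|f z - Re p.[z]| <= e.

Lemma trig_approx_Re p : trig_approx (fun z => Re p.[z]).
Proof.
split; first by case: (cadmissible_horner p).
by move=> e e0; exists p => z _; rewrite subrr normr0 ltW.
Qed.

Lemma trig_approx_closed f : admissible f ->
  (forall e, 0 < e -> exists2 g, trig_approx g &
    forall z, circle z -> `|f z - g z| <= e) -> trig_approx f.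
Proof.
move=> af fg; split=> // e e0; have e2 : 0 < e / 2 by rewrite divr_gt0.
have [g [_ hg] fge] := fg _ e2; have [p hp] := hg _ e2.
exists p => z cz; rewrite -[f z](subrK (g z)) -addrA (le_trans (ler_normD _ _))//.
by rewrite [leRHS](splitr e) lerD ?fge ?hp.
Qed.

Lemma trig_approx_cst c : trig_approx (fun=> c).
Proof.
have := trig_approx_Re (c%:C%C)%:P; congr trig_approx.
by apply/funext => z; rewrite hornerC.
Qed.

Lemma trig_approxD f g : trig_approx f -> trig_approx g ->
  trig_approx (fun z => f z + g z).
Proof.
move=> [af hf] [ag hg]; split; first exact: admissibleD.
move=> e e0; have e2 : 0 < e / 2 by rewrite divr_gt0.
have [p hp] := hf _ e2; have [q hq] := hg _ e2; exists (p + q) => z cz.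
rewrite hornerD ReD opprD addrACA (le_trans (ler_normD _ _))//.
by rewrite [leRHS](splitr e) lerD ?hp ?hq.
Qed.

(** The product is a trigonometric polynomial; each monomial of negative frequency is replaced by
    its conjugate, which has the same real part. *)
Lemma Re_conjM_horner p q :
  exists r : {poly R[i]}, forall z, circle z -> Re (conj p.[z] * q.[z]) = Re r.[z].
Proof.
have mono (c : R[i]) i j : exists r : {poly R[i]}, forall z, circle z ->
    Re (c * (conj z ^+ i * z ^+ j)) = Re r.[z].
  have [ij|ji] := leqP i j.
    exists (c *: 'X^(j - i)) => z cz; rewrite hornerZ hornerXn (circle_conj cz).
    rewrite -{1}(subnK ij) exprD exprVn [_^-1 * _]mulrC mulfK//.
    by rewrite expf_neq0// circle_neq0.
  exists (conj c *: 'X^(i - j)) => z cz; rewrite hornerZ hornerXn.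
  rewrite -[RHS]Re_conj rmorphM rmorphXn /= conjcK (circle_conj cz).
  rewrite -{1}(subnK (ltnW ji)) exprD !exprVn mulrVK ?unitfE//.
  by rewrite expf_neq0// circle_neq0.
pose P (F : R[i] -> R[i]) :=
  exists r : {poly R[i]}, forall z, circle z -> Re (F z) = Re r.[z].
have PD F G : P F -> P G -> P (fun z => F z + G z).
  move=> [r hr] [s hs]; exists (r + s) => z cz.
  by rewrite hornerD !ReD hr// hs.
have P0 : P (fun=> 0) by exists 0 => z _; rewrite horner0.
have Psum n (F : nat -> R[i] -> R[i]) : (forall i, P (F i)) ->
    P (fun z => \sum_(i < n) F i z).
  move=> PF; elim: n => [|n [r hr]].
    by exists 0 => z _; rewrite big_ord0 horner0.
  have [s hs] := PF n; exists (r + s) => z cz.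
  by rewrite big_ord_recr /= hornerD !ReD hr// hs.
have [r hr] : P (fun z => \sum_(i < size p) \sum_(j < size q)
    (conj p`_i * q`_j) * (conj z ^+ i * z ^+ j)).
  apply: (Psum _ (fun i z => \sum_(j < size q)
    (conj p`_i * q`_j) * (conj z ^+ i * z ^+ j))) => i.
  by apply: (Psum _ (fun j z => (conj p`_i * q`_j) * (conj z ^+ i * z ^+ j))) => j.
exists r => z /hr <-; congr Re.
rewrite !horner_coef rmorph_sum mulr_suml; apply: eq_bigr => i _.
rewrite mulr_sumr; apply: eq_bigr => j _; rewrite rmorphM rmorphXn /=; ring.
Qed.

Lemma trig_approxM f g : trig_approx f -> trig_approx g ->
  trig_approx (fun z => f z * g z).
Proof.
move=> [af hf] [ag hg]; split; first exact: admissibleM.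
move=> e e0; have e2 : 0 < e / 2 by rewrite divr_gt0.
have [_ [M' fM']] := af; pose M := `|M'| + 1.
have M0 : 0 < M by rewrite ltr_wpDl.
have fM z : circle z -> `|f z| <= M.
  by move=> /fM' /le_trans -> //; rewrite (le_trans (ler_norm _))// lerDl.
have [q hq] := hg _ (divr_gt0 e2 M0).
have [_ [N' qN']] : admissible (fun z => Re q.[z]) by case: (cadmissible_horner q).
pose N := `|N'| + 1; have N0 : 0 < N by rewrite ltr_wpDl.
have qN z : circle z -> `|Re q.[z]| <= N.
  by move=> /qN' /le_trans -> //; rewrite (le_trans (ler_norm _))// lerDl.
have [p hp] := hf _ (divr_gt0 e2 N0).
have [r hr] := Re_conjM_horner p q.
(* [Re a Re b = Re (a b + conj a b) / 2]. *)
exists (2^-1%:C%C *: (p * q + r)) => z cz.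
have -> : Re (2^-1%:C%C *: (p * q + r)).[z] = Re p.[z] * Re q.[z].
  rewrite hornerZ hornerD hornerM Re_realM ReD -hr// !ReM Re_conj Im_conj.
  by field.
have -> : f z * g z - Re p.[z] * Re q.[z] =
    f z * (g z - Re q.[z]) + (f z - Re p.[z]) * Re q.[z] by ring.
apply: le_trans (ler_normD _ _) _; rewrite !normrM [leRHS](splitr e).
have Mn : M != 0 by rewrite gt_eqF. have Nn : N != 0 by rewrite gt_eqF.
rewrite lerD//.
  by rewrite -[leRHS](divfK Mn) mulrC ler_pM ?hq ?fM.
by rewrite -[leRHS](divfK Nn) ler_pM ?hp ?qN.
Qed.

Lemma trig_approxZ c f : trig_approx f -> trig_approx (fun z => c * f z).
Proof. exact: trig_approxM (trig_approx_cst c). Qed.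

Lemma trig_approxN f : trig_approx f -> trig_approx (fun z => - f z).
Proof.
move=> /(trig_approxZ (-1)); congr trig_approx.
by apply/funext => z; rewrite mulN1r.
Qed.

Lemma trig_approxB f g : trig_approx f -> trig_approx g ->
  trig_approx (fun z => f z - g z).
Proof. by move=> hf hg; apply: trig_approxD => //; exact: trig_approxN. Qed.

(** The classical iteration [y + (x^2 - y^2) / 2] started at 0: polynomial in [x], it increases to
    [|x|] uniformly on [[-1, 1]], which makes the uniform limits of trigonometric polynomials a
    lattice. *)
Fixpoint abs_iter n (x : R) : R :=
  if n is k.+1 then abs_iter k x + (x ^+ 2 - abs_iter k x ^+ 2) / 2 else 0.

Lemma abs_iter_bound n x : `|x| <= 1 ->
  0 <= abs_iter n x <= `|x| /\ `|x| - abs_iter n x <= `|x| * (1 - `|x| / 2) ^+ n.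
Proof.
move=> x1; have x0 := normr_ge0 x; have xx : x ^+ 2 = `|x| ^+ 2 by rewrite real_normK ?num_real.
elim: n => [|n [/andP[h1 h2] h3]] /=; first by rewrite lexx x0 subr0 mulr1.
set y := abs_iter n x in h1 h2 h3 *; rewrite xx.
have e : `|x| - (y + (`|x| ^+ 2 - y ^+ 2) / 2) = (`|x| - y) * (1 - (`|x| + y) / 2).
  by field.
split.
  apply/andP; split.
    have : y ^+ 2 <= `|x| ^+ 2 by rewrite lerXn2r ?nnegrE.
    lra.
  by rewrite -subr_ge0 e mulr_ge0 ?subr_ge0//; lra.
rewrite e exprSr mulrA ler_pM ?subr_ge0//; lra.
Qed.

Lemma abs_iter_error n x : `|x| <= 1 -> `| `|x| - abs_iter n.+1 x| <= 2 / n.+1%:R.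
Proof.
move=> x1; have x0 := normr_ge0 x.
have [/andP[_ h2] h3] := abs_iter_bound n.+1 x1.
rewrite ger0_norm ?subr_ge0// (le_trans h3)//.
set t := `|x| in x1 x0 *; set s := t / 2.
have s01 : 0 <= s <= 1 by rewrite /s; apply/andP; split; lra.
(* Bernoulli's inequality in the form that bounds [k s (1 - s)^k] by 1, uniformly in [s]. *)
have bern k : (1 - s) ^+ k * (1 + k%:R * s) <= 1.
  elim: k => [|k IH]; first by rewrite expr0 mul0r addr0 mulr1.
  apply: le_trans IH; rewrite exprSr -mulrA ler_wpM2l ?exprn_ge0//; first lra.
  rewrite -natr1; have : 0 <= (k%:R + 1) * s ^+ 2 :> R by rewrite mulr_ge0 ?sqr_ge0.
  lra.
have n0 : 0 < n.+1%:R :> R by rewrite ltr0n.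
rewrite ler_pdivlMr//.
have h := bern n.+1; have p0 : 0 <= (1 - s) ^+ n.+1 by rewrite exprn_ge0//; lra.
have -> : t * (1 - s) ^+ n.+1 * n.+1%:R = 2 * ((1 - s) ^+ n.+1 * (n.+1%:R * s)).
  by rewrite /s; field.
lra.
Qed.

Lemma trig_approx_abs f : trig_approx f -> trig_approx (fun z => `|f z|).
Proof.
move=> Vf; have [af _] := Vf; have [_ [M' fM']] := af; pose M := `|M'| + 1.
have M0 : 0 < M by rewrite ltr_wpDl.
have fM z : circle z -> `|M^-1 * f z| <= 1.
  move=> /fM' h; rewrite normrM gtr0_norm ?invr_gt0// ler_pdivrMl// mulr1.
  by rewrite (le_trans h)// (le_trans (ler_norm _))// lerDl.
have Viter n : trig_approx (fun z => abs_iter n (M^-1 * f z)).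
  have VMf := trig_approxZ M^-1 Vf.
  elim: n => [|n IH] /=; first exact: trig_approx_cst.
  apply: trig_approxD => //.
  under eq_fun do rewrite mulrC !expr2.
  by apply: trig_approxZ; apply: trig_approxB; exact: trig_approxM.
apply: trig_approx_closed; first exact: admissible_norm.
move=> e e0; pose n := Num.truncn (2 * M / e).
exists (fun z => M * abs_iter n.+1 (M^-1 * f z)); first exact: trig_approxZ.
move=> z cz; have h := abs_iter_error n (fM z cz).
have -> : `|f z| = M * `|M^-1 * f z|.
  by rewrite normrM gtr0_norm ?invr_gt0// mulVKf// gt_eqF.
rewrite -mulrBr [leLHS]normrM (gtr0_norm M0).
apply: le_trans (ler_wpM2l (ltW M0) h) _.
have n0 : 0 < n.+1%:R :> R by rewrite ltr0n.
rewrite mulrA ler_pdivrMr// [M * 2]mulrC [e * _]mulrC -ler_pdivrMr//.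
exact/ltW/truncnS_gt.
Qed.

Lemma trig_approx_max f g : trig_approx f -> trig_approx g ->
  trig_approx (fun z => Num.max (f z) (g z)).
Proof.
move=> Vf Vg; have := trig_approxZ 2^-1
  (trig_approxD (trig_approxD Vf Vg) (trig_approx_abs (trig_approxB Vf Vg))).
congr trig_approx; apply/funext => z; case: (lerP (f z) (g z)) => h.
  by field.
by field.
Qed.

Lemma trig_approx_min f g : trig_approx f -> trig_approx g ->
  trig_approx (fun z => Num.min (f z) (g z)).
Proof.
move=> Vf Vg.
have := trig_approxN (trig_approx_max (trig_approxN Vf) (trig_approxN Vg)).
congr trig_approx; apply/funext => z.
by case: (lerP (f z) (g z)) => h; case: lerP => h'; rewrite ?opprK//; lra.
Qed.
End TrigApprox.

Section DominatedExpect.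
Variables (R : realType) (P : probability (borelC R) R).
Hypothesis P_circle : on_unit_circle P.
Local Notation circle := (@unit_circle R).

(** Dominated convergence. Eventual vanishing suffices because the approximations it is applied to
    become constant at each point. *)
Lemma expect_eventually0 (F : nat -> borelC R -> R) (M : R) :
  (forall n, admissible (F n)) ->
  (forall n z, circle z -> `|F n z| <= M) ->
  (forall z, circle z -> exists N, forall n, (N <= n)%N -> F n z = 0) ->
  forall e, 0 < e -> exists N, forall n, (N <= n)%N -> `|expect P (F n)| <= e.
Proof.
move=> aF FM F0 e e0.
have mc := @measurable_circle R.
have [|||||_ _] := @dominated_convergence _ (borelC R) R P circle mc
  (fun n z => (F n z)%:E) (fun=> 0%E) (fun=> M%:E).
- by move=> n; apply/measurable_EFinP; apply: measurable_funTS; case: (aF n).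
- exact: measurable_cst.
- apply: aeW => z cz; have [N hN] := F0 z cz.
  apply: cvg_near_cst; exists N => // n /= Nn; by rewrite hN.
- exact: (integrable_admissible P_circle (admissible_cst M)).
- by apply: aeW => z n cz; rewrite lee_fin FM.
rewrite integral0 => /fine_cvgP[_ /cvgrPdist_le /(_ e e0)[N _ hN]].
exists N => n /hN /=; by rewrite sub0r normrN.
Qed.
End DominatedExpect.

(** * Density of trigonometric polynomials in L^1 of two measures at once *)

Section L1Density.
Variables (R : realType) (P Q : probability (borelC R) R).
Hypotheses (P_circle : on_unit_circle P) (Q_circle : on_unit_circle Q).
Local Notation circle := (@unit_circle R).
Implicit Types (f g h : borelC R -> R) (A : set (borelC R)).

Let S f := expect P f + expect Q f.

Let S_le f g : admissible f -> admissible g ->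
  (forall z, circle z -> f z <= g z) -> S f <= S g.
Proof. by move=> af ag fg; rewrite lerD// expect_le. Qed.

Let SD f g : admissible f -> admissible g -> S (fun z => f z + g z) = S f + S g.
Proof. by move=> af ag; rewrite /S !expectD// addrACA. Qed.

Let SZ c f : admissible f -> S (fun z => c * f z) = c * S f.
Proof. by move=> af; rewrite /S !expectZ// mulrDr. Qed.

(** One [g] serves both measures: the entropy inequality has an integral against arc length on one
    side and one against [mu] on the other, and both have to follow the same approximant. *)
Definition l1_approx f := admissible f /\
  forall e, 0 < e -> exists2 g, trig_approx g &
    expect P (fun z => `|f z - g z|) + expect Q (fun z => `|f z - g z|) <= e.

Let adist f g : admissible f -> admissible g -> admissible (fun z => `|f z - g z|).
Proof. by move=> af ag; exact/admissible_norm/admissibleB. Qed.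

Lemma l1_approx_trig f : trig_approx f -> l1_approx f.
Proof.
move=> Vf; split; first by case: Vf.
move=> e e0; exists f => //.
rewrite -[X in X <= _]/(S _).
have -> : (fun z => `|f z - f z|) = (fun=> 0).
  by apply/funext => z; rewrite subrr normr0.
by rewrite /S !expect_cst// addr0 ltW.
Qed.

Lemma l1_approx_closed f : admissible f ->
  (forall e, 0 < e -> exists2 g, l1_approx g &
    expect P (fun z => `|f z - g z|) + expect Q (fun z => `|f z - g z|) <= e) ->
  l1_approx f.
Proof.
move=> af fg; split=> // e e0; have e2 : 0 < e / 2 by rewrite divr_gt0.
have [g [ag hg] fge] := fg _ e2; have [h Vh ghe] := hg _ e2.
have [ah _] := Vh; exists h => //.
rewrite [leRHS](splitr e) (le_trans _ (lerD fge ghe))//.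
rewrite -[leLHS]/(S _) -[leRHS]/(S _ + S _) -SD; try exact: adist.
apply: S_le; [exact: adist|apply: admissibleD; exact: adist|].
by move=> z _; rewrite -{1}[f z](subrK (g z)) -addrA ler_normD.
Qed.

Lemma l1_approx_lipschitz2 (F : R -> R -> R) f g :
  (forall x y x' y', `|F x y - F x' y'| <= `|x - x'| + `|y - y'|) ->
  (forall u v, admissible u -> admissible v -> admissible (fun z => F (u z) (v z))) ->
  (forall u v, trig_approx u -> trig_approx v -> trig_approx (fun z => F (u z) (v z))) ->
  l1_approx f -> l1_approx g -> l1_approx (fun z => F (f z) (g z)).
Proof.
move=> Flip aF VF [af hf] [ag hg]; split; first exact: aF.
move=> e e0; have e2 : 0 < e / 2 by rewrite divr_gt0.
have [u Vu fu] := hf _ e2; have [v Vv gv] := hg _ e2.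
have [au _] := Vu; have [av _] := Vv.
exists (fun z => F (u z) (v z)); first exact: VF.
rewrite [leRHS](splitr e) (le_trans _ (lerD fu gv))//.
rewrite -[leLHS]/(S _) -[leRHS]/(S _ + S _) -SD; try exact: adist.
apply: S_le; [|apply: admissibleD; exact: adist|by move=> z _; exact: Flip].
by apply: adist; exact: aF.
Qed.

Lemma l1_approxD f g : l1_approx f -> l1_approx g -> l1_approx (fun z => f z + g z).
Proof.
apply: (l1_approx_lipschitz2 (F := fun x y => x + y)).
- by move=> x y x' y'; rewrite opprD addrACA ler_normD.
- exact: admissibleD.
- exact: trig_approxD.
Qed.

Lemma l1_approxB f g : l1_approx f -> l1_approx g -> l1_approx (fun z => f z - g z).
Proof.
apply: (l1_approx_lipschitz2 (F := fun x y => x - y)).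
- move=> x y x' y'; have -> : x - y - (x' - y') = (x - x') - (y - y') by ring.
  exact: ler_normB.
- exact: admissibleB.
- exact: trig_approxB.
Qed.

Lemma admissible_max f g : admissible f -> admissible g ->
  admissible (fun z => Num.max (f z) (g z)).
Proof.
move=> af ag.
have := admissibleZ 2^-1 (admissibleD (admissibleD af ag) (adist af ag)).
congr admissible; apply/funext => z; case: (lerP (f z) (g z)) => h; by field.
Qed.

Lemma l1_approx_max f g : l1_approx f -> l1_approx g ->
  l1_approx (fun z => Num.max (f z) (g z)).
Proof.
apply: (l1_approx_lipschitz2 (F := fun x y => Num.max x y)).
- move=> x y x' y'; have h1 := ler_norm (x - x'); have h2 := ler_norm (y - y').
  have h3 := ler_norm (- (x - x')); have h4 := ler_norm (- (y - y')).
  rewrite !normrN in h3 h4.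
  by rewrite ler_norml; apply/andP; split; case: (lerP x y) => ?; case: (lerP x' y') => ?; lra.
- exact: admissible_max.
- exact: trig_approx_max.
Qed.

Lemma l1_approxZ c f : l1_approx f -> l1_approx (fun z => c * f z).
Proof.
move=> [af hf]; split; first exact: admissibleZ.
move=> e e0; have c0 : 0 < `|c| + 1 by rewrite ltr_wpDl.
have [g Vg fg] := hf _ (divr_gt0 e0 c0); have [ag _] := Vg.
exists (fun z => c * g z); first exact: trig_approxZ.
apply: le_trans (_ : S (fun z => `|c| * `|f z - g z|) <= e).
  apply: S_le; [by apply: adist; exact: admissibleZ|
                by apply: admissibleZ; exact: adist|].
  by move=> z _; rewrite -mulrBr normrM.
rewrite SZ; last exact: adist.
rewrite (le_trans (ler_wpM2l _ fg))//.
by rewrite mulrA ler_pdivrMr// mulrDr mulr1 [e * _]mulrC lerDl ltW.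
Qed.

Lemma l1_approx_sum (I : Type) (s : seq I) (F : I -> borelC R -> R) :
  (forall i, l1_approx (F i)) -> l1_approx (fun z => \sum_(i <- s) F i z).
Proof.
move=> aF; elim: s => [|i s IH].
  under eq_fun do rewrite big_nil.
  by apply: l1_approx_trig; exact: trig_approx_cst.
by under eq_fun do rewrite big_cons; exact: l1_approxD.
Qed.

Lemma l1_approx_limit (F : nat -> borelC R -> R) f M :
  (forall n, l1_approx (F n)) -> admissible f ->
  (forall n z, circle z -> `|f z - F n z| <= M) ->
  (forall z, circle z -> exists N, forall n, (N <= n)%N -> F n z = f z) ->
  l1_approx f.
Proof.
move=> LF af FM Ff; apply: l1_approx_closed => // e e0.
have e2 : 0 < e / 2 by rewrite divr_gt0.
have aG n : admissible (fun z => `|f z - F n z|) by apply: adist => //; case: (LF n).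
have GM n z : circle z -> `| `|f z - F n z| | <= M by move=> ?; rewrite normr_id FM.
have G0 z : circle z -> exists N, forall n, (N <= n)%N -> `|f z - F n z| = 0.
  by move=> /Ff[N hN]; exists N => n /hN ->; rewrite subrr normr0.
have [N1 h1] := expect_eventually0 P_circle aG GM G0 e2.
have [N2 h2] := expect_eventually0 Q_circle aG GM G0 e2.
exists (F (N1 + N2)%N) => //; rewrite [leRHS](splitr e) lerD//.
  by rewrite (le_trans (ler_norm _))// h1// leq_addr.
by rewrite (le_trans (ler_norm _))// h2// leq_addl.
Qed.

Lemma admissible_indic A : measurable A -> admissible (\1_A : borelC R -> R).
Proof.
move=> mA; split; first exact: measurable_indic.
by exists 1 => z _; rewrite indicE ger0_norm// lern1 leq_b1.
Qed.

(** The functions [min 1 (n max(0, f))] are 1 from some [n] on where [f > 0], and vanish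
    elsewhere. *)
Lemma l1_approx_gt0 f : trig_approx f -> l1_approx (\1_[set z | 0 < f z]).
Proof.
move=> Vf; have [[mf _] _] := Vf.
have mA : measurable ([set z | 0 < f z] : set (borelC R)).
  rewrite (_ : [set z | 0 < f z] = setT `&` f @^-1` `]0, +oo[%classic).
    by apply: mf => //; exact: measurable_itv.
  by apply/seteqP; split => z /=; rewrite in_itv /= andbT => // -[].
apply: (l1_approx_limit (M := 1)
  (F := fun n z => Num.min 1 (n%:R * Num.max 0 (f z)))).
- move=> n; apply: l1_approx_trig; apply: trig_approx_min; first exact: trig_approx_cst.
  by apply: trig_approxZ; apply: trig_approx_max => //; exact: trig_approx_cst.
- exact: admissible_indic.
- move=> n z _; rewrite indicE.
  have : 0 <= Num.min 1 (n%:R * Num.max 0 (f z)) :> R.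
    by rewrite le_min ler01 mulr_ge0// le_max lexx.
  have : Num.min 1 (n%:R * Num.max 0 (f z)) <= 1 :> R by rewrite ge_min lexx.
  by rewrite ler_norml; case: (_ \in _) => /=; move: (Num.min _ _) => x; lra.
- move=> z _; rewrite indicE; have [f0|f0] := ltP 0 (f z).
    exists (Num.truncn (f z)^-1).+1 => n Nn; rewrite mem_set//=.
    apply/min_idPl; rewrite -ler_pdivrMr// div1r.
    by rewrite (le_trans (ltW (truncnS_gt _)))// ler_nat.
  exists 0%N => n _; rewrite memNset /=; last by apply/negP; rewrite -leNgt.
  by rewrite mulr0; apply/min_idPr.
Qed.

Let approximable A := measurable A /\ l1_approx (\1_A).

(** A countable union is the limit of finite maxima of indicators, constant at each point from some
    rank on; stability under maxima thus gives unions directly, without a pi-lambda argument. *)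
Let approximable_sigma_algebra : sigma_algebra setT approximable.
Proof.
have ind_cases A (z : borelC R) : \1_A z = 0 :> R \/ \1_A z = 1 :> R.
  by rewrite indicE; case: (_ \in _); [right|left].
split.
- split; first exact: measurable0.
  have -> : \1_(set0 : set (borelC R)) = (fun=> 0 : R).
    by apply/funext => z; rewrite indicE in_set0.
  by apply: l1_approx_trig; exact: trig_approx_cst.
- move=> A [mA LA]; split; first by rewrite setTD; exact: measurableC.
  have -> : \1_(setT `\` A) = (fun z => 1 - \1_A z : R).
    apply/funext => z; rewrite setTD !indicE in_setC.
    by case: (_ \in _); rewrite /= ?subrr ?subr0.
  by apply: l1_approxB => //; apply: l1_approx_trig; exact: trig_approx_cst.
- move=> A hA.
  have mU : measurable (\bigcup_k A k).
    by apply: bigcupT_measurable => k; case: (hA k).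
  split => //.
  pose F := fix F n : borelC R -> R :=
    if n is k.+1 then (fun z => Num.max (F k z) (\1_(A k) z)) else (fun=> 0).
  have LF n : l1_approx (F n).
    elim: n => [|n IH] /=; first by apply: l1_approx_trig; exact: trig_approx_cst.
    by apply: l1_approx_max => //; case: (hA n).
  have F01 n z : 0 <= F n z <= 1.
    elim: n => [|n IH] /=; first by rewrite lexx ler01.
    have /andP[i1 i2] := IH.
    by case: (ind_cases (A n) z) => ->; rewrite le_max i1 ge_max i2 ?ler01 ?lexx ?orbT.
  apply: (l1_approx_limit (M := 1) LF) => //.
  + exact: admissible_indic.
  + move=> n z _; have /andP[h1 h2] := F01 n z.
    by rewrite ler_norml; case: (ind_cases (\bigcup_k A k) z) => ->; lra.
  + move=> z _; have [[k _ Akz]|nA] := pselect ((\bigcup_k A k) z).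
      exists k.+1 => n kn; rewrite indicE mem_set; last by exists k.
      elim: n kn => // n IH; rewrite ltnS leq_eqVlt => /predU1P[<-|kn] /=.
        rewrite indicE mem_set//=; apply/max_idPr.
        by have /andP[] := F01 k z.
      rewrite IH//; apply/max_idPl.
      by case: (ind_cases (A n) z) => ->; rewrite ?ler01.
    exists 0%N => n _; rewrite indicE memNset//=.
    elim: n => //= n ->; rewrite indicE memNset ?maxxx// => Anz.
    by apply: nA; exists n.
Qed.

(** Discs with rational centre and rational squared radius [q.2], written as positivity sets of
    functions in [trig_approx]; they are countably many and form a base of the topology. *)
Let disc (q : rat * rat * rat) : set (borelC R) :=
  [set z | 0 < ratr q.2 - normsq (z - (ratr q.1.1 +i* ratr q.1.2)%C)].

Let approximable_disc q : approximable (disc q).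
Proof.
pose f (z : borelC R) : R := ratr q.2 - normsq (z - (ratr q.1.1 +i* ratr q.1.2)%C).
have Vf : trig_approx f.
  have VRe : trig_approx (@complex.Re R).
    have := trig_approx_Re ('X : {poly R[i]}); congr trig_approx.
    by apply/funext => z; rewrite hornerX.
  have VIm : trig_approx (@complex.Im R).
    have := trig_approx_Re (- 'i%C *: 'X : {poly R[i]}); congr trig_approx.
    by apply/funext => z; rewrite hornerZ hornerX ReM /= ?oppr0; ring.
  rewrite /f /normsq; apply: trig_approxB; first exact: trig_approx_cst.
  under eq_fun do rewrite ReD ImD ReN ImN /= !expr2.
  by apply: trig_approxD; apply: trig_approxM; apply: trig_approxB => //;
    exact: trig_approx_cst.
split; last exact: (l1_approx_gt0 Vf).
have [[mf _] _] := Vf.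
rewrite (_ : disc q = setT `&` f @^-1` `]0, +oo[%classic).
  by apply: mf => //; exact: measurable_itv.
by apply/seteqP; split => z /=; rewrite in_itv /= andbT => // -[].
Qed.

Let open_disc (U : set R[i]) z : open U -> U z ->
  exists q, disc q z /\ disc q `<=` U.
Proof.
move=> oU Uz; have := open_nbhs_nbhs (conj oU Uz) => -[[e e'] /=].
rewrite ltcE /= => /andP[/eqP -> e0 eU].
have nball w : ComplexField.Normc.normc (w - z) < e -> U w.
  by move=> h; apply: eU; rewrite /ball_ /= -normrN opprB -normcE ltcR.
(* A radius below [e / 4] puts the whole disc within [e / 2] of [z]. The centre is within [r], half
   the radius, of [z] in each coordinate, so [z] is at squared distance at most [2 r^2], half of the
   squared radius. *)
have d0 : 0 < (e / 4) ^+ 2 by rewrite exprn_gt0// divr_gt0.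
have [s] := rat_in_itvoo d0; rewrite in_itv /= => /andP[s0 se].
have r0 : 0 < Num.sqrt (ratr s) / 2 :> R by rewrite divr_gt0// sqrtr_gt0.
set r := Num.sqrt (ratr s) / 2 in r0.
have r2 : r ^+ 2 * 4 = ratr s by rewrite /r expr_div_n sqr_sqrtr ?ltW//; field.
have [a] := @rat_in_itvoo R (complex.Re z) (complex.Re z + r) ltac:(lra).
have [b] := @rat_in_itvoo R (complex.Im z) (complex.Im z + r) ltac:(lra).
rewrite !in_itv /= => /andP[b1 b2] /andP[a1 a2].
have zc : normsq (z - (ratr a +i* ratr b)%C) < ratr s.
  rewrite /normsq ReD ImD ReN ImN /= -r2.
  have sq (x y : R) : x < y -> y < x + r -> (x - y) ^+ 2 <= r ^+ 2.
    move=> xy yx; rewrite -subr_ge0 subr_sqr mulr_ge0//; lra.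
  have := sq _ _ a1 a2; have := sq _ _ b1 b2; have : 0 < r ^+ 2 by rewrite exprn_gt0.
  lra.
have near_c w : normsq (w - (ratr a +i* ratr b)%C) < ratr s ->
    ComplexField.Normc.normc (w - (ratr a +i* ratr b)%C) < e / 4.
  rewrite normsq_normc => h; rewrite -(@ltr_pXn2r _ 2) ?nnegrE ?normc_ge0//.
    exact: lt_trans h se.
  by rewrite divr_ge0// ltW.
exists (a, b, s); split; first by rewrite /disc /= subr_gt0.
move=> w; rewrite /disc /= subr_gt0 => wc; apply: nball.
rewrite -[w](subrK (ratr a +i* ratr b)%C) -addrA (le_lt_trans (ncD _ _))//.
have := near_c w wc; have := near_c z zc; rewrite -[X in X < _ -> _]ncN opprB.
by move=> h1 h2; lra.
Qed.

Lemma l1_approx_indic A : measurable A -> l1_approx (\1_A).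
Proof.
suff : measurable `<=` approximable by move=> h /h[].
apply: smallest_sub; first exact: approximable_sigma_algebra.
move=> U oU; have [A0 _ AU] := approximable_sigma_algebra.
pose F n := if unpickle n is Some q then
  (if `[< disc q `<=` U >] then disc q else set0) else set0.
have -> : U = \bigcup_n F n.
  apply/seteqP; split => [z Uz|z [n _]].
    have [q [qz qU]] := open_disc oU Uz.
    exists (pickle q); first exact: I.
    by rewrite /F pickleK; case: asboolP.
  by rewrite /F; case: unpickle => // q; case: asboolP => // h /h.
apply: AU => n; rewrite /F; case: unpickle => // q.
by case: asboolP => // _; exact: approximable_disc.
Qed.

Let staircase (n : nat) (x : R) : 0 <= x <= n%:R ->
  `|x - \sum_(k < n) (k.+1%:R <= x)%R%:R| <= 1.
Proof.
elim: n => [|n IH] /andP[x0 xn].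
  have -> : x = 0 by apply/le_anti; rewrite x0 xn.
  by rewrite big_ord0 subr0 normr0.
rewrite big_ord_recr /=; have [xn'|nx] := leP x n%:R.
  have [h|_] := leP n.+1%:R x; last by rewrite addr0 IH// x0.
  by move: (le_trans h xn'); rewrite ler_nat ltnn.
rewrite (eq_bigr (fun=> 1)); last first.
  by move=> k _; rewrite (le_trans _ (ltW nx))// ler_nat.
rewrite sumr_const card_ord; move: xn; rewrite -natr1 => xn.
by case: (_ <= x) => /=; rewrite ler_norml; apply/andP; split; lra.
Qed.

(** A function with values in [[0, 1]] is within [1 / n] of a staircase built on its level sets, at
    total cost [2 / n] since both measures have mass 1; an affine change of scale handles any
    bounded function. *)
Lemma admissible_l1_approx f : admissible f -> l1_approx f.
Proof.
have unit_case g : admissible g -> (forall z, circle z -> 0 <= g z <= 1) -> l1_approx g.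
  move=> ag g01; apply: l1_approx_closed => // e e0.
  pose n := (Num.truncn (2 / e)).+1; have n0 : 0 < n%:R :> R by rewrite ltr0n.
  pose A k : set (borelC R) := [set z | k.+1%:R <= n%:R * g z].
  have mA k : measurable (A k).
    have [mg _] := ag.
    rewrite (_ : A k = setT `&` (fun z => n%:R * g z) @^-1` `[k.+1%:R, +oo[%classic).
      apply: measurable_funM => //; exact: measurable_itv.
    by apply/seteqP; split => z /=; rewrite in_itv /= andbT => // -[].
  pose h (z : borelC R) := n%:R^-1 * \sum_(k < n) \1_(A k) z : R.
  have Lh : l1_approx h.
    apply: l1_approxZ; apply: l1_approx_sum => k; exact: l1_approx_indic.
  exists h => //; have [ah _] := Lh.
  have gh z : circle z -> `|g z - h z| <= n%:R^-1.
    move=> cz; have /andP[g0 g1] := g01 z cz.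
    have -> : g z - h z = n%:R^-1 * (n%:R * g z - \sum_(k < n) (k.+1%:R <= n%:R * g z)%R%:R).
      rewrite mulrBr mulKf ?gt_eqF//; congr (_ - _ * _).
      apply: eq_bigr => k _; rewrite indicE; congr (nat_of_bool _)%:R.
      by apply/idP/idP => [/set_mem|H] //; apply/mem_set.
    rewrite normrM gtr0_norm ?invr_gt0//; apply: ler_piMr.
      by rewrite invr_ge0 ltW.
    apply: staircase; apply/andP; split; first by apply: mulr_ge0 => //; exact: ltW.
    by apply: ler_piMr => //; exact: ltW.
  apply: le_trans (_ : S (fun=> n%:R^-1) <= e).
    by apply: S_le => //; [exact: adist|exact: admissible_cst].
  rewrite /S !expect_cst//.
  have h2 : 2 / e <= n%:R by exact/ltW/truncnS_gt.
  rewrite ler_pdivrMr// in h2.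
  have -> : n%:R^-1 + n%:R^-1 = n%:R^-1 * 2 :> R by ring.
  by rewrite ler_pdivrMl// mulrC.
move=> af; have [_ [M' fM']] := af; pose M := `|M'| + 1.
have M0 : 0 < M by rewrite ltr_wpDl.
have fM z : circle z -> `|f z| <= M.
  by move=> /fM' /le_trans -> //; rewrite (le_trans (ler_norm _))// lerDl.
have Lu : l1_approx (fun z => (2 * M)^-1 * (f z + M)).
  apply: unit_case.
    by apply: admissibleZ; apply: admissibleD => //; exact: admissible_cst.
  move=> z /fM; rewrite ler_norml => /andP[h1 h2].
  have M2 : 0 < 2 * M by rewrite mulr_gt0.
  apply/andP; split; last by rewrite ler_pdivrMl//; lra.
  by apply: mulr_ge0; [rewrite invr_ge0 ltW|lra].
have := l1_approxD (l1_approxZ (2 * M) Lu) (l1_approx_trig (trig_approx_cst (- M))).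
congr l1_approx; apply/funext => z; rewrite mulVKf ?addrK//.
by rewrite gt_eqF// mulr_gt0.
Qed.
End L1Density.

(** * The entropy inequality *)

Section EntropyInequality.
Variables (R : realType) (mu : probability (borelC R) R) (alpha : nat -> R[i]).
Hypotheses (mu_circle : on_unit_circle mu) (mu_alpha : verblunsky mu alpha).
Local Notation circle := (@unit_circle R).
Local Notation m := (@circle_measure R).
Local Notation mC := (@circle_measure_circle R).
Local Notation Re := (@complex.Re R).
Local Notation q := (@weight R).
Let a1 := alpha_lt1 mu_alpha.
Implicit Types (f g : borelC R -> R).

Lemma szego_density_moment N (p : {poly R[i]}) : (size p <= N.+1)%N ->
  expect m (fun z => szego_density alpha N z * Re p.[z]) =
  expect mu (fun z => Re p.[z]).
Proof.
move=> sp; have := szego_moments a1 mu_circle (cexpect_szego mu_circle mu_alpha) sp.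
move=> /(congr1 Re) /= ->; apply: expect_eq => z _ /=; by rewrite Re_realM.
Qed.

Lemma expect_szego_density N : expect m (szego_density alpha N) = 1.
Proof.
have s1 : (size (1%R : {poly R[i]}) <= N.+1)%N by rewrite size_poly1.
rewrite -[RHS](expect_cst mu_circle).
transitivity (expect mu (fun z => Re (1 : {poly R[i]}).[z])); last first.
  by apply: expect_eq => z _; rewrite -polyC1 hornerC.
rewrite -(szego_density_moment s1); apply: expect_eq => z _.
by rewrite -polyC1 hornerC mulr1.
Qed.

Lemma admissible_ln_szego_density N : admissible (fun z => ln (szego_density alpha N z)).
Proof.
have [al _] := expect_weight_ln (coef0_szego_dual alpha N)
  (fun z z1 => (szego_dual_neq0 a1 N z1).1).
have [_ [M hM]] := admissibleB (admissible_cst (ln (szego_const alpha N))) al.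
split.
  apply: measurableT_comp (@measurable_ln R) _.
  by case: (admissible_szego_density a1 N).
exists M => z cz; have := hM z cz; rewrite /szego_density.
rewrite ln_div ?posrE ?szego_const_gt0//.
rewrite normsq_gt0; have /nc_circle z1 := cz.
by case: (@szego_dual_neq0 _ _ a1 N z); rewrite ?z1.
Qed.

Definition entropy N := expect m (fun z => q z * ln (szego_density alpha N z)).

Variable K : R.
Hypothesis entropy_ge : forall N, - K <= entropy N.

Lemma trig_approx_weight : trig_approx q.
Proof.
have VRe : trig_approx Re.
  have := trig_approx_Re ('X : {poly R[i]}); congr trig_approx.
  by apply/funext => z; rewrite hornerX.
rewrite /weight; under eq_fun do rewrite expr2.
by do ! [apply: trig_approxM|apply: trig_approxB|apply: trig_approxD|
         exact: VRe|exact: trig_approx_cst].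
Qed.

(** With [d] the density of [mu_N], integrating [q ln (d f) <= q d f] leaves the mean of [q f]
    against [mu_N]. Up to [e / 2] this is the mean of a polynomial, which [mu] shares once [N]
    exceeds its degree. *)
Lemma expect_weight_ln_le_trig f c : trig_approx f -> 0 < c ->
  (forall z, circle z -> c <= f z) ->
  expect m (fun z => q z * ln (f z)) <= K + expect mu (fun z => q z * f z).
Proof.
move=> Vf c0 cf; have [af _] := Vf; have aq := @admissible_weight R.
have aqf := admissibleM aq af.
apply/ler_addgt0Pl => e e0; have e2 : 0 < e / 2 by rewrite divr_gt0.
have [_ /(_ _ e2)[p hp]] := trig_approxM trig_approx_weight Vf.
pose N := size p; pose d := szego_density alpha N.
have ad : admissible d by exact: admissible_szego_density.
have alf := admissible_ln af c0 cf; have ald := admissible_ln_szego_density N.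
have [ap _] := cadmissible_horner p.
have h1 : expect m (fun z => q z * ln (f z)) + entropy N <=
    expect m (fun z => d z * (q z * f z)).
  rewrite -expectD; [|exact: mC|exact: admissibleM..].
  apply: (expect_le mC).
  - by apply: admissibleD; exact: admissibleM.
  - exact: admissibleM.
  move=> z cz; have d0 : 0 < d z by exact: szego_density_gt0.
  have f0 := lt_le_trans c0 (cf z cz).
  rewrite -mulrDr -lnM ?posrE// [leRHS]mulrCA ler_wpM2l ?weight_ge0// [leRHS]mulrC.
  by rewrite ltW// ln_sublinear// mulr_gt0.
have h2 : expect m (fun z => d z * (q z * f z)) <=
    expect m (fun z => d z * Re p.[z] + e / 2 * d z).
  apply: (expect_le mC).
  - exact: admissibleM.
  - by apply: admissibleD; [exact: admissibleM|exact: admissibleZ].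
  move=> z cz; have d0 : 0 < d z by exact: szego_density_gt0.
  rewrite [e / 2 * _]mulrC -mulrDr ler_pM2l//.
  by have := hp z cz; rewrite ler_norml => /andP[_]; rewrite lerBlDl addrC.
have h3 : expect m (fun z => d z * Re p.[z] + e / 2 * d z) =
    expect mu (fun z => Re p.[z]) + e / 2.
  rewrite expectD; [|exact: mC|exact: admissibleM|exact: admissibleZ].
  rewrite (expectZ mC _ ad) expect_szego_density mulr1.
  by rewrite (szego_density_moment (leqnSn _)).
have h4 : expect mu (fun z => Re p.[z]) <= expect mu (fun z => q z * f z) + e / 2.
  rewrite -[e / 2 in leRHS](expect_cst mu_circle) -expectD//; last exact: admissible_cst.
  apply: expect_le => //; first by apply: admissibleD => //; exact: admissible_cst.
  move=> z cz; have := hp z cz; rewrite ler_norml => /andP[+ _].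
  by move: (q z * f z) (Re _) => x y; lra.
have := entropy_ge N; lra.
Qed.

(** This is what the lower bound 1 on the test functions provides: an [L^1] error on [g] controls
    that on [ln g]. *)
Lemma ln_lipschitz (x y : R) : 1 <= x -> 1 <= y -> ln x - ln y <= `|x - y|.
Proof.
move=> x1 y1; have x0 := lt_le_trans ltr01 x1; have y0 := lt_le_trans ltr01 y1.
have [xy|yx] := leP x y.
  by rewrite (@le_trans _ _ 0)// subr_le0 ler_ln.
rewrite -ln_div ?posrE// gtr0_norm ?subr_gt0//.
have -> : x / y = 1 + (x - y) / y by field; rewrite gt_eqF.
have d0 : 0 <= (x - y) / y by apply: divr_ge0; [rewrite subr_ge0|]; apply: ltW.
apply: le_trans (le_ln1Dx _) _; first by rewrite (lt_le_trans _ d0)// ltrN10.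
by rewrite ler_pdivrMr// ler_peMr// subr_ge0 ltW.
Qed.

(** Replacing the approximant [f] by [max 1 f] brings it no further from [g]; each side then moves
    by at most 8, the bound of the weight, times the [L^1] error. *)
Lemma expect_weight_ln_le g : admissible g -> (forall z, circle z -> 1 <= g z) ->
  expect m (fun z => q z * ln (g z)) <= K + expect mu (fun z => q z * g z).
Proof.
move=> ag g1; have aq := @admissible_weight R.
apply/ler_addgt0Pl => e e0; have e8 : 0 < e / 8 by rewrite divr_gt0.
have [_ /(_ _ e8)[f Vf fg]] := admissible_l1_approx mC mu_circle ag.
pose f' z := Num.max 1 (f z).
have Vf' : trig_approx f' by apply: trig_approx_max => //; exact: trig_approx_cst.
have f'1 z : 1 <= f' z by rewrite le_max lexx.
have [af _] := Vf; have [af' _] := Vf'.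
have fg' z : circle z -> `|g z - f' z| <= `|g z - f z|.
  move=> /g1; rewrite /f'; case: (leP 1 (f z)) => // h gz.
  rewrite ger0_norm ?subr_ge0// (le_trans _ (ler_norm _))//; lra.
have adf : admissible (fun z => `|g z - f z|) by exact/admissible_norm/admissibleB.
have := expect_weight_ln_le_trig Vf' ltr01 (fun z _ => f'1 z).
have alg := admissible_ln ag ltr01 g1.
have alf := admissible_ln af' ltr01 (fun z _ => f'1 z).
have h1 : expect m (fun z => q z * ln (g z)) <=
    expect m (fun z => q z * ln (f' z)) + 8 * expect m (fun z => `|g z - f z|).
  rewrite -(expectZ mC _ adf) -expectD; [|exact: mC|exact: admissibleM|exact: admissibleZ].
  apply: (expect_le mC); first exact: admissibleM.
    by apply: admissibleD; [exact: admissibleM|exact: admissibleZ].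
  move=> z cz; rewrite addrC -lerBlDr -mulrBr.
  apply: le_trans (_ : q z * `|g z - f z| <= _).
    rewrite ler_wpM2l ?weight_ge0//.
    exact: le_trans (ln_lipschitz (g1 z cz) (f'1 z)) (fg' z cz).
  by rewrite ler_wpM2r// weight_le8.
have h2 : expect mu (fun z => q z * f' z) <=
    expect mu (fun z => q z * g z) + 8 * expect mu (fun z => `|g z - f z|).
  rewrite -(expectZ mu_circle _ adf) -expectD//; [|exact: admissibleM|exact: admissibleZ].
  apply: (expect_le mu_circle); first exact: admissibleM.
    by apply: admissibleD; [exact: admissibleM|exact: admissibleZ].
  move=> z cz; rewrite addrC -lerBlDr -mulrBr.
  apply: le_trans (_ : q z * `|g z - f z| <= _).
    rewrite ler_wpM2l ?weight_ge0// (le_trans _ (fg' z cz))//.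
    by rewrite -normrN opprB ler_norm.
  by rewrite ler_wpM2r// weight_le8.
move: h1 h2 fg; rewrite ler_pdivlMr//; lra.
Qed.
End EntropyInequality.

(** * Absolutely continuous and singular parts *)

Section IntegralDensity.
Context d (T : measurableType d) (R : realType).
Variables (mu nu m : {measure set T -> \bar R}) (W : T -> R).
Hypotheses (mW : measurable_fun setT W) (W0 : forall x, 0 <= W x).
Local Open Scope ereal_scope.
Hypothesis mu_density : forall A, measurable A ->
  mu A = \int[m]_(x in A) (W x)%:E + nu A.

Import HBNNSimple.

Let nnsfun_density (h : {nnsfun T >-> R}) :
  \int[mu]_x (h x)%:E = \int[m]_x ((h x)%:E * (W x)%:E) + \int[nu]_x (h x)%:E.
Proof.
have mp y : measurable (h @^-1` [set y]) by exact: measurable_sfunP.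
rewrite !integralT_nnsfun !sintegralE.
have -> : \int[m]_x ((h x)%:E * (W x)%:E) =
    \sum_(y \in range h) y%:E * \int[m]_(x in h @^-1` [set y]) (W x)%:E.
  transitivity (\int[m]_x (\sum_(y \in range h)
      y%:E * ((\1_(h @^-1` [set y]) x)%:E * (W x)%:E))).
    apply: eq_integral => x _; rewrite {1}(fimfunE h x) -fsumEFin//.
    rewrite ge0_mule_fsuml; last by move=> y; exact: nnfun_muleindic_ge0.
    by apply: eq_fsbigr => y _; rewrite EFinM muleA.
  have mi y : measurable_fun setT (fun x => (\1_(h @^-1` [set y]) x)%:E * (W x)%:E).
    apply: emeasurable_funM; exact/measurable_EFinP.
  have i0 y x : 0 <= (\1_(h @^-1` [set y]) x)%:E * (W x)%:E.
    by rewrite mule_ge0 ?lee_fin.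
  have yi0 y x : 0 <= y%:E * ((\1_(h @^-1` [set y]) x)%:E * (W x)%:E).
    rewrite muleA; apply: mule_ge0; last by rewrite lee_fin.
    by rewrite -EFinM nnfun_muleindic_ge0.
  rewrite ge0_integral_fsum//; last by move=> y; exact: measurable_funeM.
  apply: eq_fsbigr => y /set_mem[x0 _ hx0].
  have y0 : (0 <= y)%R by rewrite -hx0; exact: fun_ge0.
  rewrite ge0_integralZl//.
  congr (_ * _); rewrite [RHS]integral_mkcond.
  apply: eq_integral => x _; rewrite patchE indicE.
  by case: (_ \in _); rewrite ?mul1e ?mul0e.
rewrite -fsbig_split//=; apply: eq_fsbigr => y /set_mem[x0 _ hx0].
have y0 : (0 <= y)%R by rewrite -hx0; exact: fun_ge0.
rewrite mu_density// ge0_muleDr//; by apply: integral_ge0 => x _; rewrite lee_fin.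
Qed.

(** Indicators are the hypothesis on [mu]; simple functions follow by additivity, the rest by
    monotone convergence in the three integrals. *)
Lemma integral_density (f : T -> \bar R) :
  measurable_fun setT f -> (forall x, 0 <= f x) ->
  \int[mu]_x f x = \int[m]_x (f x * (W x)%:E) + \int[nu]_x f x.
Proof.
move=> mf f0; pose h := nnsfun_approx measurableT mf.
have hf x : (h n x)%:E @[n --> \oo] --> f x by exact: cvg_nnsfun_approx.
have nd x a b : (a <= b)%N -> (h a x)%:E <= (h b x)%:E.
  by move=> ab; rewrite lee_fin; exact/lefP/nd_nnsfun_approx.
have mh n : measurable_fun setT (fun x => (h n x)%:E).
  exact/measurable_EFinP.
have mono (P : {measure set T -> \bar R}) :
    \int[P]_x (h n x)%:E @[n --> \oo] --> \int[P]_x f x.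
  have -> : \int[P]_x f x = \int[P]_x limn (fun n => (h n x)%:E).
    by apply: eq_integral => x _; apply/esym/cvg_lim => //; exact: hf.
  apply: cvg_monotone_convergence => //.
  - by move=> n x _; rewrite lee_fin.
  - by move=> x _ a b; exact: nd.
have monoW : \int[m]_x ((h n x)%:E * (W x)%:E) @[n --> \oo] -->
    \int[m]_x (f x * (W x)%:E).
  have -> : \int[m]_x (f x * (W x)%:E) =
      \int[m]_x limn (fun n => (h n x)%:E * (W x)%:E).
    by apply: eq_integral => x _; apply/esym/cvg_lim => //; apply: cvgeZr.
  apply: cvg_monotone_convergence => //.
  - by move=> n; apply: emeasurable_funM => //; exact/measurable_EFinP.
  - by move=> n x _; rewrite mule_ge0// lee_fin.
  - by move=> x _ a b ab; rewrite lee_wpmul2r ?nd// lee_fin.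
have e : (fun n => \int[mu]_x (h n x)%:E) =
    (fun n => \int[m]_x ((h n x)%:E * (W x)%:E) + \int[nu]_x (h n x)%:E).
  by apply/funext => n; exact: nnsfun_density.
have := mono mu; rewrite e => lim1.
apply: (cvg_unique _ lim1) => //.
apply: (cvgeD _ monoW (mono nu)).
apply: ge0_adde_def; rewrite inE; apply: integral_ge0 => x _ //.
by rewrite mule_ge0// lee_fin.
Qed.
End IntegralDensity.

Section Argument.
Variable R : realType.

(* The half-angle formula; junk value [pi] at [z = 1]. *)
Definition argument (z : borelC R) : R :=
  pi + 2 * atan (- complex.Im z / (1 - complex.Re z)).

Lemma argument_expi (t : R) : 0 < t < 2 * pi -> argument (expi t) = t.
Proof.
move=> /andP[t0 t2]; pose s := (t - pi) / 2.
have tE : t = s *+ 2 + pi by rewrite /s -mulr_natr divfK// subrK.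
have s_bnd : -(pi / 2) < s < pi / 2 by rewrite /s; apply/andP; split; lra.
have c0 : cos s != 0 by rewrite gt_eqF// cos_gt0_pihalf.
rewrite /argument /expi /=.
(* For [t = 2 s + pi], [- sin t = 2 sin s cos s] and [1 - cos t = 2 cos^2 s]; moreover [s] lies
   where [atan] inverts [tan]. *)
have -> : - sin t / (1 - cos t) = tan s.
  rewrite tE sinDpi cosDpi sin_mulr2n cos_mulr2n /tan opprK.
  have -> : 1 - - (cos s ^+ 2 *+ 2 - 1) = 2 * cos s ^+ 2 by ring.
  by field; rewrite c0.
by rewrite tanK ?in_itv// /s; field.
Qed.

Lemma measurable_argument : measurable_fun setT argument.
Proof.
apply: measurable_funD; first exact: measurable_cst.
apply: measurable_funM; first exact: measurable_cst.
apply: measurableT_comp.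
  by apply: continuous_measurable_fun => x; exact: continuous_atan.
apply: measurable_funM; first by apply: measurable_funN; exact: measurable_Im.
apply: measurable_inv; apply: measurable_funB; first exact: measurable_cst.
exact: measurable_Re.
Qed.
End Argument.

Section AbsolutelyContinuousPart.
Variables (R : realType) (mu : probability (borelC R) R) (w : R -> R).
Hypotheses (mu_circle : on_unit_circle mu) (mu_w : ac_density mu w).
Local Notation circle := (@unit_circle R).
Local Notation m := (@circle_measure R).
Local Notation mC := (@circle_measure_circle R).

(** Agreement on the open interval is what can be had, [argument] having a junk value at angle 0,
    which is a null set. *)
Lemma integral_circle_angles (f : borelC R -> \bar R) (g : R -> \bar R) :
  measurable_fun setT f -> (forall z, 0 <= f z)%E ->
  measurable_fun `[0, 2 * pi[%classic g ->
  (forall t, 0 < t < 2 * pi -> f (expi t) = g t) ->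
  (\int[m]_z f z =
   (2 * pi)^-1%:E * \int[lebesgue_measure]_(t in `[0%R, (2 * pi)%R[) g t)%E.
Proof.
move=> mf f0 mg fg; rewrite ge0_integral_circle_measure//; congr (_ * _)%E.
rewrite -integral_itv_obnd_cbnd; last first.
  by apply: measurable_funTS; apply: measurableT_comp mf _; exact: measurable_expi.
rewrite -[RHS]integral_itv_obnd_cbnd; last first.
  apply: measurable_funS mg => //; exact: subset_itv_oo_co.
by apply: eq_integral => t /set_mem /=; rewrite in_itv /= => /fg.
Qed.

(** [w] transported to the space carrying [mu]; cutting it off outside [[0, 2 pi[] makes it
    measurable and nonnegative everywhere. *)
Definition circle_density (z : borelC R) : R :=
  (w \_ `[0, 2 * pi[%classic) (argument z).

Lemma circle_density_expi (t : R) : 0 < t < 2 * pi -> circle_density (expi t) = w t.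
Proof.
move=> t02; rewrite /circle_density argument_expi// patchE mem_set//=.
by rewrite in_itv /=; case/andP: t02 => /ltW -> ->.
Qed.

Lemma circle_density_ge0 z : 0 <= circle_density z.
Proof.
rewrite /circle_density patchE; case: ifPn => // /set_mem /= h.
by case: mu_w => _ w0 _; apply: w0.
Qed.

Lemma measurable_circle_density : measurable_fun setT circle_density.
Proof.
case: mu_w => mw _ _; apply: measurableT_comp; last exact: measurable_argument.
by apply/(measurable_restrictT _ _).1.
Qed.

(** Restates the decomposition against [circle_measure], which absorbs the factor [2 pi], and keeps
    the null set [N] carrying [mu_s] explicit, because the test functions are modified on it. *)
Lemma singular_part : exists (mu_s : {measure set (borelC R) -> \bar R})
    (N : set (borelC R)),
  [/\ measurable N, m N = 0%E, mu_s (~` N) = 0%E &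
    forall A, measurable A ->
      mu A = (\int[m]_(z in A) (circle_density z)%:E + mu_s A)%E].
Proof.
have [mw w0 [mu_s [[N [mN N0 Ns]] muE]]] := mu_w.
have ind_angles (A : set (borelC R)) (g : R -> \bar R) :
    (\int[lebesgue_measure]_(t in angles A) g t =
     \int[lebesgue_measure]_(t in `[0%R, (2 * pi)%R[) (g \_ (@expi R @^-1` A)) t)%E.
  by rewrite /angles integral_mkcondr.
have mpre (A : set (borelC R)) : measurable A -> measurable (@expi R @^-1` A).
  by move=> mA; rewrite -[_ @^-1` _]setTI; apply: measurable_expi.
have mind (A : set (borelC R)) : measurable A ->
    measurable_fun setT (fun t : R => (\1_A (expi t) : R)).
  move=> mA; have mi : measurable_fun setT (\1_A : borelC R -> R).
    exact: measurable_indic.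
  exact: (measurableT_comp mi (@measurable_expi R)).
exists mu_s, N; split => //.
- transitivity (\int[m]_z (\1_N z)%:E)%E; first by rewrite integral_indic// setIT.
  rewrite (@integral_circle_angles _ (fun t => (\1_N (expi t))%:E)) => //.
  + rewrite (_ : \int[_]_(t in _) _ = 0)%E ?mule0// -[RHS]N0.
    by rewrite -[RHS]/(lebesgue_measure (`[0, 2 * pi[%classic `&` _)) setIC -integral_indic//; exact: mpre.
  + by apply/measurable_EFinP; exact: measurable_indic.
  + by apply/measurable_EFinP; apply: measurable_funTS; exact: mind.
- move=> A mA; rewrite muE//; congr (_ + _)%E.
  have pi20 := pi2_gt0 R; have mcd := measurable_circle_density.
  pose g t : \bar R := ((w t)%:E * (\1_A (expi t))%:E)%E.
  have mg : measurable_fun `[0, 2 * pi[%classic g.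
    by apply: emeasurable_funM; apply/measurable_EFinP => //;
      apply: measurable_funTS; exact: mind.
  have -> : (\int[m]_(z in A) (circle_density z)%:E =
      \int[m]_z ((circle_density z)%:E * (\1_A z)%:E))%E.
    rewrite integral_mkcond; apply: eq_integral => z _; rewrite patchE indicE.
    by case: (_ \in _); rewrite ?mule1 ?mule0.
  rewrite (@integral_circle_angles _ g) => //.
  + rewrite ind_angles -ge0_integralZl//.
    * apply: eq_integral => t _; rewrite patchE /g indicE.
      rewrite (_ : (expi t \in A) = (t \in @expi R @^-1` A))//.
      by case: (_ \in _); rewrite ?mule1 ?mule0// -EFinM mulrC.
    * move=> t /w0 wt; rewrite /g mule_ge0// lee_fin//.
    * by rewrite lee_fin invr_ge0 ltW.
  + by apply: emeasurable_funM; apply/measurable_EFinP;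
      [exact: mcd|exact: measurable_indic].
  + by move=> z; rewrite mule_ge0// lee_fin ?circle_density_ge0.
  + by move=> t t02; rewrite /g circle_density_expi.
Qed.
End AbsolutelyContinuousPart.

(** * Finiteness of the log integral and lower bounds for the entropy *)

Section LogIntegral.
Variables (R : realType) (mu : probability (borelC R) R) (w : R -> R).
Hypotheses (mu_circle : on_unit_circle mu) (mu_w : ac_density mu w).
Local Notation circle := (@unit_circle R).
Local Notation m := (@circle_measure R).
Local Notation mC := (@circle_measure_circle R).
Local Notation W := (@circle_density R w).

Definition neg_lne (x : R) : \bar R :=
  if x <= 0 then +oo%E else (Num.max 0 (- ln x))%:E.

Definition neg_ln_trunc (k : nat) (x : R) : R :=
  if x <= 0 then k%:R else Num.min k%:R (Num.max 0 (- ln x)).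

Lemma neg_lneE (x : R) : (maxe (- lne x%:E) 0 = neg_lne x)%E.
Proof.
rewrite /neg_lne /lne; case: ifP => _ /=; first by apply/max_idPl; exact: leey.
by rewrite -EFin_max maxC.
Qed.

Lemma neg_lne_ge0 x : (0 <= neg_lne x)%E.
Proof.
by rewrite /neg_lne; case: ifP => // _; rewrite lee_fin le_max lexx.
Qed.

Lemma measurable_neg_lne : measurable_fun setT neg_lne.
Proof.
apply: measurable_fun_if => //.
- by apply: measurable_fun_ler; [exact: measurable_id|exact: measurable_cst].
- apply/measurable_EFinP; apply: measurable_funTS; apply: measurable_maxr.
    exact: measurable_cst.
  by apply: measurable_funN; exact: measurable_ln.
Qed.

Lemma measurable_neg_ln_trunc k : measurable_fun setT (neg_ln_trunc k).
Proof.
apply: measurable_fun_if => //.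
- by apply: measurable_fun_ler; [exact: measurable_id|exact: measurable_cst].
- apply: measurable_funTS; apply: measurable_minr; first exact: measurable_cst.
  apply: measurable_maxr; first exact: measurable_cst.
  by apply: measurable_funN; exact: measurable_ln.
Qed.

Lemma neg_ln_trunc_bound k x : 0 <= neg_ln_trunc k x <= k%:R.
Proof.
rewrite /neg_ln_trunc; case: ifP => _; first by rewrite ler0n lexx.
by rewrite le_min ler0n le_max lexx ge_min lexx.
Qed.

Lemma neg_ln_trunc_nondecreasing x a b : (a <= b)%N ->
  neg_ln_trunc a x <= neg_ln_trunc b x.
Proof.
move=> ab; rewrite /neg_ln_trunc; case: ifP => _; first by rewrite ler_nat.
by rewrite le_min !ge_min ler_nat ab lexx orbT.
Qed.

Lemma neg_ln_trunc_cvg x : (neg_ln_trunc k x)%:E @[k --> \oo] --> neg_lne x.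
Proof.
rewrite /neg_ln_trunc /neg_lne; case: ifP => _.
  by apply/cvgeryP; exact: cvgr_idn.
set y := Num.max 0 _; apply: cvg_near_cst; exists (Num.truncn y).+1 => // k /= yk.
by congr EFin; apply/min_idPr; rewrite (le_trans (ltW (truncnS_gt _)))// ler_nat.
Qed.

(** The product is at most 1 for [x <= 1] and equals [x] beyond. Hence the exponential of the
    truncation has integral at most 2 against the absolutely continuous part, whatever [k]. *)
Lemma expR_neg_ln_trunc_mul k x : 0 <= x -> expR (neg_ln_trunc k x) * x <= 1 + x.
Proof.
rewrite le_eqVlt => /predU1P[<-|x0]; first by rewrite mulr0 addr0.
rewrite /neg_ln_trunc [x <= 0]leNgt x0 /=.
have h : Num.min k%:R (Num.max 0 (- ln x)) <= Num.max 0 (- ln x).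
  by rewrite ge_min lexx orbT.
apply: le_trans (_ : expR (Num.max 0 (- ln x)) * x <= _).
  by apply: (ler_wpM2r (ltW x0)); rewrite ler_expR.
case: (lerP 0 (- ln x)) => _; last by rewrite expR0 mul1r lerDr.
by rewrite expRN lnK ?posrE// mulVf ?gt_eqF// lerDl ltW.
Qed.

(** Off the circle the weight may be negative; the absolute value makes the integrand nonnegative on
    the whole plane and changes nothing on the circle. *)
Definition log_integrand (z : borelC R) : \bar R :=
  (`|weight z|%:E * neg_lne (W z))%E.

Let mW := measurable_circle_density mu_w.

Let mq : measurable_fun setT (fun z : borelC R => `|weight z|).
Proof. by case: (admissible_norm (@admissible_weight R)). Qed.

Lemma measurable_log_integrand : measurable_fun setT log_integrand.
Proof.
apply: emeasurable_funM; first exact/measurable_EFinP.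
exact: (measurableT_comp measurable_neg_lne mW).
Qed.

Lemma log_integrand_ge0 z : (0 <= log_integrand z)%E.
Proof. by rewrite mule_ge0 ?lee_fin ?neg_lne_ge0. Qed.

Lemma log_integral_gtNy :
  (-oo < \int[lebesgue_measure]_(theta in `[0%R, (2 * pi)%R[)
     (((1 - cos theta) ^+ 2 * (1 + cos theta) / (2 * pi))%:E
        * lne (w theta)%:E))%E
  <-> (\int[m]_z log_integrand z < +oo)%E.
Proof.
have [mw w0 _] := mu_w; have pi20 := pi2_gt0 R.
set f := fun theta => (_ * _)%E.
have wE (t : R) : (1 - cos t) ^+ 2 * (1 + cos t) = weight (expi t) by [].
have f0 (t : R) : 0 <= weight (expi t) / (2 * pi).
  by apply: divr_ge0; [apply: weight_ge0; exact: circle_expi|exact: ltW].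
have fnE (t : R) : (f^\- t = (weight (expi t) / (2 * pi))%:E * neg_lne (w t))%E.
  rewrite funenegE /f wE -neg_lneE -muleN.
  by rewrite maxe_pMr ?lee_fin// mule0.
pose g (t : R) : \bar R := ((weight (expi t))%:E * neg_lne (w t))%E.
have mg : measurable_fun `[0, 2 * pi[%classic g.
  apply: emeasurable_funM.
    apply/measurable_EFinP; apply: measurable_funTS.
    have [mwt _] := @admissible_weight R.
    exact: (measurableT_comp mwt (@measurable_expi R)).
  exact: (measurableT_comp measurable_neg_lne mw).
have HE : (\int[m]_z log_integrand z =
    \int[lebesgue_measure]_(t in `[0%R, (2 * pi)%R[) f^\- t)%E.
  rewrite (integral_circle_angles measurable_log_integrand log_integrand_ge0 mg).
    rewrite -ge0_integralZl//.
    - by apply: eq_integral => t _; rewrite fnE /g muleA -EFinM [(2 * pi)^-1 * _]mulrC.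
    - move=> t _; rewrite mule_ge0 ?neg_lne_ge0// lee_fin weight_ge0//.
      exact: circle_expi.
    - by rewrite lee_fin invr_ge0 ltW.
  move=> t t02; rewrite /log_integrand /g circle_density_expi// ger0_norm//.
  by rewrite weight_ge0//; exact: circle_expi.
rewrite HE integralE.
have p0 : (0 <= \int[lebesgue_measure]_(t in `[0%R, (2 * pi)%R[) f^\+ t)%E.
  by apply: integral_ge0 => t _; exact: funepos_ge0.
have n0 : (0 <= \int[lebesgue_measure]_(t in `[0%R, (2 * pi)%R[) f^\- t)%E.
  by apply: integral_ge0 => t _; exact: funeneg_ge0.
(* With the convention [+oo - +oo = -oo], a difference of nonnegative terms exceeds [-oo] exactly
   when the subtracted one is finite. *)
have key (x y : \bar R) : (0 <= x)%E -> (0 <= y)%E -> (-oo < x - y <-> y < +oo)%E.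
  case: y => [y|_|_]; case: x => [x| |]//=; rewrite ?ltNyr ?ltry//.
exact: key.
Qed.

Variable alpha : nat -> R[i].
Hypothesis mu_alpha : verblunsky mu alpha.

(** The test function is 1 on the null set [N] carrying [mu_s], and [exp T_k] off it. Arc length
    sees [exp T_k] while the singular part sees 1, so the bound is free of [k] and monotone
    convergence applies. *)
Lemma entropy_bounded_log_integral (K : R) :
  (forall N, - K <= entropy alpha N) -> (\int[m]_z log_integrand z < +oo)%E.
Proof.
move=> hK; have [mu_s [N [mN N0 Ns muE]]] := singular_part mu_w.
have W0 := circle_density_ge0 mu_w.
have aq := @admissible_weight R.
have mass : (\int[m]_z (W z)%:E <= 1)%E /\ (mu_s setT <= 1)%E.
  have i0 : (0 <= \int[m]_z (W z)%:E)%E by apply: integral_ge0 => z _; rewrite lee_fin.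
  have := muE setT measurableT; rewrite probability_setT => ->.
  by rewrite leeDl ?leeDr.
pose T k (z : borelC R) := neg_ln_trunc k (W z).
have mT k : measurable_fun setT (T k) := measurableT_comp (measurable_neg_ln_trunc k) mW.
have T0 k z : 0 <= T k z by case/andP: (neg_ln_trunc_bound k (W z)).
have Tk k z : T k z <= k%:R by case/andP: (neg_ln_trunc_bound k (W z)).
have aT k : admissible (T k) by split=> //; exists k%:R => z _; rewrite ger0_norm.
(* [24 = 8 * 3]: the weight is at most 8, and [g] has [mu]-mean at most 3, with 2 from the
   absolutely continuous part and 1 from [mu_s]. *)
have bound k : expect m (fun z => weight z * T k z) <= K + 24.
  pose g (z : borelC R) := \1_N z + (1 - \1_N z) * expR (T k z) : R.
  have aN := admissible_indic mN.
  have aexp : admissible (fun z => expR (T k z)).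
    split; first exact: (measurableT_comp (@measurable_expR R) (mT k)).
    by exists (expR k%:R) => z _; rewrite ger0_norm ?expR_ge0// ler_expR.
  have ag : admissible g.
    apply: admissibleD => //; apply: admissibleM => //.
    by apply: admissibleB => //; exact: admissible_cst.
  have gE z : g z = if z \in N then 1 else expR (T k z).
    by rewrite /g indicE; case: (_ \in _) => /=; ring.
  have g1 z : 1 <= g z by rewrite gE; case: ifP => // _; rewrite -expR0 ler_expR.
  have g0 z : (0 <= (g z)%:E)%E by rewrite lee_fin (le_trans _ (g1 z)).
  have [mg _] := ag.
  have EN : expect m (\1_N) = 0.
    apply: EFin_inj; rewrite (EFin_expect mC aN) integral_indic//; last exact: measurable_circle.
    have mNc := measurableI _ _ mN (@measurable_circle R).
    exact: (subset_measure0 mNc mN (@subIsetl _ N circle) N0).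
  (* The integrands differ only on [N], by at most [8 k], and [N] is null for arc length. *)
  have h1 : expect m (fun z => weight z * T k z) <= expect m (fun z => weight z * ln (g z)).
    have alg := admissible_ln ag ltr01 (fun z _ => g1 z).
    rewrite -[leRHS]addr0 -(mulr0 (8 * k%:R)) -EN -(expectZ mC _ aN).
    rewrite -expectD; [|exact: mC|exact: admissibleM|exact: admissibleZ].
    apply: (expect_le mC); first exact: admissibleM.
      by apply: admissibleD; [exact: admissibleM|exact: admissibleZ].
    move=> z cz; rewrite gE indicE; case: ifP => _ /=; last by rewrite expRK mulr0 addr0.
    by rewrite ln1 mulr0 add0r mulr1 ler_pM// ?weight_ge0 ?weight_le8.
  have h2 : expect mu (fun z => weight z * g z) <= 8 * expect mu g.
    rewrite -expectZ//; apply: expect_le => //; first exact: admissibleM.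
      exact: admissibleZ.
    move=> z cz; rewrite ler_wpM2r ?weight_le8//.
    exact: le_trans (g1 z).
  have h3 : expect mu g <= 3.
    rewrite -lee_fin (EFin_expect mu_circle ag).
    rewrite -(ge0_integral_circle mu_circle)//; last exact/measurable_EFinP.
    rewrite (integral_density mW W0 muE)//; last exact/measurable_EFinP.
    have -> : (3%:E = (1 + 1) + 1 :> \bar R)%E by rewrite -!EFinD; congr EFin; ring.
    apply: leeD.
      apply: le_trans (_ : \int[m]_z (1 + (W z)%:E) <= _)%E.
        apply: ge0_le_integral => //.
        - by move=> z _; rewrite mule_ge0// lee_fin.
        - by apply: emeasurable_funM; exact/measurable_EFinP.
        - by apply: emeasurable_funD => //; exact/measurable_EFinP.
        - move=> z _; rewrite -EFinM -EFinD lee_fin gE; case: ifP => _.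
            by rewrite mul1r lerDr.
          exact: expR_neg_ln_trunc_mul.
      rewrite ge0_integralD//; last 2 first.
      - by move=> z _; rewrite lee_fin.
      - exact/measurable_EFinP.
      apply: leeD; last by case: mass.
      by rewrite integral_cst// mul1e; exact: probability_le1.
    rewrite (@ge0_negligible_integral _ _ _ mu_s setT (~` N))//; last 2 first.
    - exact: measurableC.
    - exact/measurable_EFinP.
    rewrite setTD setCK (eq_integral (fun=> 1%E)).
      rewrite integral_cst// mul1e; apply: le_trans (mass.2).
      by apply: le_measure; rewrite ?inE.
    by move=> z zN; rewrite gE zN.
  have := expect_weight_ln_le mu_circle mu_alpha hK ag (fun z _ => g1 z).
  lra.
apply: (@le_lt_trans _ _ (K + 24)%:E); last exact: ltry.
pose F k (z : borelC R) := (`|weight z|%:E * (T k z)%:E)%E.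
have cv : (\int[m]_z F k z @[k --> \oo] --> \int[m]_z log_integrand z)%E.
  have -> : (\int[m]_z log_integrand z = \int[m]_z limn (fun k => F k z))%E.
    apply: eq_integral => z _; apply/esym/cvg_lim => //.
    by apply: cvgeZl => //; exact: neg_ln_trunc_cvg.
  apply: cvg_monotone_convergence => //.
  - by move=> k; apply: emeasurable_funM; apply/measurable_EFinP.
  - by move=> k z _; rewrite mule_ge0 ?lee_fin.
  - move=> z _ a b ab; rewrite lee_wpmul2l ?lee_fin//.
    exact: neg_ln_trunc_nondecreasing.
rewrite -(cvg_lim _ cv)//; apply: lime_le; first by apply/cvg_ex; eexists; exact: cv.
apply: nearW => k; rewrite ge0_integral_circle//; last 3 first.
- exact: mC.
- by apply: emeasurable_funM; apply/measurable_EFinP.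
- by move=> z; rewrite mule_ge0 ?lee_fin.
rewrite (eq_integral (fun z : borelC R => (weight z * T k z)%:E)); last first.
  by move=> z /set_mem cz; rewrite /F -EFinM ger0_norm ?weight_ge0.
rewrite -(EFin_expect mC (admissibleM aq (aT k))) lee_fin; exact: bound.
Qed.

(** With [h = |Phi_n|^2 / D_n], the density of [mu_n] is [1 / h] on the circle and
    [ln h = ln (h W) - ln W], at most [h W] plus the negative part of [ln W]. As [h] has [mu]-mean
    1, [h W] has integral at most 1; the constant 8 is the bound of the weight in front of it. *)
Lemma log_integral_entropy_bounded : (\int[m]_z log_integrand z < +oo)%E ->
  exists K, forall N, - K <= entropy alpha N.
Proof.
move=> Hoo; have [mu_s [N [mN N0 Ns muE]]] := singular_part mu_w.
have W0 := circle_density_ge0 mu_w.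
have aq := @admissible_weight R; have a1 := alpha_lt1 mu_alpha.
have H0 : (0 <= \int[m]_z log_integrand z)%E.
  by apply: integral_ge0 => z _; exact: log_integrand_ge0.
exists (8 + fine (\int[m]_z log_integrand z)%E) => n.
pose h (z : borelC R) := (szego_const alpha n)^-1 * normsq (szego alpha n).1.[z].
have D0 := szego_const_gt0 a1 n.
have h0 z : 0 <= h z by rewrite mulr_ge0 ?invr_ge0 ?normsq_ge0 ?ltW.
have an : admissible (fun z => normsq (szego alpha n).1.[z]).
  by apply: admissible_normsq; exact: cadmissible_horner.
have ah : admissible h by exact: admissibleZ.
have [mh _] := ah.
have Eh : expect mu h = 1.
  by rewrite /h expectZ// (expect_normsq_szego mu_circle mu_alpha) mulVf// gt_eqF.
have densE z : circle z -> szego_density alpha n z = (h z)^-1.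
  move=> cz; rewrite /h invfM invrK szego_circle// normsqM normsqX (circleE z).1//.
  by rewrite expr1n mul1r normsq_conj.
have hp z : circle z -> 0 < h z.
  by move=> cz; rewrite -invr_gt0 -densE// szego_density_gt0.
have ald := admissible_ln_szego_density mu_alpha n.
pose f (z : borelC R) := - (weight z * ln (szego_density alpha n z)).
have af : admissible f by apply: admissibleN; exact: admissibleM.
have am : admissible (fun z => Num.max 0 (f z)).
  by apply: admissible_max => //; exact: admissible_cst.
have mhW : measurable_fun setT (fun z => ((h z)%:E * (W z)%:E)%E).
  by apply: emeasurable_funM; exact/measurable_EFinP.
have hW0 z : (0 <= (h z)%:E * (W z)%:E)%E by rewrite mule_ge0 ?lee_fin.
have ihW : (\int[m]_z ((h z)%:E * (W z)%:E) <= 1)%E.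
  have := EFin_expect mu_circle ah; rewrite Eh.
  rewrite -(ge0_integral_circle mu_circle); last 2 first.
  - exact/measurable_EFinP.
  - by move=> z; rewrite lee_fin.
  rewrite (integral_density mW W0 muE); last 2 first.
  - exact/measurable_EFinP.
  - by move=> z; rewrite lee_fin.
  move=> ->; rewrite leeDl//; apply: integral_ge0 => z _; rewrite lee_fin//.
have key : ((expect m (fun z => Num.max 0 (f z)))%:E <=
    8%:E + \int[m]_z log_integrand z)%E.
  rewrite (EFin_expect mC am).
  apply: le_trans (_ : \int[m]_(z in circle)
    (8%:E * ((h z)%:E * (W z)%:E) + log_integrand z) <= _)%E.
    apply: ge0_le_integral => //.
    - exact: measurable_circle.
    - by move=> z _; rewrite lee_fin le_max lexx.
    - by apply/measurable_EFinP; apply: measurable_funTS; case: am.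
    - apply: measurable_funTS; apply: emeasurable_funD.
        exact: measurable_funeM.
      exact: measurable_log_integrand.
    move=> z cz; have q0 := weight_ge0 cz; have q8 := weight_le8 cz.
    rewrite /log_integrand ger0_norm// /neg_lne /f densE// lnV ?posrE ?hp// mulrN opprK.
    (* Where [W = 0] the right side is [+oo], unless the weight vanishes too, in which case both
       sides are 0. *)
    case: ifPn => [w0|].
      have -> : W z = 0 by apply/le_anti; rewrite w0 W0.
      rewrite mule0 mule0 add0e; move: q0; rewrite le_eqVlt => /predU1P[<-|q0].
        by rewrite mul0r mul0e maxxx.
      by rewrite gt0_muley ?lte_fin// leey.
    rewrite -ltNge => Wp; rewrite -!EFinM -EFinD lee_fin ge_max; apply/andP; split.
      apply: addr_ge0; first by apply: mulr_ge0 => //; apply: mulr_ge0.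
      by apply: mulr_ge0 => //; rewrite le_max lexx.
    have l1 : ln (h z) <= h z * W z + Num.max 0 (- ln (W z)).
      have e1 : ln (h z * W z) = ln (h z) + ln (W z) by rewrite lnM ?posrE ?hp.
      have e2 : ln (h z * W z) < h z * W z by rewrite ln_sublinear// mulr_gt0 ?hp.
      have e3 : - ln (W z) <= Num.max 0 (- ln (W z)) by rewrite le_max lexx orbT.
      lra.
    apply: le_trans (ler_wpM2l q0 l1) _; rewrite mulrDr lerD2r ler_wpM2r//.
    by rewrite mulr_ge0.
  rewrite -(ge0_integral_circle mC); last 2 first.
  - apply: emeasurable_funD; first exact: measurable_funeM.
    exact: measurable_log_integrand.
  - by move=> z; rewrite adde_ge0 ?log_integrand_ge0// mule_ge0// lee_fin.
  rewrite ge0_integralD//; last 4 first.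
  - by move=> z _; rewrite mule_ge0// lee_fin.
  - exact: measurable_funeM.
  - by move=> z _; exact: log_integrand_ge0.
  - exact: measurable_log_integrand.
  rewrite ge0_integralZl// leeD2r// -[leRHS]mule1 lee_wpmul2l//.
have Hf : (\int[m]_z log_integrand z)%E \is a fin_num by rewrite ge0_fin_numE.
rewrite -(fineK Hf) -EFinD lee_fin in key.
have le1 : expect m f <= expect m (fun z => Num.max 0 (f z)).
  by apply: (expect_le mC) => // z _; rewrite le_max lexx orbT.
have e : expect m f = - entropy alpha n.
  by rewrite /f (expectN mC)//; exact: admissibleM.
rewrite lerNl -e; exact: le_trans le1 key.
Qed.
End LogIntegral.

(** * Increments of the entropy *)

Section EntropyStep.
Variables (R : realType) (a : nat -> R[i]).
Local Notation Re := (@complex.Re R).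
Local Notation conj := (@conjc R).
Local Notation m := (@circle_measure R).
Local Notation mC := (@circle_measure_circle R).
Hypothesis a1 : forall n, ComplexField.Normc.normc (a n) < 1.

(** The factor 1/2 is the mean of the weight, its Fourier coefficient of order 0. *)
Lemma entropyE N : entropy a N =
  2^-1 * ln (szego_const a N) - Re (log_coef (szego a N).2).
Proof.
have D0 := szego_const_gt0 a1 N.
have [al <-] := expect_weight_ln (coef0_szego_dual a N)
  (fun z z1 => (szego_dual_neq0 a1 N z1).1).
have aq := @admissible_weight R.
have Eq : expect m (@weight R) = 2^-1.
  have e := @expect_weight_horner R 1; rewrite !coef1 !eqxx in e.
  have h0 k : (k.+1 == 0)%N%:R = 0 :> R[i] by [].
  rewrite !h0 mulr1n mulr1 !mulr0 !subr0 addr0 in e.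
  transitivity (expect m (fun z => weight z * Re (1 : {poly R[i]}).[z])).
    by apply: expect_eq => z _; rewrite -polyC1 hornerC mulr1.
  rewrite e.
  by have -> : (2^-1 : R[i]) = (2^-1)%:C%C by rewrite fmorphV rmorph_nat.
rewrite -Eq [expect m _ * _]mulrC -(expectZ mC _ aq) -(expectB mC); last 2 first.
- exact: admissibleZ.
- exact: admissibleM.
apply: expect_eq => z cz; rewrite /szego_density ln_div ?posrE//.
  by rewrite mulrBr [ln _ * _]mulrC.
by rewrite normsq_gt0; case: (@szego_dual_neq0 _ _ a1 N z); rewrite // (nc_circle z).1.
Qed.

Lemma coef_szego n k : (szego a n.+1).1`_k =
  (if k is j.+1 then (szego a n).1`_j else 0) - conj (a n) * (szego a n).2`_k.
Proof. by rewrite /= coefB coefZ coefXM; case: k. Qed.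

Lemma coef_szego_dual n k : (szego a n.+1).2`_k =
  (szego a n).2`_k - a n * (if k is j.+1 then (szego a n).1`_j else 0).
Proof. by rewrite /= coefB coefZ coefXM; case: k. Qed.

(** For [x, y, u, v] equal to [alpha_N, ..., alpha_(N-3)] and [f_N = Phi_N / Phi_N^*], this is
    [log_coef] of the power series [1 - x z f_N], the quotient of consecutive reversed
    polynomials. *)
Definition log_coef_step (x y u v : R[i]) : R[i] :=
  - 4^-1 * (x * conj y)
  - 2^-1 * (x * conj u * (1 - y * conj y) - 2^-1 * (x * conj y) ^+ 2)
  + 4^-1 * (x * (1 - y * conj y) * ((1 - u * conj u) * conj v - y * conj u ^+ 2)
            - x ^+ 2 * conj y * conj u * (1 - y * conj y)
            + 3^-1 * (x * conj y) ^+ 3).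

(** By the Schur recursion [f_N = (z f_(N-1) - conj alpha_(N-1)) / (1 - alpha_(N-1) z f_(N-1))], the
    coefficients of [f_N] of order 0, 1, 2 involve the three preceding [alpha] only. Three backward
    steps thus eliminate every other coefficient, whence the start at [j.+3]. *)
Lemma log_coef_szego_step j :
  log_coef (szego a j.+4).2 - log_coef (szego a j.+3).2 =
  log_coef_step (a j.+3) (a j.+2) (a j.+1) (a j).
Proof.
rewrite /log_coef /log_coef_step !(coef_szego_dual j.+3) !(coef_szego j.+2).
rewrite !(coef_szego_dual j.+2) !(coef_szego j.+1) !(coef_szego_dual j.+1).
rewrite !(coef_szego j) !coef0_szego_dual.
move: (szego a j.+1).2`_1 (szego a j.+1).2`_2 (szego a j.+1).2`_3.
move: (szego a j).1`_0 (szego a j).1`_1 (szego a j).2`_1 (szego a j).2`_2.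
move: (conj (a j)) (conj (a j.+1)) (conj (a j.+2)).
move: (a j.+1) (a j.+2) (a j.+3) => *.
by field.
Qed.

Definition entropy_step (x y u v : R[i]) : R :=
  2^-1 * ln (1 - normsq x) - Re (log_coef_step x y u v).

Lemma entropy_stepE j : entropy a j.+4 - entropy a j.+3 =
  entropy_step (a j.+3) (a j.+2) (a j.+1) (a j).
Proof.
rewrite !entropyE /entropy_step -log_coef_szego_step ReD ReN.
have a0 : 0 < 1 - normsq (a j.+3).
  by rewrite subr_gt0 normsq_normc expr_lt1 ?normc_ge0.
rewrite {1}/szego_const big_ord_recr /= -/(szego_const a j.+3).
rewrite lnM ?posrE ?szego_const_gt0//.
by move: (ln _) (ln _) (Re _) (Re _) => *; ring.
Qed.
End EntropyStep.

(** * Expansion and estimate of one entropy increment *)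

Section StepEstimate.
Variable R : realType.
Local Notation Re := (@complex.Re R).
Local Notation conj := (@conjc R).
Local Notation nc := (@ComplexField.Normc.normc R).
Implicit Types x y u v : R[i].

(** Enters only through differences of consecutive values along the sequence; it stays bounded
    there, since all [|alpha_n| < 1]. *)
Definition telescope_term x y u : R :=
  - 4^-1 * (normsq x + normsq y) + 4^-1 * Re (y * conj u)
  - 8^-1 * normsq x ^+ 2 + 4^-1 * (Re (x * conj y) * normsq x).

(** The residuals are sorted by degree and by the number of factors [x - u] or [y - v]: two in each
    term of [residual2], one in each term of [residual4], none in [residual6]. *)
Definition residual2 x y u v : R := - 4^-1 * normsq (x - u) + 4^-1 * Re ((x - u) * conj (y - v)).

Definition residual4 x y u v : R :=
  2^-1 * (Re (x * conj (x - u)) * normsq y)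
  - 4^-1 * (Re (x * conj y) * Re ((x - u) * conj (u + x)))
  - 4^-1 * (Re (x * conj (y - v)) * (normsq y + normsq u))
  - 4^-1 * Re (x * y * (conj (x - u) * conj (x + u)))
  - 4^-1 * Re (x ^+ 2 * (conj y * conj (x - u)))
  - 4^-1 * (Re ((x - u) * conj y) * normsq y).

Definition residual6 x y u v : R :=
  - 4^-1 * (Re (x * conj v) * (normsq y * normsq u)
    + Re (x * y * conj u ^+ 2) * normsq y + Re (x ^+ 2 * (conj y * conj u)) * normsq y
    + 3^-1 * Re ((x * conj y) ^+ 3)).

(* The shifts [u = x] and [v = y] turn the step into minus one eighth of the
   fourth power of [|x - y|], up to telescoping terms. *)
Lemma log_coef_step_expansion x y u v :
  - Re (log_coef_step x y u v) - 2^-1 * normsq x - 4^-1 * normsq x ^+ 2 =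
  - 8^-1 * normsq (x - y) ^+ 2 + (telescope_term x y u - telescope_term y u v)
  + residual2 x y u v + residual4 x y u v + residual6 x y u v.
Proof.
have q : [/\ (2^-1 : R[i]) = (2^-1)%:C%C, (3^-1 : R[i]) = (3^-1)%:C%C
  & (4^-1 : R[i]) = (4^-1)%:C%C] by split; rewrite fmorphV rmorph_nat.
have [q2 q3 q4] := q.
rewrite /log_coef_step q2 q3 q4.
rewrite /residual2 /residual4 /residual6 /telescope_term /normsq.
case: x y u v => [x1 x2] [y1 y2] [u1 u2] [v1 v2].
rewrite !exprS !expr0 /=.
by field.
Qed.
End StepEstimate.

Section StepBound.
Variable R : realType.
Local Notation Re := (@complex.Re R).
Local Notation conj := (@conjc R).
Local Notation nc := (@ComplexField.Normc.normc R).
Implicit Types x y u v : R[i].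

(** [ln_normsq_taylor] with two terms at a real point, where [|1 - s|^2 = (1 - s)^2]; [s <= 1/2]
    bounds [1 / (1 - s)] by 2, and division by 4 brings the constant to 1. *)
Lemma ln_1B_taylor2 (s : R) : 0 <= s <= 2^-1 ->
  `|2^-1 * ln (1 - s) + 2^-1 * s + 4^-1 * s ^+ 2| <= s ^+ 3.
Proof.
move=> /andP[s0 s1]; have s1' : s < 1 by lra.
have := @ln_normsq_taylor R s%:C%C 2; rewrite nc_real ger0_norm// => /(_ s1').
have -> : normsq (1 - s%:C%C) = (1 - s) ^+ 2 by rewrite /normsq /=; ring.
have -> : \sum_(j < 2) s%:C%C ^+ j.+1 / j.+1%:R = (s + s ^+ 2 / 2)%:C%C :> R[i].
  rewrite !big_ord_recr big_ord0 rmorphD rmorphM fmorphV rmorphXn rmorph_nat.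
  by rewrite [X in X + _](_ : _ = s%:C%C)// [X in X + _ = _]add0r expr1 divr1.
rewrite lnXn ?subr_gt0//=.
move=> h.
have -> : 2^-1 * ln (1 - s) + 2^-1 * s + 4^-1 * s ^+ 2 =
    4^-1 * (ln (1 - s) *+ 2 + 2 * (s + s ^+ 2 / 2)) by field.
rewrite normrM ger0_norm ?invr_ge0// ler_pdivrMl//.
apply: le_trans h _; rewrite ler_pdivrMr ?subr_gt0//.
have s3 : 0 <= s ^+ 3 by rewrite exprn_ge0.
have : 4 * s ^+ 3 * 2^-1 <= 4 * s ^+ 3 * (1 - s) by rewrite ler_wpM2l ?mulr_ge0//; lra.
lra.
Qed.

Lemma nc_le_Re x c : nc x <= c -> `|Re x| <= c.
Proof. exact: le_trans (Re_le_normc x). Qed.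

Lemma normsq_le x c : nc x <= c -> normsq x <= c ^+ 2.
Proof.
move=> h; rewrite normsq_normc lerXn2r ?nnegrE ?normc_ge0//.
exact: le_trans (normc_ge0 x) h.
Qed.

(** The logarithm and [residual6] cost [t^6] each, [residual2] costs [e^2 / 2], and the six terms of
    [residual4] cost [5 t^3 e / 2], split by [2 t^3 e <= e^2 + t^6]; the constant 4 covers the
    total. *)
Lemma entropy_step_bound x y u v (t e : R) : normsq x <= 2^-1 ->
  nc x <= t -> nc y <= t -> nc u <= t -> nc v <= t ->
  nc (x - u) <= e -> nc (y - v) <= e ->
  `|entropy_step x y u v + 8^-1 * normsq (x - y) ^+ 2
    - (telescope_term x y u - telescope_term y u v)| <= 4 * (e ^+ 2 + t ^+ 6).
Proof.
move=> x2 xt yt ut vt xe ye.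
have t0 : 0 <= t := le_trans (normc_ge0 x) xt.
have e0 : 0 <= e := le_trans (normc_ge0 _) xe.
have mulc (p q : R[i]) (c d : R) : nc p <= c -> nc q <= d -> nc (p * q) <= c * d.
  by move=> pc qd; rewrite ncM ler_pM ?normc_ge0.
have cj (p : R[i]) (c : R) : nc p <= c -> nc (conj p) <= c by rewrite nc_conj.
have ad (p q : R[i]) (c d : R) : nc p <= c -> nc q <= d -> nc (p + q) <= c + d.
  by move=> pc qd; rewrite (le_trans (ncD _ _))// lerD.
have mulr (p q c d : R) : `|p| <= c -> `|q| <= d -> `|p * q| <= c * d.
  by move=> pc qd; rewrite normrM ler_pM.
have nq (p : R[i]) (c : R) : nc p <= c -> `|normsq p| <= c ^+ 2.
  by move=> pc; rewrite ger0_norm ?normsq_ge0// normsq_le.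
have ex := log_coef_step_expansion x y u v.
set S := _ - _; have -> : S = (2^-1 * ln (1 - normsq x) + 2^-1 * normsq x
    + 4^-1 * normsq x ^+ 2)
    + (residual2 x y u v + residual4 x y u v + residual6 x y u v).
  by rewrite /S /entropy_step; move: ex; lra.
have b0 : `|2^-1 * ln (1 - normsq x) + 2^-1 * normsq x + 4^-1 * normsq x ^+ 2|
    <= t ^+ 6.
  apply: le_trans (ln_1B_taylor2 _) _; first by rewrite normsq_ge0.
  by rewrite (exprM t 2 3) lerXn2r ?nnegrE ?normsq_ge0 ?exprn_ge0// normsq_le.
have p1 := nq _ _ xe.
have p2 := nc_le_Re (mulc _ _ _ _ xe (cj _ _ ye)).
have b2 : `|residual2 x y u v| <= 2^-1 * e ^+ 2.
  by move: p1 p2; rewrite /residual2 !ler_norml => /andP[? ?] /andP[? ?]; lra.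
have r1 := mulr _ _ _ _ (nc_le_Re (mulc _ _ _ _ xt (cj _ _ xe))) (nq _ _ yt).
have r2 := mulr _ _ _ _ (nc_le_Re (mulc _ _ _ _ xt (cj _ _ yt)))
  (nc_le_Re (mulc _ _ _ _ xe (cj _ _ (ad _ _ _ _ ut xt)))).
have n2 : `|normsq y + normsq u| <= t ^+ 2 + t ^+ 2.
  by rewrite (le_trans (ler_normD _ _))// lerD// nq.
have r3 := mulr _ _ _ _ (nc_le_Re (mulc _ _ _ _ xt (cj _ _ ye))) n2.
have r4 := nc_le_Re (mulc _ _ _ _ (mulc _ _ _ _ xt yt)
  (mulc _ _ _ _ (cj _ _ xe) (cj _ _ (ad _ _ _ _ xt ut)))).
have xx : nc (x ^+ 2) <= t * t by rewrite expr2 mulc.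
have r5 := nc_le_Re (mulc _ _ _ _ xx (mulc _ _ _ _ (cj _ _ yt) (cj _ _ xe))).
have r6 := mulr _ _ _ _ (nc_le_Re (mulc _ _ _ _ xe (cj _ _ yt))) (nq _ _ yt).
have b4 : `|residual4 x y u v| <= 5 * 2^-1 * (t ^+ 3 * e).
  move: r1 r2 r3 r4 r5 r6; rewrite /residual4 !ler_norml.
  by do 6 (move=> /andP[? ?]); lra.
have uu : nc (conj u ^+ 2) <= t * t by rewrite expr2 mulc ?cj.
have s1 := mulr _ _ _ _ (nc_le_Re (mulc _ _ _ _ xt (cj _ _ vt)))
  (mulr _ _ _ _ (nq _ _ yt) (nq _ _ ut)).
have s2 := mulr _ _ _ _ (nc_le_Re (mulc _ _ _ _ (mulc _ _ _ _ xt yt) uu)) (nq _ _ yt).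
have s3 := mulr _ _ _ _ (nc_le_Re (mulc _ _ _ _ xx (mulc _ _ _ _ (cj _ _ yt) (cj _ _ ut))))
  (nq _ _ yt).
have xy3 : nc ((x * conj y) ^+ 3) <= t ^+ 6.
  by rewrite (exprM t 2 3) ncX lerXn2r ?nnegrE ?normc_ge0 ?exprn_ge0// expr2 mulc ?cj.
have s4 := nc_le_Re xy3.
have b6 : `|residual6 x y u v| <= t ^+ 6.
  have t6 : 0 <= t ^+ 6 by rewrite exprn_ge0.
  move: s1 s2 s3 s4; rewrite /residual6 !ler_norml.
  by do 4 (move=> /andP[? ?]); lra.
have sq : 2 * (t ^+ 3 * e) <= e ^+ 2 + t ^+ 6.
  by rewrite -subr_ge0 (_ : _ - _ = (t ^+ 3 - e) ^+ 2) ?sqr_ge0//; ring.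
have t6 : 0 <= t ^+ 6 by rewrite exprn_ge0.
have e2 : 0 <= e ^+ 2 by rewrite exprn_ge0.
move: b0 b2 b4 b6; rewrite !ler_norml.
by do 4 (move=> /andP[? ?]); lra.
Qed.
End StepBound.

(** * Series with bounded partial sums *)

Section BoundedSums.
Variable R : realType.
Local Notation nc := (@ComplexField.Normc.normc R).
Implicit Types u v : nat -> R.

(** Summability for nonnegative terms, stated in [R] so that finite sums and [lra] apply; [ell_bsum]
    links it to [ell]. *)
Definition bsum u := exists K, forall N, \sum_(i < N) u i <= K.

Lemma bsum_le u v : (forall n, u n <= v n) -> bsum v -> bsum u.
Proof.
move=> uv [K hK]; exists K => N; apply: le_trans (hK N).
by apply: ler_sum => i _; exact: uv.
Qed.

Lemma bsumD u v : bsum u -> bsum v -> bsum (fun n => u n + v n).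
Proof.
move=> [K hK] [L hL]; exists (K + L) => N.
by rewrite big_split; exact: lerD.
Qed.

Lemma bsumZ c u : 0 <= c -> bsum u -> bsum (fun n => c * u n).
Proof.
by move=> c0 [K hK]; exists (c * K) => N; rewrite -mulr_sumr ler_wpM2l.
Qed.

Lemma sum_shift u k N :
  \sum_(i < (k + N)%N) u i = \sum_(i < k) u i + \sum_(i < N) u (k + i)%N.
Proof. by rewrite big_split_ord. Qed.

Lemma bsum_shift k u : (forall n, 0 <= u n) ->
  bsum u <-> bsum (fun n => u (k + n)%N).
Proof.
move=> u0; split=> -[K hK].
  exists K => N; apply: le_trans (hK (k + N)%N).
  by rewrite sum_shift lerDr sumr_ge0.
exists (\sum_(i < k) u i + K) => N.
apply: le_trans (_ : \sum_(i < (k + N)%N) u i <= _).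
  by rewrite addnC sum_shift lerDl sumr_ge0.
by rewrite sum_shift lerD2l.
Qed.

Lemma bsum_eventually_le u e : (forall n, 0 <= u n) -> bsum u -> 0 < e ->
  exists N, forall n, (N <= n)%N -> u n <= e.
Proof.
move=> u0 [K hK] e0.
have nd : nondecreasing_seq (series u).
  by apply/nondecreasing_seqP => n; rewrite /series /= big_nat_recr//= lerDl.
have cv : cvgn (series u).
  apply: nondecreasing_is_cvgn => //; exists K => _ [n _ <-].
  by rewrite /series /= big_mkord.
have /cvgrPdist_le/(_ e e0)[N _ hN] := cvg_series_cvg_0 cv.
exists N => n /hN /=; rewrite sub0r normrN => h; exact: le_trans (ler_norm _) h.
Qed.

Lemma ell_bsum (p : nat) (x : nat -> R[i]) : ell p x <-> bsum (fun n => nc (x n) ^+ p).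
Proof.
have p0 n : 0 <= nc (x n) ^+ p by rewrite exprn_ge0// normc_ge0.
have sE N : (\sum_(0 <= n < N) (nc (x n) ^+ p)%:E = (\sum_(i < N) nc (x i) ^+ p)%:E)%E.
  by rewrite sumEFin big_mkord.
rewrite /ell; split=> [foo|[K hK]].
  set S := (\sum_(0 <= n <oo) _)%E in foo.
  have S0 : (0 <= S)%E by apply: nneseries_ge0 => n _ _; rewrite lee_fin.
  have Sf : S \is a fin_num by rewrite ge0_fin_numE.
  exists (fine S) => N; rewrite -lee_fin -sE fineK//.
  by apply: nneseries_lim_ge => n _; rewrite lee_fin.
apply: (@le_lt_trans _ _ K%:E); last exact: ltry.
apply: lime_le.
  by apply: is_cvg_nneseries => n _ _; rewrite lee_fin.
by apply: nearW => N; rewrite sE lee_fin.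
Qed.

Lemma pow6D (a b : R) : 0 <= a -> 0 <= b -> (a + b) ^+ 6 <= 64 * (a ^+ 6 + b ^+ 6).
Proof.
wlog ab : a b / a <= b.
  move=> H a0 b0; have [/H|/ltW /H] := leP a b; first exact.
  by rewrite [b + a]addrC [_ + a ^+ 6]addrC; exact.
move=> a0 b0; apply: le_trans (_ : (2 * b) ^+ 6 <= _).
  by rewrite lerXn2r ?nnegrE ?addr_ge0 ?mulr_ge0//; lra.
rewrite exprMn; have := exprn_ge0 6 a0; have -> : 2 ^+ 6 = 64 :> R by ring.
lra.
Qed.
Lemma pow4D (a b : R) : 0 <= a -> 0 <= b -> (a + b) ^+ 4 <= 16 * (a ^+ 4 + b ^+ 4).
Proof.
wlog ab : a b / a <= b.
  move=> H a0 b0; have [/H|/ltW /H] := leP a b; first exact.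
  by rewrite [b + a]addrC [_ + a ^+ 4]addrC; exact.
move=> a0 b0; apply: le_trans (_ : (2 * b) ^+ 4 <= _).
  by rewrite lerXn2r ?nnegrE ?addr_ge0 ?mulr_ge0//; lra.
rewrite exprMn; have := exprn_ge0 4 a0; have -> : 2 ^+ 4 = 16 :> R by ring.
lra.
Qed.
End BoundedSums.

(** * Asymptotics of the entropy and the two difference conditions *)

Section EntropyAsymptotics.
Variables (R : realType) (a : nat -> R[i]).
Local Notation Re := (@complex.Re R).
Local Notation nc := (@ComplexField.Normc.normc R).
Hypothesis a1 : forall n, nc (a n) < 1.
Hypothesis a2 : bsum (fun n => nc (a n.+2 - a n) ^+ 2).
Hypothesis a6 : bsum (fun n => nc (a n) ^+ 6).

Let d n := nc (a n.+1 - a n).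

(** Sums rather than maxima: [t] and [e] dominate every modulus needed by [entropy_step_bound], and
    their sixth and second powers inherit summability from those of the summands. *)
Let t n := (nc (a n.+3) + nc (a n.+2)) + (nc (a n.+1) + nc (a n)).
Let e n := nc (a n.+3 - a n.+1) + nc (a n.+2 - a n).

Let shift_bsum k (u : nat -> R) : (forall n, 0 <= u n) -> bsum u ->
  bsum (fun n => u (k + n)%N).
Proof. by move=> u0 /(bsum_shift k u0). Qed.

Let error_bsum : bsum (fun n => 4 * (e n ^+ 2 + t n ^+ 6)).
Proof.
have n2 n : 0 <= nc (a n.+2 - a n) ^+ 2 by rewrite exprn_ge0// normc_ge0.
have n6 n : 0 <= nc (a n) ^+ 6 by rewrite exprn_ge0// normc_ge0.
apply: bsumZ => //; apply: bsumD.
  apply: (bsum_le _ (bsumZ (ler0n R 2) (bsumD (shift_bsum 1 n2 a2) a2))) => n.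
  rewrite /e add1n; move: (nc _) (nc _) => p q.
  rewrite -subr_ge0 (_ : _ - _ = (p - q) ^+ 2) ?sqr_ge0//; ring.
have h k := shift_bsum k n6 a6.
apply: (bsum_le _ (bsumZ (ler0n R 64) (bsumD
  (bsumZ (ler0n R 64) (bsumD (h 3) (h 2))) (bsumZ (ler0n R 64) (bsumD (h 1) a6))))) => n.
rewrite /t !addSn !add0n; apply: le_trans (pow6D _ _) _; rewrite ?addr_ge0 ?normc_ge0//.
by rewrite ler_wpM2l// lerD// pow6D ?normc_ge0.
Qed.

Let W n := telescope_term (a n.+2) (a n.+1) (a n).

Let W_bound n : `|W n| <= 2.
Proof.
have nle k : nc (a k) <= 1 by exact/ltW.
have q k : 0 <= normsq (a k) <= 1.
  by rewrite normsq_ge0 normsq_normc expr_le1 ?normc_ge0 ?nle.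
have r i j : `|Re (a i * conjc (a j))| <= 1.
  rewrite (le_trans (Re_le_normc _))// ncM nc_conj.
  by rewrite -[leRHS]mul1r ler_pM ?normc_ge0.
have s i : `|normsq (a i) ^+ 2| <= 1.
  rewrite ger0_norm ?exprn_ge0 ?normsq_ge0// expr_le1 ?normsq_ge0//.
  by have /andP[] := q i.
have p i j k : `|Re (a i * conjc (a j)) * normsq (a k)| <= 1.
  rewrite normrM -[leRHS]mul1r ler_pM//.
  by rewrite ger0_norm ?normsq_ge0//; have /andP[] := q k.
rewrite /W /telescope_term.
move: (q n.+2) (q n.+1) (r n.+1 n) (s n.+2) (p n.+2 n.+1 n.+2).
rewrite !ler_norml.
by do 5 (move=> /andP[? ?]); lra.
Qed.

Lemma entropy_asymptotics : exists n0 K, forall N,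
  `|entropy a (n0 + N).+1 + 8^-1 * \sum_(i < N) nc (a (n0 + i).+1 - a (n0 + i)%N) ^+ 4|
    <= K.
Proof.
have n6 n : 0 <= nc (a n) ^+ 6 by rewrite exprn_ge0// normc_ge0.
(* The cube of 1/2: [|a_n|^6 <= 1/8] gives [|a_n|^2 <= 1/2], as the expansion of the logarithm
   requires. *)
have e8 : 0 < 8^-1 :> R by rewrite invr_gt0.
have [M hM] := bsum_eventually_le n6 a6 e8.
have small n : (M <= n)%N -> normsq (a n) <= 2^-1.
  move=> /hM; rewrite normsq_normc (exprM _ 2 3) => h.
  rewrite -(@ler_pXn2r _ 3) ?nnegrE ?exprn_ge0 ?normc_ge0 ?invr_ge0//.
  by have -> : 2^-1 ^+ 3 = 8^-1 :> R by field.
have [K hK] : bsum (fun i => 4 * (e (M + i)%N ^+ 2 + t (M + i)%N ^+ 6)).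
  apply: (shift_bsum M _ error_bsum) => n.
  by rewrite mulr_ge0// addr_ge0// exprn_ge0// ?addr_ge0 ?normc_ge0.
(* The step formula at [M + j] relates the entropies of index [M + j + 3] and [M + j + 4], and
   involves the difference of index [M + j + 2]. The constant 4 bounds [|W (M + N) - W M|]. *)
exists M.+2, (`|entropy a M.+3| + 4 + K) => N.
have step j : `|(entropy a (M + j).+4 - entropy a (M + j).+3)
    + 8^-1 * nc (a (M + j).+3 - a (M + j).+2) ^+ 4
    - (W (M + j).+1 - W (M + j))|
    <= 4 * (e (M + j)%N ^+ 2 + t (M + j)%N ^+ 6).
  rewrite (entropy_stepE a1) (exprM _ 2 2) -normsq_normc.
  have g0 := normc_ge0.
  apply: entropy_step_bound.
  - by apply: small; rewrite -addn3 -addnA leq_addr.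
  - rewrite /t; have := g0 _ (a (M + j).+2); have := g0 _ (a (M + j).+1).
    have := g0 _ (a (M + j)%N); lra.
  - rewrite /t; have := g0 _ (a (M + j).+3); have := g0 _ (a (M + j).+1).
    have := g0 _ (a (M + j)%N); lra.
  - rewrite /t; have := g0 _ (a (M + j).+2); have := g0 _ (a (M + j).+3).
    have := g0 _ (a (M + j)%N); lra.
  - rewrite /t; have := g0 _ (a (M + j).+2); have := g0 _ (a (M + j).+1).
    have := g0 _ (a (M + j).+3); lra.
  - rewrite /e; have := g0 _ (a (M + j).+2 - a (M + j)%N); lra.
  - rewrite /e; have := g0 _ (a (M + j).+3 - a (M + j).+1); lra.
have sum_step : `|(entropy a (M.+3 + N)%N - entropy a M.+3)
    + 8^-1 * (\sum_(i < N) nc (a (M.+3 + i)%N - a (M.+3 + i).-1) ^+ 4)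
    - (W (M + N) - W M)|
    <= \sum_(i < N) 4 * (e (M + i)%N ^+ 2 + t (M + i)%N ^+ 6).
  elim: N => [|N IH].
    by rewrite !big_ord0 !addn0 !subrr mulr0 !addr0 subrr normr0.
  rewrite !big_ord_recr /= (le_trans _ (lerD IH (step N)))//.
  apply: le_trans (ler_normD _ _); rewrite le_eqVlt; apply/orP; left; apply/eqP.
  rewrite !addSn !addnS /=; congr (`|_|).
  move: (entropy _ _) (entropy _ _) (entropy _ _) (\sum_(_ < _) _) (W _) (W _) (W _) => *.
  by ring.
rewrite -[X in entropy a X]/(M.+3 + N)%N.
rewrite -[X in _ + 8^-1 * X]/(\sum_(i < N) nc (a (M.+3 + i)%N - a (M.+3 + i).-1) ^+ 4).
have := hK N; have := W_bound (M + N); have := W_bound M.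
move: sum_step; have := ler_norm (entropy a M.+3).
have := ler_norm (- entropy a M.+3); rewrite normrN.
rewrite !ler_norml => ? ? /andP[? ?] /andP[? ?] /andP[? ?] ?.
by apply/andP; split; lra.
Qed.

Lemma entropy_bounded_iff :
  (exists K, forall N, - K <= entropy a N) <-> bsum (fun n => d n ^+ 4).
Proof.
have [n0 [K hK]] := entropy_asymptotics.
have d0 n : 0 <= d n ^+ 4 by rewrite exprn_ge0 ?normc_ge0.
split=> [[L hL]|].
  apply/(bsum_shift n0 d0); exists (8 * (K + L)) => N.
  have := hK N; have := hL (n0 + N).+1; rewrite /d ler_norml => ? /andP[_ ?].
  by rewrite -ler_pdivrMl//; lra.
move=> /(bsum_shift n0 d0)[L hL].
have L0 : 0 <= L by have := hL 0%N; rewrite big_ord0.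
have K0 : 0 <= K by exact: le_trans (hK 0%N).
(* The asymptotic formula starts at index [n0 + 1]; [S] covers the finitely many earlier
   entropies. *)
pose S := \sum_(i < n0.+1) `|entropy a i|.
have S0 : 0 <= S by exact: sumr_ge0.
exists (S + K + L) => N; have [Nn|nN] := ltnP N n0.+1.
  have : `|entropy a N| <= S.
    by rewrite /S (bigD1 (Ordinal Nn)) //= lerDl sumr_ge0.
  have := ler_norm (- entropy a N); rewrite normrN; lra.
rewrite -(subnKC nN) addSn; have := hL (N - n0.+1)%N; have := hK (N - n0.+1)%N.
rewrite ler_norml /d => /andP[? _] ?; lra.
Qed.

(** Twice a first difference is a second difference plus a two-step one: [2 (a_(n+2) - a_(n+1)) =
    (a_(n+2) - 2 a_(n+1) + a_n) + (a_(n+2) - a_n)]. The two-step difference is in [l^2] and bounded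
    by 2, hence in [l^4]. Conversely, a second difference is a difference of two first ones. *)
Lemma second_difference_bsum :
  bsum (fun n => nc (a n.+2 - a n.+1 - (a n.+1 - a n)) ^+ 4) <->
  bsum (fun n => d n ^+ 4).
Proof.
have d0 n : 0 <= d n ^+ 4 by rewrite exprn_ge0 ?normc_ge0.
split=> h.
  have b4 : bsum (fun n => nc (a n.+2 - a n) ^+ 4).
    apply: (bsum_le _ (bsumZ (ler0n R 4) a2)) => n.
    have b2 : nc (a n.+2 - a n) <= 2.
      have := ncB (a n.+2) (a n); have := a1 n.+2; have := a1 n; lra.
    have b4 : nc (a n.+2 - a n) ^+ 2 <= 2 ^+ 2.
      by rewrite lerXn2r ?nnegrE ?normc_ge0.
    have -> : nc (a n.+2 - a n) ^+ 4 = nc (a n.+2 - a n) ^+ 2 * nc (a n.+2 - a n) ^+ 2.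
      by rewrite -exprD.
    by rewrite ler_wpM2r ?exprn_ge0 ?normc_ge0//; move: b4; rewrite !expr2; lra.
  apply/(bsum_shift 1 d0); apply: (bsum_le _ (bsumD h b4)) => n.
  rewrite -(@ler_pM2l _ 16)//.
  have -> : 16 * d (1 + n) ^+ 4 = nc ((a n.+2 - a n.+1 - (a n.+1 - a n))
      + (a n.+2 - a n)) ^+ 4.
    have -> : (a n.+2 - a n.+1 - (a n.+1 - a n)) + (a n.+2 - a n) =
      (2 : R)%:C%C * (a n.+2 - a n.+1) by rewrite rmorph_nat; ring.
    by rewrite ncM nc_real ger0_norm// exprMn /d add1n; congr (_ * _); ring.
  apply: le_trans (pow4D (normc_ge0 _) (normc_ge0 _)).
  by rewrite lerXn2r ?nnegrE ?addr_ge0 ?normc_ge0// ncD.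
have := bsumZ (ler0n R 16) (bsumD ((bsum_shift 1 d0).1 h) h).
apply: bsum_le => n; apply: le_trans (pow4D (normc_ge0 _) (normc_ge0 _)).
by rewrite lerXn2r ?nnegrE ?addr_ge0 ?normc_ge0// ncB.
Qed.
End EntropyAsymptotics.

Theorem theorem1p3 (R : realType) (mu : probability (borelC R) R)
    (alpha : nat -> R[i]) (w : R -> R)
    (mu_circle : on_unit_circle mu)
    (mu_supp : infinite_set (measure_support mu))
    (mu_alpha : verblunsky mu alpha)
    (mu_w : ac_density mu w)
    (alpha2 : ell 2 (((@shift_seq R \- idfun) \o (@shift_seq R \+ idfun)) alpha))
    (alpha6 : ell 6 alpha) :
  (-oo < \int[lebesgue_measure]_(theta in `[0%R, (2 * pi)%R[)
     (((1 - cos theta) ^+ 2 * (1 + cos theta) / (2 * pi))%:E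
        * lne (w theta)%:E))%E
  <-> ell 4 (((@shift_seq R \- idfun) \o (@shift_seq R \- idfun)) alpha).
Proof.
have a1 := alpha_lt1 mu_alpha.
have diffE n : ((@shift_seq R \- idfun) \o (@shift_seq R \+ idfun)) alpha n =
    alpha n.+2 - alpha n.
  by rewrite -[LHS]/(alpha n.+2 + alpha n.+1 - (alpha n.+1 + alpha n)); ring.
have a2 : bsum (fun n => ComplexField.Normc.normc (alpha n.+2 - alpha n) ^+ 2).
  by move/ell_bsum: alpha2; apply: bsum_le => n; rewrite diffE.
have a6 := (ell_bsum _ _).1 alpha6.
apply: iff_trans (log_integral_gtNy mu_w) _.
apply: iff_trans (_ : (exists K, forall N, - K <= entropy alpha N) <-> _).
  split; first exact: log_integral_entropy_bounded mu_circle mu_w _ mu_alpha.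
  by case=> K; exact: entropy_bounded_log_integral mu_circle mu_w _ mu_alpha K.
apply: iff_trans (entropy_bounded_iff a1 a2 a6) _.
apply: iff_trans (iff_sym (second_difference_bsum a1 a2)) _.
exact: iff_sym (ell_bsum 4 _).
Qed.
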